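(* Let $Y$ be a dissociated RCE matrix. Let $h$ be a $p\times q$ kernel function such that $\mathbb{E}[h(Y_{(1,\dots,p;1,\dots,q)})^2]<\infty$. Let $(m_N,n_N)_{N\ge1}$ be a sequence of dimensions with $m_N+n_N=N$, such that $\frac{m_N}{N}\to\rho$ and $\frac{n_N}{N}\to1-\rho$ as $N\to\infty$, where $\rho\in(0,1)$. Let $U^h_N:=U^h_{m_N,n_N}(Y)$, set $U^h_\infty=\mathbb{E}[h(Y_{(1,\dots,p;1,\dots,q)})]$ and $$V^h=\frac{p^2}{\rho}v^{1,0}_h+\frac{q^2}{1-\rho}v^{0,1}_h.$$ If $V^h>0$, then $$\sqrt{N}\,(U^h_N-U^h_\infty)\xrightarrow[N\to\infty]{\mathcal{D}}\mathcal{N}(0,V^h).$$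
   Context: Notation: $\mathbb{N}=\{1,2,\dots\}$, $[n]=\{1,\dots,n\}$, and $\mathcal{P}_k(A)$ is the set of subsets of $A$ of cardinality $k$. RCE matrices. An infinite real random matrix $Y=(Y_{ij})_{i,j\ge1}$ is row-column exchangeable (RCE) if for all finite permutations $\sigma_1,\sigma_2$ of $\mathbb{N}$, $(Y_{\sigma_1(i)\sigma_2(j)})_{i,j\ge1}$ has the same distribution as $Y$. It is dissociated if for all $m,n$, $(Y_{ij})_{i\le m,j\le n}$ is independent of $(Y_{ij})_{i>m,j>n}$. AHK (Aldous-Hoover-Kallenberg) representation. For a dissociated RCE matrix $Y$ one fixes a measurable function $\phi$ and mutually independent families $(\xi_i)_{i\ge1},(\eta_j)_{j\ge1},(\zeta_{ij})_{i,j\ge1}$ of i.i.d. uniform $[0,1]$ variables with $Y_{ij}=\phi(\xi_i,\eta_j,\zeta_{ij})$ almost surely. Kernels and $U$-statistics. A kernel function of size $p\times q$ ($p,q\ge1$) is a measurable $h:\mathcal{M}_{p,q}(\mathbb{R})\to\mathbb{R}$ invariant under permutations of the rows and of the columns of its matrix argument. For $\mathbf{i}\in\mathcal{P}_p(\mathbb{N})$, $\mathbf{j}\in\mathcal{P}_q(\mathbb{N})$, $h(Y_{\mathbf{i},\mathbf{j}})$ is $h$ applied to the submatrix of $Y$ with rows $\mathbf{i}$ and columns $\mathbf{j}$ (in any order); $Y_{(1,\dots,p;1,\dots,q)}$ is the leading $p\times q$ submatrix. For $m\ge p$, $n\ge q$, $$U^h_{m,n}(Y)=\binom{m}{p}^{-1}\binom{n}{q}^{-1}\sum_{\mathbf{i}\in\mathcal{P}_p([m]),\,\mathbf{j}\in\mathcal{P}_q([n])}h(Y_{\mathbf{i},\mathbf{j}})$$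 (in sequences indexed by $N$, only $N$ large enough that $m_N\ge p$, $n_N\ge q$ matter). Variances. $v^{1,0}_h:=\mathrm{Var}\big(\mathbb{E}[h(Y_{[p],[q]})\mid\xi_1]\big)$ and $v^{0,1}_h:=\mathrm{Var}\big(\mathbb{E}[h(Y_{[p],[q]})\mid\eta_1]\big)$. *)

(* Defs.v *)
From HB Require Import structures.
From mathcomp Require Import all_boot all_order all_fingroup all_algebra.
From mathcomp Require Import all_classical all_reals all_analysis.

Set Implicit Arguments.
Unset Strict Implicit.
Unset Printing Implicit Defensive.

Import Order.TTheory GRing.Theory Num.Theory.
Import numFieldNormedType.Exports.

Local Open Scope classical_set_scope.
Local Open Scope ring_scope.

(* Rows and columns are indexed from 0: the first n indices are {0, ..., n-1}. *)

Section SigmaAlgebras.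
Context {R : realType}.

(* The sigma-algebra generated by the real functions [X i], [i] in [D]. With
   [X] the coordinate maps of a space of matrices and [D := setT], this is its
   product sigma-algebra (the Borel one when the matrices are finite). *)
Definition sigma_family {I S : Type} (D : set I) (X : I -> S -> R) :
    set (set S) :=
  <<s \bigcup_(i in D) preimage_set_system setT (X i) measurable >>.

Definition sigma_var {S : Type} (X : S -> R) : set (set S) :=
  preimage_set_system setT X measurable.

End SigmaAlgebras.

Section Probability.
Context {d : measure_display} {T : measurableType d} {R : realType}.
Variable P : probability T R.

(* Equality of the laws of two families of real random variables, as
   probability measures on the product space [I -> R]. *)
Definition same_law {I : Type} (X X' : I -> T -> R) : Prop :=
  forall A : set (I -> R), sigma_family setT (fun i x => x i) A ->
    P [set w | A (X ^~ w)] = P [set w | A (X' ^~ w)].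

Definition independent_systems (F G : set (set T)) : Prop :=
  forall A B, F A -> G B -> P (A `&` B) = (P A * P B)%E.

Definition mutually_independent {I : eqType} (X : I -> T -> R) : Prop :=
  forall (s : seq I) (B : I -> set R), uniq s ->
    (forall i, measurable (B i)) ->
    P (\bigcap_(i in [set` s]) X i @^-1` B i) =
    (\prod_(i <- s) P (X i @^-1` B i))%E.

Definition uniform01 (X : {RV P >-> R}) : Prop :=
  forall B : set R, measurable B ->
    distribution P X B = uniform_prob (@ltr01 R) B.

Definition is_cond_expectation (F : set (set T)) (X Z : T -> R) : Prop :=
  [/\ forall B : set R, measurable B -> F (Z @^-1` B),
      P.-integrable setT (EFin \o Z) &
      forall A, F A ->
        (\int[P]_(w in A) (Z w)%:E = \int[P]_(w in A) (X w)%:E)%E].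

(* A version of E[X | F]; meaningful when [X] is integrable and [F] is a
   sub-sigma-algebra of the events. *)
Definition cond_expectation (F : set (set T)) (X : T -> R) : T -> R :=
  xget (fun=> 0) [set Z | is_cond_expectation F X Z].

(* Convergence of the distribution functions at the continuity points of the
   limiting one. *)
Definition cvg_in_distribution (X : nat -> T -> R) (mu : set R -> \bar R) :
    Prop :=
  forall x : R, {for x, continuous (fun y : R => mu `]-oo, y]%classic)} ->
    P [set w | X N w <= x] @[N --> \oo] --> mu `]-oo, x]%classic.

End Probability.

Section RowColumnExchangeable.
Context {d : measure_display} {T : measurableType d} {R : realType}.
Variable P : probability T R.

Definition finite_permutation (s : nat -> nat) : Prop :=
  bijective s /\ exists n, forall i, (n <= i)%N -> s i = i.

Definition RCE (Y : nat -> nat -> {RV P >-> R}) : Prop :=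
  forall s1 s2, finite_permutation s1 -> finite_permutation s2 ->
    same_law P (fun ij : nat * nat => Y (s1 ij.1) (s2 ij.2) : T -> R)
               (fun ij : nat * nat => Y ij.1 ij.2 : T -> R).

Definition dissociated (Y : nat -> nat -> {RV P >-> R}) : Prop :=
  forall m n : nat,
    let Yf (ij : nat * nat) : T -> R := Y ij.1 ij.2 in
    independent_systems P
      (sigma_family [set ij | (ij.1 < m)%N /\ (ij.2 < n)%N] Yf)
      (sigma_family [set ij | (m <= ij.1)%N /\ (n <= ij.2)%N] Yf).

Definition AHK_variables (xi eta : nat -> {RV P >-> R})
    (zeta : nat -> nat -> {RV P >-> R}) (k : nat + nat + nat * nat) :
    {RV P >-> R} :=
  match k with
  | inl (inl i) => xi i
  | inl (inr j) => eta j
  | inr (i, j) => zeta i j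
  end.

Definition unit_cube : set (R * R * R) :=
  `[0, 1] `*` `[0, 1] `*` `[0, 1].

Definition AHK_representation (Y : nat -> nat -> {RV P >-> R})
    (phi : R * R * R -> R) (xi eta : nat -> {RV P >-> R})
    (zeta : nat -> nat -> {RV P >-> R}) : Prop :=
  [/\ measurable_fun unit_cube phi,
      mutually_independent P (fun k => AHK_variables xi eta zeta k : T -> R),
      forall k, uniform01 (AHK_variables xi eta zeta k) &
      forall i j, {ae P, forall w, Y i j w = phi (xi i w, eta j w, zeta i j w)}].

End RowColumnExchangeable.

Section UStatistics.
Context {d : measure_display} {T : measurableType d} {R : realType}.
Variable P : probability T R.

Definition kernel_function {p q : nat} (h : 'M[R]_(p, q) -> R) : Prop :=
  (forall B : set R, measurable B ->
     sigma_family setT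
       (fun (ab : 'I_p * 'I_q) (M : 'M[R]_(p, q)) => M ab.1 ab.2) (h @^-1` B))
  /\ forall (s : 'S_p) (t : 'S_q) (M : 'M[R]_(p, q)),
       h (row_perm s (col_perm t M)) = h M.

Definition submatrix (Y : nat -> nat -> {RV P >-> R}) {p q : nat}
    (r : 'I_p -> nat) (c : 'I_q -> nat) (w : T) : 'M[R]_(p, q) :=
  \matrix_(a < p, b < q) Y (r a) (c b) w.

Definition leading_submatrix (Y : nat -> nat -> {RV P >-> R}) (p q : nat) :
    T -> 'M[R]_(p, q) :=
  submatrix Y (fun a => a : nat) (fun b => b : nat).

(* The elements of a set of indices, in increasing order. *)
Definition elements {m : nat} (A : {set 'I_m}) (a : nat) : nat :=
  nth 0%N [seq val i | i <- enum A] a.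

Definition Ustat {p q : nat} (h : 'M[R]_(p, q) -> R)
    (Y : nat -> nat -> {RV P >-> R}) (m n : nat) (w : T) : R :=
  ('C(m, p)%:R)^-1 * ('C(n, q)%:R)^-1 *
  \sum_(A : {set 'I_m} | #|A| == p) \sum_(B : {set 'I_n} | #|B| == q)
    h (submatrix Y (fun a => elements A a) (fun b => elements B b) w).

Definition Uinfty {p q : nat} (h : 'M[R]_(p, q) -> R)
    (Y : nat -> nat -> {RV P >-> R}) : R :=
  fine 'E_P[h \o leading_submatrix Y p q].

(* Var(E[h(Y) | X]) for the leading submatrix of [Y]. *)
Definition kernel_cond_var {p q : nat} (h : 'M[R]_(p, q) -> R)
    (Y : nat -> nat -> {RV P >-> R}) (X : {RV P >-> R}) : R :=
  fine 'V_P[cond_expectation P (sigma_var X) (h \o leading_submatrix Y p q)].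

Definition asymptotic_variance {p q : nat} (h : 'M[R]_(p, q) -> R)
    (Y : nat -> nat -> {RV P >-> R}) (xi eta : nat -> {RV P >-> R}) (rho : R) :
    R :=
  p%:R ^+ 2 / rho * kernel_cond_var h Y (xi 0%N) +
  q%:R ^+ 2 / (1 - rho) * kernel_cond_var h Y (eta 0%N).

End UStatistics.

(* Main.v *)
From HB Require Import structures.
Require Import Defs.
From mathcomp Require Import all_boot all_order all_fingroup all_algebra.
From mathcomp Require Import all_classical all_reals all_analysis.
From mathcomp Require Import measurable_realfun.
From mathcomp Require Import ring lra zify.

(* By the AHK representation the U-statistic is a function of a countable family of
   i.i.d. variables, so that its law can be studied on the product of their laws.
   Each kernel value minus its mean is the sum of its projections on the row
   variables [xi_i] and on the column variables [eta_j] and of a residual whose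
   conditional mean given any single variable vanishes. Two residuals whose index
   sets share at most one row or column in total are uncorrelated, by resampling
   the variables they do not share. Counting the other pairs, the averaged residual
   has variance O(1/N^2), so that it disappears after multiplication by sqrt N and
   a weighted sum of independent centered variables remains.

   That sum is treated by Lindeberg's exchange method. A test function only has to
   satisfy a second-order Taylor bound with error C min(y^2, |y|^3). Convolution
   with a Gaussian density preserves such bounds, and the Gaussian densities form a
   convolution semigroup (complete the square), so that the variables can be
   exchanged one at a time. Cubic B-spline steps satisfy the Taylor bound by algebra
   and squeeze the distribution function. *)

Set Implicit Arguments.
Unset Strict Implicit.
Unset Printing Implicit Defensive.

Import Order.TTheory GRing.Theory Num.Theory.
Import numFieldNormedType.Exports.

Local Open Scope ring_scope.

(** * Counting index sets *)

Section draws.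
Local Open Scope nat_scope.

(** Resampling needs independent copies of the variables, which the original probability space need
    not carry; on the product space a copy is just a second point, and conditional means become
    Fubini integrals over it. Likewise the Gaussian comparison variables are never realized: they
    enter only as smoothing operators acting on test functions. The kernel has only a second moment,
    so a third-order Taylor error alone could not be integrated; [min(y^2, |y|^3)] is integrable
    under a second moment and is still negligible after scaling, by dominated convergence.
    Projecting on single row and column variables is enough: a cell variable common to two index
    sets comes with a common row and a common column, and such pairs are about as rare as those with
    two common rows. Finally, [m N / N] only tends to [rho], so the linear part is compared with
    weights whose total variance is exactly the limiting one, and the discrepancy joins the residual
    in the remainder. *)

Lemma card_draws_containing (T : finType) (D : {set T}) p : #|D| <= p ->
  #|[set A : {set T} | (D \subset A) && (#|A| == p)]| = 'C(#|T| - #|D|, p - #|D|).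
Proof.
move=> Dp.
have -> : #|T| - #|D| = #|~: D| by rewrite -cardsT -cardsDS ?finset.subsetT// finset.setTD.
rewrite -cards_draws.
pose X := [set B : {set T} | B \subset ~: D & #|B| == p - #|D|].
have subX B : B \in X -> forall z, z \in B -> z \notin D.
  by rewrite inE => /andP[/fintype.subsetP BD _] z /BD; rewrite inE.
(* Adding [D] is inverse to removing it, hence injective on the subsets of the complement of [D]. *)
rewrite -/X -[RHS](@card_in_imset _ _ (fun B => B :|: D)); last first.
  move=> B B' /subX BD /subX B'D /setP E; apply/setP => z.
  have := E z; rewrite !inE; have [zD|zD] := boolP (z \in D); last by rewrite !orbF.
  have -> : z \in B = false by apply/negP => /BD; rewrite zD.
  by have -> : z \in B' = false by apply/negP => /B'D; rewrite zD.
apply: eq_card => A; rewrite inE; apply/idP/imsetP.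
  move=> /andP[DA /eqP Ap]; exists (A :\: D).
    rewrite inE cardsDS// Ap eqxx andbT; apply/fintype.subsetP => z.
    by rewrite !inE => /andP[].
  apply/setP => z; rewrite !inE; have /fintype.subsetP/(_ z) := DA.
  by case: (z \in D) => //= [->|_] //; rewrite orbF.
move=> [B BX ->]; rewrite finset.subsetUr/= cardsU.
have -> : B :&: D = finset.set0.
  by apply/setP => z; rewrite !inE; apply/negP => /andP[/(subX _ BX)/negP].
rewrite cards0 subn0.
by move: BX; rewrite inE => /andP[_ /eqP ->]; rewrite subnK.
Qed.

Definition overlap m p := \sum_(A : {set 'I_m} | #|A| == p)
  \sum_(A' : {set 'I_m} | #|A'| == p) #|A :&: A'|.

(** The summand counts ordered pairs of distinct common elements. Unlike the indicator of having two
    common elements, which it dominates, it sums to a closed form by double counting. *)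
Definition overlap2 m p := \sum_(A : {set 'I_m} | #|A| == p)
  \sum_(A' : {set 'I_m} | #|A'| == p) #|A :&: A'| * #|A :&: A'|.-1.

(** Double counting: for a fixed [i] the sets [A] and [A'] containing [D i] are chosen independently
    of each other, whence the square. *)
Lemma sum_draws_exchange m p (I : finType) (Q : pred I) (D : I -> {set 'I_m}) :
  \sum_(A : {set 'I_m} | #|A| == p) \sum_(A' : {set 'I_m} | #|A'| == p)
    \sum_(i | Q i) ((D i \subset A) && (D i \subset A')) =
  \sum_(i | Q i) #|[set A : {set 'I_m} | (D i \subset A) && (#|A| == p)]| ^ 2.
Proof.
transitivity (\sum_(i | Q i) \sum_(A : {set 'I_m} | #|A| == p)
    \sum_(A' : {set 'I_m} | #|A'| == p) ((D i \subset A) && (D i \subset A'))).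
  by rewrite [RHS]exchange_big; apply: eq_bigr => A _; exact: exchange_big.
apply: eq_bigr => i _.
have cardE : \sum_(A : {set 'I_m} | #|A| == p) (D i \subset A) =
    #|[set A : {set 'I_m} | (D i \subset A) && (#|A| == p)]|.
  rewrite -sum1_card big_mkcond [RHS]big_mkcond; apply: eq_bigr => A _.
  by rewrite inE; case: (D i \subset A); case: (#|A| == p).
rewrite -cardE expnS expn1 big_distrlr/=.
by apply: eq_bigr => A _; apply: eq_bigr => A' _; rewrite mulnb.
Qed.

Lemma overlapE m p : 0 < p -> overlap m p = m * 'C(m.-1, p.-1) ^ 2.
Proof.
move=> p0; rewrite /overlap.
transitivity (\sum_(A : {set 'I_m} | #|A| == p) \sum_(A' : {set 'I_m} | #|A'| == p)
    \sum_(i : 'I_m) (([set i] \subset A) && ([set i] \subset A'))).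
  apply: eq_bigr => A _; apply: eq_bigr => A' _.
  rewrite -sum1_card big_mkcond; apply: eq_bigr => i _.
  by rewrite !finset.sub1set inE; case: (i \in A); case: (i \in A').
rewrite (@sum_draws_exchange m p 'I_m xpredT (fun i => [set i])).
under eq_bigr do rewrite card_draws_containing ?cards1// card_ord !subn1.
by rewrite sum_nat_const card_ord.
Qed.

(** For [p = 1] the truncated [p.-2] would turn the right-hand side into [m * m.-1], although two
    singletons never share two elements; that case is [overlap2_1]. *)
Lemma overlap2E m p : 1 < p -> overlap2 m p = m * m.-1 * 'C(m.-2, p.-2) ^ 2.
Proof.
move=> p1; rewrite /overlap2.
transitivity (\sum_(A : {set 'I_m} | #|A| == p) \sum_(A' : {set 'I_m} | #|A'| == p)
    \sum_(ij : 'I_m * 'I_m | ij.1 != ij.2)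
    (([set ij.1; ij.2] \subset A) && ([set ij.1; ij.2] \subset A'))).
  apply: eq_bigr => A _; apply: eq_bigr => A' _.
  rewrite -(pair_big_dep xpredT (fun i j => i != j)
    (fun i j => (([set i; j] \subset A) && ([set i; j] \subset A') : nat)))/=.
  rewrite -sum_nat_const big_mkcond/=; apply: eq_bigr => i _.
  have -> : \sum_(j | i != j) ([set i; j] \subset A) && ([set i; j] \subset A') =
      if i \in A :&: A' then #|(A :&: A') :\ i| else 0.
    case: ifPn => iA.
      rewrite -sum1_card big_mkcond [RHS]big_mkcond; apply: eq_bigr => j _.
      move: iA; rewrite !finset.subUset !finset.sub1set !inE eq_sym => /andP[-> ->]/=.
      by case: (j == i); case: (j \in A); case: (j \in A').
    rewrite big1// => j _; move: iA; rewrite !finset.subUset !finset.sub1set !inE.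
    by case: (i \in A) => //= /negbTE ->; rewrite andbF.
  by case: ifP => // iA; rewrite (cardsD1 i (A :&: A')) iA.
rewrite (@sum_draws_exchange m p _ (fun ij => ij.1 != ij.2) (fun ij => [set ij.1; ij.2])).
under eq_bigr => ij ij12.
  rewrite card_draws_containing cards2 ij12// card_ord !subn2; over.
rewrite sum_nat_const; congr (_ * _).
rewrite -sum1_card (eq_bigl (fun ij => xpredT ij.1 && (ij.1 != ij.2)))//.
rewrite -(pair_big_dep xpredT (fun i j : 'I_m => i != j) (fun _ _ => 1))/=.
rewrite (eq_bigr (fun=> m.-1)); last first.
  move=> i _; rewrite sum1_card -[in RHS](card_ord m) -[in RHS](cardC (pred1 i)) card1/=.
  by apply: eq_card => j; rewrite !inE eq_sym.
by rewrite sum_nat_const card_ord.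
Qed.

Lemma overlap2_1 m : overlap2 m 1 = 0.
Proof.
rewrite /overlap2 big1// => A /eqP A1; rewrite big1// => A' _.
have : #|A :&: A'| <= 1 by rewrite -A1 subset_leq_card// finset.subsetIl.
by case: #|_| => // -[].
Qed.

End draws.

Section draws_ratio.
Context {R : realType}.

(** This is the probability that a uniformly drawn [p]-subset contains a given element. *)
Lemma draws_ratio m p : (0 < p <= m)%N ->
  ('C(m.-1, p.-1))%:R / ('C(m, p))%:R = p%:R / m%:R :> R.
Proof.
move=> /andP[p0 pm].
have := mul_bin_diag m p.-1; rewrite prednK// => E.
have C0 : ('C(m, p))%:R != 0 :> R by rewrite pnatr_eq0 -lt0n bin_gt0.
have m0 : m%:R != 0 :> R by rewrite pnatr_eq0 -lt0n (leq_trans p0).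
apply/eqP; rewrite eqr_div//; apply/eqP.
by rewrite -!natrM mulnC E.
Qed.

Lemma overlap_ratio m p : (0 < p <= m)%N ->
  (overlap m p)%:R / ('C(m, p))%:R ^+ 2 = p%:R ^+ 2 / m%:R :> R.
Proof.
move=> pm; have /andP[p0 pm'] := pm.
have m0 : m%:R != 0 :> R by rewrite pnatr_eq0 -lt0n (leq_trans p0).
rewrite overlapE// natrM natrX -mulrA -expr_div_n draws_ratio// expr_div_n.
by field.
Qed.

Lemma overlap2_ratio m p : (0 < p <= m)%N -> (1 < m)%N ->
  (overlap2 m p)%:R / ('C(m, p))%:R ^+ 2 =
  (p%:R * (p.-1)%:R) ^+ 2 / (m%:R * (m.-1)%:R) :> R.
Proof.
move=> pm m1; have /andP[p0 pm'] := pm.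
have m0 : m%:R != 0 :> R by rewrite pnatr_eq0 -lt0n (leq_trans p0).
have m10 : m.-1%:R != 0 :> R by rewrite pnatr_eq0; case: m m1 {pm pm' m0} => [|[]].
(* For singletons both sides vanish, the right one through [p.-1 = 0]. *)
have [p1|p1] := leqP p 1.
  have -> : p = 1%N by apply/eqP; rewrite eqn_leq p1.
  by rewrite overlap2_1 !mul0r mulr0 expr0n/= mul0r.
rewrite overlap2E// (natrM _ (m * m.-1)%N) (natrM _ m) natrX.
have -> : ('C(m.-2, p.-2))%:R = (p.-1)%:R / (m.-1)%:R * ('C(m.-1, p.-1))%:R :> R.
  rewrite -(@draws_ratio m.-1 p.-1); last by lia.
  rewrite divfK// pnatr_eq0 -lt0n bin_gt0; lia.
have C0 : ('C(m, p))%:R != 0 :> R by rewrite pnatr_eq0 -lt0n bin_gt0.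
have -> : ('C(m.-1, p.-1))%:R = p%:R / m%:R * ('C(m, p))%:R :> R.
  by rewrite -draws_ratio// divfK.
by field; rewrite m0 m10 C0.
Qed.

Lemma avg_draws_cst m p (c : R) : (p <= m)%N ->
  ('C(m, p))%:R^-1 * \sum_(A : {set 'I_m} | #|A| == p) c = c.
Proof.
move=> pm; rewrite sumr_const.
have -> : #|(fun A : {set 'I_m} => #|A| == p)| = 'C(m, p).
  by rewrite -[m in RHS]card_ord -card_draws; apply: eq_card => A; rewrite inE.
by rewrite -[c *+ _]mulr_natl mulKf// pnatr_eq0 -lt0n bin_gt0.
Qed.

(** Each index lies in the same number of [p]-subsets; this is the origin of the factors [p] and [q]
    in the limiting variance. *)
Lemma avg_draws_sum m p (F : 'I_m -> R) : (0 < p <= m)%N ->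
  ('C(m, p))%:R^-1 * \sum_(A : {set 'I_m} | #|A| == p) \sum_(i in A) F i =
  p%:R / m%:R * \sum_(i < m) F i.
Proof.
move=> pm; have /andP[p0 pm'] := pm.
have -> : \sum_(A : {set 'I_m} | #|A| == p) \sum_(i in A) F i =
    ('C(m.-1, p.-1))%:R * \sum_(i < m) F i; last by rewrite -draws_ratio// mulrCA mulrA.
transitivity (\sum_(i < m) \sum_(A : {set 'I_m} | (#|A| == p) && (i \in A)) F i).
  rewrite [RHS](exchange_big_dep (fun A : {set 'I_m} => #|A| == p))/=; last first.
    by move=> i A _ /andP[].
  by apply: eq_bigr => A Ap; apply: eq_bigl => i; rewrite Ap.
rewrite mulr_sumr; apply: eq_bigr => i _.
rewrite sumr_const mulr_natl; congr (_ *+ _).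
rewrite -!subn1 -[m in RHS]card_ord -(cards1 i) -card_draws_containing ?cards1//.
by apply: eq_card => A; rewrite inE finset.sub1set andbC.
Qed.

End draws_ratio.

Local Open Scope classical_set_scope.

(** * Products of copies of the real line *)

Section canonical_space.
Context {R : realType} {K : choiceType}.

Definition coords : set (set (K -> R)) :=
  \bigcup_(k in setT) preimage_set_system setT (fun x : K -> R => x k) measurable.

Definition prodspace := g_sigma_algebraType coords.

Lemma measurable_coord k : measurable_fun setT (fun x : prodspace => x k).
Proof.
move=> _ B mB; apply: sub_sigma_algebra; exists k => //; exists B => //.
Qed.

Lemma measurable_to_prodspace d (T : measurableType d) (f : T -> prodspace) :
  (forall k, measurable_fun setT (fun w => f w k)) -> measurable_fun setT f.
Proof.
move=> mf; apply: (@measurability _ _ _ _ _ f coords) => //.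
move=> _ [B [k _ [C mC <-]] <-]; rewrite setTI.
have := mf k measurableT C mC.
by rewrite !setTI.
Qed.

Definition cylinder (s : seq K) (B : K -> set R) : set prodspace :=
  \bigcap_(k in [set` s]) (fun x : prodspace => x k) @^-1` B k.

Lemma measurable_cylinder s B : (forall k, measurable (B k)) ->
  measurable (cylinder s B).
Proof.
move=> mB; apply: fin_bigcap_measurable => // k _.
by rewrite -[X in measurable X]setTI; exact: measurable_coord.
Qed.

(** The cylinders are stable under intersection and generate the product sigma-algebra, so that the
    uniqueness theorem for finite measures applies. *)
Lemma measure_cylinder_unique (m1 m2 : {measure set prodspace -> \bar R}) :
  (m1 setT < +oo)%E ->
  (forall s B, uniq s -> (forall k, measurable (B k)) ->
    m1 (cylinder s B) = m2 (cylinder s B)) ->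
  forall A, measurable A -> m1 A = m2 A.
Proof.
move=> m1T m12.
pose G := [set A | exists s B, [/\ uniq s, forall k, measurable (B k) &
  A = cylinder s B]].
have GT : G setT.
  by exists [::], (fun=> setT); split => //; rewrite /cylinder set_nil bigcap_set0.
apply: (@measure_unique _ _ _ G (fun=> setT)) => //.
- apply/seteqP; split; last first.
    apply: smallest_sub; first exact: sigma_algebra_measurable.
    move=> _ [s [B [_ mB ->]]]; exact: measurable_cylinder.
  apply: smallest_sub; first exact: smallest_sigma_algebra.
  move=> _ [k _ [B mB <-]]; apply: sub_sigma_algebra.
  exists [:: k], (fun=> B); split => //; rewrite setTI /cylinder set_cons1.
  by rewrite bigcap_set1.
- move=> _ _ [s [B [us mB ->]]] [s' [B' [us' mB' ->]]].
  (* A coordinate constrained by only one of the two cylinders gets [setT] from the other. *)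
  pose C k := (if k \in s then B k else setT) `&` (if k \in s' then B' k else setT).
  exists (undup (s ++ s')), C; split; first exact: undup_uniq.
    by move=> k; apply: measurableI; case: ifP.
  apply/seteqP; split=> x.
    move=> [xs xs'] k /=; rewrite mem_undup mem_cat /C => kss; split.
      by case: ifP => // ks; apply: xs.
    by case: ifP => // ks; apply: xs'.
  move=> xC; split => k /= ks; have := xC k; rewrite /= mem_undup mem_cat ks ?orbT /C.
    by move=> /(_ isT)[]; rewrite ks.
  by move=> /(_ isT)[]; rewrite ks.
- by apply/seteqP; split => // x _; exists 0%N.
- by move=> _ [s [B [us mB ->]]]; exact: m12.
Qed.

End canonical_space.
Arguments prodspace : clear implicits.

Section iid_law.
Context {R : realType} {K : choiceType} (mu : probability (prodspace R K) R)
  (nu : probability R R).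

(** The list has to be duplicate-free: a repeated coordinate would contribute its factor several
    times to the product. *)
Definition iid_law := forall s (B : K -> set R), uniq s ->
  (forall k, measurable (B k)) ->
  mu (cylinder s B) = (\prod_(k <- s) nu (B k))%E.

Hypothesis mu_iid : iid_law.

(** With [xy.2] an independent copy of [xy.1], this resamples the coordinates outside [I]. *)
Definition mix (I : pred K) (xy : prodspace R K * prodspace R K) : prodspace R K :=
  fun k => if I k then xy.1 k else xy.2 k.

Lemma measurable_mix I : measurable_fun setT (mix I).
Proof.
apply: measurable_to_prodspace => k; rewrite /mix; case: (I k).
  exact: (measurableT_comp (measurable_coord k) measurable_fst).
exact: (measurableT_comp (measurable_coord k) measurable_snd).
Qed.

HB.instance Definition _ I := isMeasurableFun.Build _ _ _ _ (mix I) (measurable_mix I).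

(** The preimage of a cylinder is a rectangle: the constraints in [I] bear on the first point, the
    others on the second, and the product over the list splits accordingly. *)
Lemma mix_law I A : measurable A ->
  pushforward (mu \x mu)%E (mix I) A = mu A.
Proof.
move=> mA; apply/esym.
apply: (@measure_cylinder_unique _ _ mu (pushforward (mu \x mu)%E (mix I))) => //.
  by rewrite (le_lt_trans (probability_le1 mu measurableT)) ?ltry.
move=> s B us mB.
apply: (etrans (mu_iid us mB)); rewrite /pushforward.
have mixE : mix I @^-1` (cylinder s B) =
    cylinder [seq k <- s | I k] B `*` cylinder [seq k <- s | predC I k] B.
  apply/seteqP; split=> -[x y] /=.
    move=> xyB; split=> k /=; rewrite mem_filter => /andP[Ik ks].
      by have := xyB k ks; rewrite /mix/= Ik.
    by have := xyB k ks; rewrite /mix/= (negbTE Ik).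
  move=> [xB yB] k /= ks; rewrite /mix/=; case: ifPn => Ik.
    by apply: xB; rewrite /= mem_filter Ik.
  by apply: yB; rewrite /= mem_filter /= Ik.
apply: (etrans _ (congr1 (mu \x mu)%E (esym mixE))).
rewrite product_measure1E; [|exact: measurable_cylinder..].
rewrite (bigID I)/= -!(big_filter s).
by congr (_ * _)%E; apply/esym; apply: mu_iid => //; exact: filter_uniq.
Qed.

Definition relabel (tau : K -> K) (x : prodspace R K) : prodspace R K := x \o tau.

Lemma measurable_relabel tau : measurable_fun setT (relabel tau).
Proof. by apply: measurable_to_prodspace => k; exact: measurable_coord. Qed.

HB.instance Definition _ tau := isMeasurableFun.Build _ _ _ _ (relabel tau)
  (measurable_relabel tau).

(** Injectivity ensures that distinct new coordinates read distinct, hence independent, old ones. *)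
Lemma relabel_law tau A : injective tau -> measurable A ->
  pushforward mu (relabel tau) A = mu A.
Proof.
move=> tau_inj mA; apply/esym.
apply: (@measure_cylinder_unique _ _ mu (pushforward mu (relabel tau))) => //.
  by rewrite (le_lt_trans (probability_le1 mu measurableT)) ?ltry.
move=> s B us mB; apply: (etrans (mu_iid us mB)); rewrite /pushforward.
(* The constraint on the coordinate [k] moves to [tau k]; coordinates outside the image of the list
   get the default [setT]. *)
pose C k := nth setT (map B s) (index k (map tau s)).
have CE k : k \in s -> C (tau k) = B k.
  move=> ks; rewrite /C index_map// (nth_map k) ?index_mem//.
  by rewrite nth_index.
have reE : relabel tau @^-1` (cylinder s B) = cylinder (map tau s) C.
  apply/seteqP; split=> x xB k /=.
    by move=> /mapP[i iS ->]; rewrite CE//; exact: xB.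
  by move=> ks; have := xB (tau k); rewrite CE//; apply; exact: map_f.
apply: (etrans _ (congr1 mu (esym reE))).
rewrite [RHS]mu_iid; last 2 first.
- by rewrite map_inj_uniq.
- move=> k; rewrite /C; have [ks|ks] := ltnP (index k (map tau s)) (size (map B s)).
    have /mapP[i _ ->] := mem_nth setT ks; exact: mB.
  by rewrite nth_default.
by rewrite big_map big_seq [RHS]big_seq; apply: eq_bigr => k ks; rewrite CE.
Qed.

End iid_law.

(** * Square-integrable functions and decoupling of coordinates *)

Section transfer.
Context d d' (T : measurableType d) (T' : measurableType d') (R : realType)
  (m : {measure set T -> \bar R}) (m' : {measure set T' -> \bar R})
  (g : {mfun T' >-> T}).
Hypothesis gm : forall A, measurable A -> pushforward m' g A = m A.

Lemma ge0_integral_transfer (f : T -> \bar R) : measurable_fun setT f ->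
  (forall x, 0 <= f x)%E -> (\int[m]_x f x = \int[m']_y f (g y))%E.
Proof.
move=> mf f0; rewrite -(@eq_measure_integral _ _ _ _ _ (pushforward m' g)); last first.
  by move=> A mA _; exact: gm.
by rewrite ge0_integral_pushforward.
Qed.

Lemma integrable_transfer (f : T -> R) : measurable_fun setT f ->
  m'.-integrable setT (EFin \o (f \o g)) <-> m.-integrable setT (EFin \o f).
Proof.
move=> mf; have intE : (\int[m]_x `|(f x)%:E| = \int[m']_y `|(f (g y))%:E|)%E.
  rewrite (@ge0_integral_transfer (fun x => `|(f x)%:E|%E))//.
  by apply: measurableT_comp => //; exact/measurable_EFinP.
split => /integrableP[mfg fgoo]; apply/integrableP; split.
- exact/measurable_EFinP.
- by rewrite /= intE.
- by apply/measurable_EFinP; exact: measurableT_comp.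
- by rewrite /= -intE.
Qed.

Lemma Rintegral_transfer (f : T -> R) : m.-integrable setT (EFin \o f) ->
  \int[m]_x f x = \int[m']_y f (g y).
Proof.
move=> intf; rewrite /Rintegral; congr fine.
rewrite -(@eq_measure_integral _ _ _ _ _ (pushforward m' g)); last first.
  by move=> A mA _; exact: gm.
have mf : measurable_fun setT f by apply/measurable_EFinP; apply: measurable_int intf.
rewrite integral_pushforward//=; first exact/measurable_EFinP.
exact/integrable_transfer.
Qed.

End transfer.

Section square_integrable.
Context d (T : measurableType d) (R : realType) (m : probability T R).

Definition L2 (f : T -> R) :=
  measurable_fun setT f /\ m.-integrable setT (EFin \o (fun x => f x ^+ 2)).

Lemma Rintegral_prob_cst (c : R) : \int[m]__ c = c.
Proof.
by rewrite /Rintegral integral_cst//= probability_setT mule1.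
Qed.

Lemma L2_mul f g : L2 f -> L2 g -> m.-integrable setT (EFin \o (fun x => f x * g x)).
Proof.
move=> [mf f2] [mg g2].
apply: (le_integrable _ _ _ (integrableD measurableT f2 g2)) => //.
  by apply/measurable_EFinP; exact: measurable_funM.
move=> x _ /=; rewrite lee_fin.
rewrite [leRHS]ger0_norm ?addr_ge0 ?sqr_ge0// ler_norml.
by apply/andP; split; nra.
Qed.

(** From [2 f g <= f^2 + g^2], which for equal second moments gives the Cauchy-Schwarz bound. *)
Lemma Rintegral_mul_le f g c : L2 f -> L2 g ->
  \int[m]_x (f x ^+ 2) = c -> \int[m]_x (g x ^+ 2) = c -> \int[m]_x (f x * g x) <= c.
Proof.
move=> Lf Lg fc gc; have [_ f2] := Lf; have [_ g2] := Lg.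
have -> : c = 2^-1 * (\int[m]_x (f x ^+ 2) + \int[m]_x (g x ^+ 2)).
  by rewrite fc gc; field.
have fg2 := integrableD measurableT f2 g2.
rewrite -RintegralD// -RintegralZl//.
apply: le_Rintegral => //; first exact: L2_mul.
  exact: (integrableZl measurableT 2^-1 fg2).
by move=> x _; have := sqr_ge0 (f x - g x); rewrite sqrrB; lra.
Qed.

Lemma L2_cst c : L2 (fun=> c).
Proof. by split => //; exact: finite_measure_integrable_cst. Qed.

Lemma L2_int f : L2 f -> m.-integrable setT (EFin \o f).
Proof.
move=> f2; have := L2_mul (L2_cst 1) f2.
by congr integrable; apply/funext => x /=; rewrite mul1r.
Qed.

Lemma L2Z c f : L2 f -> L2 (fun x => c * f x).
Proof.
move=> [mf f2]; split; first exact: measurable_funM.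
have := integrableZl measurableT (c ^+ 2) f2.
by congr integrable; apply/funext => x /=; rewrite exprMn.
Qed.

Lemma L2D f g : L2 f -> L2 g -> L2 (fun x => f x + g x).
Proof.
move=> Lf Lg; have [mf f2] := Lf; have [mg g2] := Lg.
split; first exact: measurable_funD.
have := integrableD measurableT (integrableD measurableT f2 g2)
  (integrableZl measurableT 2 (L2_mul Lf Lg)).
by congr integrable; apply/funext => x /=; congr EFin; ring.
Qed.

Lemma L2B f g : L2 f -> L2 g -> L2 (fun x => f x - g x).
Proof.
move=> Lf Lg; have := L2D Lf (L2Z (-1) Lg).
by congr L2; apply/funext => x; rewrite mulN1r.
Qed.

Lemma L2_sum I (s : seq I) (Q : pred I) (F : I -> T -> R) :
  (forall i, L2 (F i)) -> L2 (fun x => \sum_(i <- s | Q i) F i x).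
Proof.
move=> LF; elim: s => [|i s IH].
  by under eq_fun do rewrite big_nil; exact: L2_cst.
by under eq_fun do rewrite big_cons; case: (Q i) => //; exact: L2D.
Qed.

Lemma integrable_Rsum I (s : seq I) (Q : pred I) (F : I -> T -> R) :
  (forall i, m.-integrable setT (EFin \o F i)) ->
  m.-integrable setT (EFin \o (fun x => \sum_(i <- s | Q i) F i x)).
Proof.
move=> iF; rewrite (_ : _ \o _ = (fun x => \sum_(i <- s | Q i) (F i x)%:E)%E).
  by apply: integrable_sum => // i _; exact: iF.
by apply/funext => x; rewrite /= sumEFin.
Qed.

Lemma Rintegral_sum I (s : seq I) (Q : pred I) (F : I -> T -> R) :
  (forall i, m.-integrable setT (EFin \o F i)) ->
  \int[m]_x \sum_(i <- s | Q i) F i x = \sum_(i <- s | Q i) \int[m]_x F i x.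
Proof.
move=> iF; rewrite /Rintegral; under eq_integral do rewrite -sumEFin.
rewrite (integral_sum measurableT iF s Q) sum_fine// => i _.
by apply: integrable_fin_num => //; exact: iF.
Qed.

(** Nonnegativity of the variance. In extended reals no integrability is required, so that the
    inequality can be applied to every slice of a function on a product. *)
Lemma sqr_integral_le (f : T -> R) : measurable_fun setT f ->
  (((\int[m]_x f x) ^+ 2)%:E <= \int[m]_x (f x ^+ 2)%:E)%E.
Proof.
move=> mf; have mf2 : measurable_fun setT (EFin \o (fun x => f x ^+ 2)).
  by apply/measurable_EFinP; exact: measurable_funX.
have [foo|] := ltP (\int[m]_x (f x ^+ 2)%:E)%E +oo%E; last first.
  by move=> /(le_trans _); apply; exact: leey.
have f2 : m.-integrable setT (EFin \o (fun x => f x ^+ 2)).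
  apply/integrableP; split => //=.
  by under eq_integral do rewrite ger0_norm ?sqr_ge0//.
have Lf : L2 f by [].
set a := \int[m]_x f x.
have : (0 <= \int[m]_x ((f x - a) ^+ 2))%R.
  by apply: Rintegral_ge0 => x _; exact: sqr_ge0.
have -> : (fun x => (f x - a) ^+ 2) = (fun x => (f x ^+ 2 - (2 * a) * f x) + a ^+ 2).
  by apply/funext => x; ring.
have ia : m.-integrable setT (EFin \o (fun x => 2 * a * f x)).
  exact/L2_int/L2Z.
rewrite RintegralD//; last 2 first.
- have := integrableB measurableT f2 ia.
  by congr integrable; apply/funext => x /=; by [].
- exact: finite_measure_integrable_cst.
rewrite RintegralB// RintegralZl//; last exact: L2_int.
rewrite Rintegral_prob_cst -/a.
rewrite -[X in (_ <= X)%E]fineK; last exact: integrable_fin_num.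
by rewrite lee_fin /Rintegral; lra.
Qed.

Lemma ae_Rintegral0 (f : T -> R) : measurable_fun setT f ->
  {ae m, forall x, f x = 0} -> \int[m]_x f x = 0.
Proof.
move=> mf f0; rewrite /Rintegral (ae_eq_integral (cst 0%E))//; last first.
- by apply: filterS f0 => x /= ->.
- exact/measurable_EFinP.
by rewrite integral0.
Qed.

End square_integrable.

(** * Resampling and conditional means given one coordinate *)

Section decoupling.
Context {R : realType} {K : choiceType} (mu : probability (prodspace R K) R)
  (nu : probability R R).
Hypothesis mu_iid : iid_law mu nu.

Notation prod_mu := (product_measure1 mu mu).

Lemma integrable_mix I (f : prodspace R K -> R) : mu.-integrable setT (EFin \o f) ->
  prod_mu.-integrable setT (EFin \o (fun z => f (mix I z))).
Proof.
move=> intf; have mf : measurable_fun setT f.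
  by apply/measurable_EFinP; exact: measurable_int intf.
by apply/(integrable_transfer (mix_law mu_iid I)).
Qed.

Lemma Rintegral_mix I (f : prodspace R K -> R) : mu.-integrable setT (EFin \o f) ->
  \int[mu]_x f x = \int[mu]_x \int[mu]_y f (mix I (x, y)).
Proof.
move=> intf; rewrite (Rintegral_transfer (mix_law mu_iid I))//.
have imix := integrable_mix I intf.
rewrite /Rintegral -(integral12_prod_meas1 imix); congr fine.
apply: ae_eq_integral => //.
- exact: (measurable_fubini_F imix).
- apply/measurable_EFinP; apply: measurableT_comp => //.
  exact: (measurable_fubini_F imix).
apply: filterS (ae_integrable1 imix) => x /= ix _.
by rewrite /fubini_F fineK//; exact: integrable_fin_num ix.
Qed.

(** By Fubini a version of the conditional expectation given the [k]-th coordinate. The slices are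
    integrable only for almost every [x], hence the almost-everywhere statements below. *)
Definition cmean k (f : prodspace R K -> R) (x : prodspace R K) : R :=
  \int[mu]_y f (mix (pred1 k) (x, y)).

Lemma measurable_cmean k f : mu.-integrable setT (EFin \o f) ->
  measurable_fun setT (cmean k f).
Proof.
move=> intf; apply: measurableT_comp => //.
exact: (measurable_fubini_F (integrable_mix (pred1 k) intf)).
Qed.

Lemma measurable_mixr I x : measurable_fun setT (fun y => mix I (x, y) : prodspace R K).
Proof.
apply: measurable_to_prodspace => k; rewrite /mix/=; case: (I k) => //.
exact: measurable_coord.
Qed.

Lemma L2_cmean k f : L2 mu f -> L2 mu (cmean k f).
Proof.
move=> Lf; have [mf f2] := Lf; split; first exact: (measurable_cmean k (L2_int Lf)).
have imix := integrable_mix (pred1 k) f2.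
apply/integrableP; split.
  apply/measurable_EFinP; apply: measurable_funX.
  exact: (measurable_cmean k (L2_int Lf)).
apply: le_lt_trans (integrable_lty measurableT imix).
rewrite -(integral12_prod_meas1 imix); apply: ge0_le_integral => //.
- apply: measurableT_comp => //; apply/measurable_EFinP; apply: measurable_funX.
  exact: (measurable_cmean k (L2_int Lf)).
- exact: (measurable_fubini_F imix).
- move=> x _ /=; rewrite ger0_norm ?sqr_ge0// /cmean.
  apply: (@sqr_integral_le _ _ _ mu (fun y => f (mix (pred1 k) (x, y)))).
  exact: (measurableT_comp mf (measurable_mixr (pred1 k) x)).
Qed.

Lemma ae_cmean_int k f : mu.-integrable setT (EFin \o f) ->
  {ae mu, forall x, mu.-integrable setT (fun y => (f (mix (pred1 k) (x, y)))%:E)}.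
Proof. by move=> intf; exact: (ae_integrable1 (integrable_mix (pred1 k) intf)). Qed.

Definition depends (D : set K) (f : prodspace R K -> R) :=
  forall x y, (forall k, D k -> x k = y k) -> f x = f y.

(* Resampling the coordinates outside [D] fixes [f] and, since [D] and [D'] only
   share [k], resamples all the coordinates of [g] but the [k]-th one. *)
Lemma integral_mul_eq0 (D D' : set K) k f g : L2 mu f -> L2 mu g ->
  depends D f -> depends D' g -> D `&` D' `<=` [set k] ->
  {ae mu, forall x, cmean k g x = 0} -> \int[mu]_x (f x * g x) = 0.
Proof.
move=> Lf Lg fD gD' DD' g0.
pose I : pred K := fun j => `[< D j >] || (j == k).
have fgint := L2_mul Lf Lg.
rewrite (Rintegral_mix I fgint).
have E x y : f (mix I (x, y)) * g (mix I (x, y)) = f x * g (mix (pred1 k) (x, y)).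
  congr (_ * _).
    by apply: fD => j Dj; rewrite /mix /I asboolT.
  apply: gD' => j D'j; rewrite /mix /I/=.
  have [->|jk] := eqVneq j k; first by rewrite orbT.
  by rewrite orbF; case: asboolP => // Dj; have /eqP := DD' _ (conj Dj D'j); rewrite (negbTE jk).
under eq_Rintegral do under eq_Rintegral do rewrite E.
apply: ae_Rintegral0.
  have := measurable_fubini_F (integrable_mix I fgint).
  move=> /(measurableT_comp (@fine_measurable R _ measurableT)).
  apply: eq_measurable_fun => x _ /=; rewrite /fubini_F/= /Rintegral.
  by congr fine; apply: eq_integral => y _; rewrite /= E.
apply: filterS2 g0 (ae_cmean_int k (L2_int Lg)) => x gx ix.
by rewrite RintegralZl// -/(cmean k g x) gx mulr0.
Qed.

Lemma integrable_relabel tau (f : prodspace R K -> R) : injective tau ->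
  mu.-integrable setT (EFin \o f) ->
  mu.-integrable setT (EFin \o (fun x => f (relabel tau x))).
Proof.
move=> tau_inj intf; have mf : measurable_fun setT f.
  by apply/measurable_EFinP; exact: measurable_int intf.
by apply/(integrable_transfer (fun A => @relabel_law _ _ _ _ mu_iid tau A tau_inj)).
Qed.

Lemma Rintegral_relabel tau (f : prodspace R K -> R) : injective tau ->
  mu.-integrable setT (EFin \o f) ->
  \int[mu]_x f (relabel tau x) = \int[mu]_x f x.
Proof.
move=> tau_inj intf; apply/esym.
exact: (Rintegral_transfer (fun A => @relabel_law _ _ _ _ mu_iid tau A tau_inj)).
Qed.

Lemma L2_relabel tau f : injective tau -> L2 mu f ->
  L2 mu (fun x => f (relabel tau x)).
Proof.
move=> tau_inj [mf f2]; split; last exact: (integrable_relabel tau_inj f2).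
by apply: measurableT_comp => //; exact: measurable_relabel.
Qed.

(* Conditioning [f \o relabel tau] on the coordinate [tau k] amounts to
   conditioning [f] on the coordinate [k]. *)
Lemma cmean_relabel tau k f x : injective tau -> 
  mu.-integrable setT (fun y => (f (mix (pred1 k) (relabel tau x, y)))%:E) ->
  cmean (tau k) (fun y => f (relabel tau y)) x = cmean k f (relabel tau x).
Proof.
move=> tau_inj intf; rewrite /cmean.
rewrite -(Rintegral_relabel tau_inj intf); apply: eq_Rintegral => y _.
congr f; apply/funext => j; rewrite /mix /relabel/= inj_eq//.
Qed.

End decoupling.

(** * The Gaussian law *)

Section whole_line_FTC.
Context {R : realType}.
Notation leb := (@lebesgue_measure R).

(** The fundamental theorem of calculus on growing intervals, with the limit taken under the
    integral by domination by [|f|]. The Gaussian moments are obtained by exhibiting primitives that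
    vanish at infinity. *)
Lemma Rintegral_derive_eq0 (F f : R -> R) : continuous f ->
  leb.-integrable setT (EFin \o f) ->
  (forall x : R, is_derive x 1 F (f x)) ->
  F n%:R @[n --> \oo] --> (0 : R) -> F (- n%:R) @[n --> \oo] --> (0 : R) ->
  \int[leb]_x f x = 0.
Proof.
move=> cf intf dF Fp Fm.
have mf : measurable_fun setT f by exact: continuous_measurable_fun.
(* The successor keeps the interval nondegenerate for [n = 0], as the fundamental theorem
   requires. *)
pose A n : set R := `[- n.+1%:R, n.+1%:R]%classic.
pose g n : R -> \bar R := (EFin \o f) \_ (A n).
have mg n : measurable_fun setT (g n).
  apply/(measurable_restrictT _ _).1; first exact: measurable_itv.
  by apply/measurable_EFinP; exact: measurable_funS mf.
have cF x : {for x, continuous F}.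
  by apply: differentiable_continuous; apply/derivable1_diffP; case: (dF x).
have gE n : (\int[leb]_x g n x = (F n.+1%:R - F (- n.+1%:R))%:E)%E.
  rewrite /g -integral_mkcond EFinB.
  apply: continuous_FTC2.
  - by rewrite ltrNl (@lt_trans _ _ 0) ?oppr_lt0 ?ltr0n.
  - by apply: continuous_subspaceT => x; exact: cf.
  - split.
    + by move=> x _; case: (dF x).
    + apply: cvg_at_right_filter; exact: cF.
    + apply: cvg_at_left_filter; exact: cF.
  - by move=> x _; rewrite derive1E; apply: derive_val.
have [] := @dominated_convergence _ _ _ leb setT measurableT g (EFin \o f)
    (abse \o (EFin \o f)) mg.
- exact/measurable_EFinP.
- apply: aeW => x _; apply: cvg_near_cst.
  near=> n; rewrite /g patchE ifT// inE /A /= in_itv/= -ler_norml.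
  rewrite ltW// (le_lt_trans (ler_norm _))// normr_id.
  apply: lt_trans (_ : n%:R < _); last by rewrite ltr_nat.
  by near: n; exact: nbhs_infty_gtr.
- exact: integrable_abse.
- by apply: aeW => x n _; rewrite /g patchE; case: ifP => // _; rewrite abse0 abse_ge0.
move=> _ _ cv.
have cv0 : (\int[leb]_x (g n x))%E @[n --> \oo] --> (0%:E : \bar R).
  under eq_fun do rewrite gE.
  apply: cvg_EFin; first by apply: nearW => n.
  rewrite /comp /= -[X in _ --> X](subrr (0 : R)); apply: cvgB.
    by move: Fp; rewrite -(cvg_shiftS (fun n => F n%:R)).
  by move: Fm; rewrite -(cvg_shiftS (fun n => F (- n%:R))).
by rewrite /Rintegral (cvg_unique _ cv cv0).
Unshelve. all: end_near. Qed.

End whole_line_FTC.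

Lemma normrX_le_1DX4 (R : realType) (y : R) (k : nat) : (k <= 4)%N ->
  `|y| ^+ k <= 1 + y ^+ 4.
Proof.
move=> k4; have -> : y ^+ 4 = `|y| ^+ 4.
  by rewrite -normrX ger0_norm// (exprM y 2 2) sqr_ge0.
have [y1|y1] := leP `|y| 1.
  by rewrite (le_trans (exprn_ile1 k (normr_ge0 y) y1))// lerDl exprn_ge0.
by rewrite (le_trans (ler_weXn2l (ltW y1) k4))// lerDr.
Qed.

(** * Moments of the centered Gaussian density *)

Section gaussian_moments.
Context {R : realType} (sigma : R).
Hypothesis sigma_gt0 : 0 < sigma.
Notation leb := (@lebesgue_measure R).
Notation phi := (normal_pdf 0 sigma).

Let sigma_neq0 : sigma != 0. Proof. by rewrite gt_eqF. Qed.

Lemma is_derive_normal_pdf (x : R) : is_derive x 1 phi (- (x / sigma ^+ 2) * phi x).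
Proof.
rewrite normal_pdfE// /normal_fun.
have dg : is_derive x 1 (fun y : R => - (y - 0) ^+ 2 / (sigma ^+ 2 *+ 2)) (- (x / sigma ^+ 2)).
  have -> : (fun y : R => - (y - 0) ^+ 2 / (sigma ^+ 2 *+ 2)) =
     (fun y : R => (- (sigma ^+ 2 *+ 2)^-1) * (y * y)).
    by apply/funext => y; rewrite subr0 expr2 mulrC mulrN mulNr.
  apply: is_derive_eq; rewrite /GRing.scale/=; field; exact: sigma_neq0.
have := is_derive1_comp (is_derive_expR _) dg.
move=> dh.
have -> : (fun x0 => normal_peak sigma * expR (- (x0 - 0) ^+ 2 / (sigma ^+ 2 *+ 2))) =
  (normal_peak sigma \*: (expR \o (fun y : R => - (y - 0) ^+ 2 / (sigma ^+ 2 *+ 2)))).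
  by [].
apply: is_derive_eq; rewrite /GRing.scale/=; ring.
Qed.

(* The mass of [y ^+ 4] is absorbed by doubling the standard deviation, because
   [u ^+ 2 * exp (- 4 u) <= exp (- u)] for [u >= 0]. *)
Lemma normal_pdf_expr4 y : y ^+ 4 * phi y <= 128 * sigma ^+ 4 * normal_pdf 0 (2 * sigma) y.
Proof.
have s2 : 2 * sigma != 0 by rewrite mulf_neq0.
rewrite !normal_pdfE// /normal_fun subr0.
set u := y ^+ 2 / (8 * sigma ^+ 2).
have u0 : 0 <= u by rewrite divr_ge0 ?sqr_ge0// mulr_ge0// sqr_ge0.
have -> : - y ^+ 2 / (sigma ^+ 2 *+ 2) = (- u) *+ 4.
  by rewrite /u; field; exact: sigma_neq0.
have -> : - y ^+ 2 / ((2 * sigma) ^+ 2 *+ 2) = - u.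
  by rewrite /u; field; rewrite sigma_neq0.
have -> : normal_peak sigma = 2 * normal_peak (2 * sigma).
  rewrite /normal_peak.
  have -> : (2 * sigma) ^+ 2 * pi *+ 2 = 2 ^+ 2 * (sigma ^+ 2 * pi *+ 2) :> R by ring.
  by rewrite sqrtrM ?sqr_ge0// sqrtr_sqr ger0_norm// invfM mulrA divff// mul1r.
have -> : y ^+ 4 = 64 * sigma ^+ 4 * u ^+ 2 by rewrite /u; field; exact: sigma_neq0.
have -> : expR (- u *+ 4) = expR (- u) ^+ 4 by rewrite -[_ *+ 4]mulr_natl expRM_natl.
have P0 := normal_peak_ge0 (2 * sigma).
set E := expR (- u); set P := normal_peak _ in P0 *.
have E0 : 0 <= E by exact: expR_ge0.
have E1 : E <= 1 by rewrite /E -expR0 ler_expR oppr_le0.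
have uE : u * E <= 1.
  rewrite /E expRN ler_pdivrMr ?expR_gt0// mul1r.
  by apply: le_trans (expR_ge1Dx u); rewrite lerDr.
have uE0 : 0 <= u * E by exact: mulr_ge0.
have key : u ^+ 2 * E ^+ 4 <= E.
  have -> : u ^+ 2 * E ^+ 4 = (u * E) ^+ 2 * E * E by ring.
  rewrite ler_piMl// mulr_ile1 ?sqr_ge0//.
  by rewrite expr_le1.
have s4 : 0 <= sigma ^+ 4 by apply: exprn_ge0; exact: ltW.
have -> : 64 * sigma ^+ 4 * u ^+ 2 * (2 * P * E ^+ 4) =
  128 * sigma ^+ 4 * P * (u ^+ 2 * E ^+ 4) by ring.
have c0 : 0 <= 128 * sigma ^+ 4 * P by apply: mulr_ge0 => //; apply: mulr_ge0.
by rewrite [leRHS]mulrA ler_wpM2l.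
Qed.

Lemma measurable_phi : measurable_fun setT phi.
Proof. exact: measurable_normal_pdf. Qed.

Lemma integrable_normal_expr4 : leb.-integrable setT (fun y => (y ^+ 4 * phi y)%:E).
Proof.
have := integrableZl measurableT (128 * sigma ^+ 4)
  (integrable_normal_pdf 0 (2 * sigma)).
apply: le_integrable => //.
  apply/measurable_EFinP; apply: measurable_funM; last exact: measurable_phi.
  exact: measurable_funX.
move=> y _ /=; rewrite lee_fin ger0_norm.
  by apply: le_trans (normal_pdf_expr4 y) _; exact: ler_norm.
by rewrite mulr_ge0 ?normal_pdf_ge0// (exprM y 2 2) sqr_ge0.
Qed.

Lemma integrable_normal (f : R -> R) A : measurable_fun setT f ->
  (forall y, `|f y| <= A * (1 + y ^+ 4)) ->
  leb.-integrable setT (fun y => (f y * phi y)%:E).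
Proof.
move=> mf fA.
have := integrableZl measurableT A
  (integrableD measurableT (integrable_normal_pdf 0 sigma) integrable_normal_expr4).
apply: le_integrable => //.
  apply/measurable_EFinP; apply: measurable_funM => //; exact: measurable_phi.
move=> y _ /=; rewrite lee_fin.
have p0 := normal_pdf_ge0 0 sigma y.
rewrite normrM (ger0_norm p0); apply: le_trans (ler_norm _).
by apply: le_trans (ler_wpM2r p0 (fA y)) _; rewrite -mulrA mulrDl mul1r.
Qed.

Lemma integrable_normal_bounded (f : R -> R) A : measurable_fun setT f ->
  (forall y, `|f y| <= A) -> leb.-integrable setT (fun y => (f y * phi y)%:E).
Proof.
move=> mf fA; apply: (@integrable_normal f A) => // y.
have A0 : 0 <= A by exact: le_trans (fA 0).
apply: le_trans (fA y) _; rewrite ler_peMr// lerDl (exprM y 2 2) sqr_ge0//.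
Qed.

(** Since [y^4 * phi y] is bounded, [|y|^k * phi y] is at most a constant over [|y|] for [|y| >= 1].
    The sign [e] treats both tails at once. *)
Lemma cvg_natr_normal (k : nat) (e : R) : (k <= 3)%N -> `|e| = 1 ->
  (e * n%:R) ^+ k * phi (e * n%:R) @[n --> \oo] --> (0 : R).
Proof.
move=> k3 e1.
pose C := 128 * sigma ^+ 4 * normal_peak (2 * sigma).
have C0 : 0 <= C.
  by rewrite !mulr_ge0 ?normal_peak_ge0// ltW.
have s2 : 2 * sigma != 0 by rewrite mulf_neq0.
apply/cvgrPdist_le => /= eps eps0; near=> n.
rewrite sub0r normrN normrM normrX normrM e1 mul1r.
rewrite ger0_norm// (ger0_norm (normal_pdf_ge0 _ _ _)).
have n1 : 1 <= n%:R :> R by rewrite ler1n; near: n; exact: nbhs_infty_gt.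
have bnd : n%:R ^+ 4 * phi (e * n%:R) <= C.
  have := normal_pdf_expr4 (e * n%:R).
  have -> : (e * n%:R) ^+ 4 = n%:R ^+ 4.
    by rewrite exprMn (exprM e 2 2) -[e ^+ 2]real_normK ?num_real// e1 !expr1n mul1r.
  move=> /le_trans; apply; rewrite /C ler_wpM2l ?normal_pdf_ub//.
  by rewrite mulr_ge0// ltW// exprn_gt0.
have nk : n%:R ^+ k * n%:R <= n%:R ^+ 4 :> R.
  by rewrite -exprSr ler_weXn2l.
have p0 := normal_pdf_ge0 0 sigma (e * n%:R).
have n0 : 0 < n%:R :> R by exact: lt_le_trans n1.
rewrite -(ler_pM2r n0) mulrAC.
apply: le_trans (ler_wpM2r p0 nk) _; apply: le_trans bnd _.
rewrite mulrC -ler_pdivrMr//.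
by near: n; exact: nbhs_infty_ger.
Unshelve. all: end_near. Qed.

Lemma continuous_phi : continuous phi.
Proof. exact: continuous_normal_pdf. Qed.

Lemma normal_mean0 : \int[leb]_y (y * phi y) = 0.
Proof.
have -> : (fun y => y * phi y) = (fun y => - sigma ^+ 2 * (- (y / sigma ^+ 2) * phi y)).
  by apply/funext => y; field; exact: sigma_neq0.
have cv e : `|e| = 1 -> (- sigma ^+ 2) * phi (e * n%:R) @[n --> \oo] --> (0 : R).
  move=> e1; rewrite -[X in _ --> X](mulr0 (- sigma ^+ 2)); apply: cvgMl_tmp.
  by have := @cvg_natr_normal 0 e isT e1; under eq_fun do rewrite expr0 mul1r.
apply: (@Rintegral_derive_eq0 _ (fun y => - sigma ^+ 2 * phi y)).
- move=> x; apply: cvgMl_tmp; apply: cvgM; last exact: continuous_phi.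
  by apply: cvgN; apply: cvgMr_tmp; exact: cvg_id.
- have idX4 (y : R) : `|y| <= 1 * (1 + y ^+ 4).
    by rewrite mul1r; exact: (@normrX_le_1DX4 _ y 1).
  have := integrable_normal (@measurable_id _ R setT) idX4.
  congr integrable; apply/funext => y /=; congr EFin; field; exact: sigma_neq0.
- move=> x; have := is_derive_normal_pdf x => dphi.
  have -> : (fun y => - sigma ^+ 2 * phi y) = (- sigma ^+ 2) \*: phi by [].
  by apply: is_derive_eq; rewrite /GRing.scale/=.
- by have := cv 1 (normr1 _); under eq_fun do rewrite mul1r.
- by have := cv (-1) (normrN1 _); under eq_fun do rewrite mulN1r.
Qed.

Let integrable_normal_sqr : leb.-integrable setT (EFin \o (fun y => y ^+ 2 * phi y)).
Proof.
apply: (@integrable_normal _ 1); first exact: measurable_funX.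
by move=> y; rewrite mul1r normrX; exact: normrX_le_1DX4.
Qed.

(** The difference [y^2 phi - sigma^2 phi] is the derivative of [- sigma^2 y phi], so its integral
    vanishes. *)
Lemma normal_variance : \int[leb]_y (y ^+ 2 * phi y) = sigma ^+ 2.
Proof.
have i2 := integrable_normal_sqr.
have i0 : leb.-integrable setT (EFin \o (fun y => sigma ^+ 2 * phi y)).
  exact: (integrableZl measurableT (sigma ^+ 2) (integrable_normal_pdf 0 sigma)).
have := @Rintegral_derive_eq0 _ (fun y => - sigma ^+ 2 * (y * phi y))
  (fun y => y ^+ 2 * phi y - sigma ^+ 2 * phi y) _ _ _ _ _.
rewrite RintegralB// RintegralZl//; last exact: integrable_normal_pdf.
have -> : \int[leb]_y phi y = 1 by rewrite /Rintegral integral_normal_pdf.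
rewrite mulr1 => H; apply/eqP; rewrite -subr_eq0; apply/eqP; apply: H.
- move=> x; apply: cvgB.
    by apply: cvgM; [exact: exprn_continuous|exact: continuous_phi].
  by apply: cvgMl_tmp; exact: continuous_phi.
- have := integrableB measurableT i2 i0.
  by congr integrable.
- move=> x; have dphi := is_derive_normal_pdf x.
  have -> : (fun y => - sigma ^+ 2 * (y * phi y)) = (- sigma ^+ 2) \*: (id * phi) by [].
  by apply: is_derive_eq; rewrite /GRing.scale/=; field; exact: sigma_neq0.
- have := @cvg_natr_normal 1 1 isT (normr1 _); under eq_fun do rewrite mul1r expr1.
  move=> cv; have := cvgMl_tmp (a := - sigma ^+ 2) cv; rewrite mulr0; by apply.
- have := @cvg_natr_normal 1 (-1) isT (normrN1 _); under eq_fun do rewrite mulN1r expr1.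
  move=> cv; have := cvgMl_tmp (a := - sigma ^+ 2) cv; rewrite mulr0; by apply.
Qed.

(* [|y| ^+ 3 <= sigma * y ^+ 2 + y ^+ 4 / sigma], hence [129 = 1 + 128]. *)
Lemma normal_moment3 : \int[leb]_y (`|y| ^+ 3 * phi y) <= 129 * sigma ^+ 3.
Proof.
have i2 : leb.-integrable setT (EFin \o (fun y => sigma * (y ^+ 2 * phi y))).
  exact: (integrableZl measurableT sigma integrable_normal_sqr).
have i4 : leb.-integrable setT
    (EFin \o (fun y => 128 * sigma ^+ 3 * normal_pdf 0 (2 * sigma) y)).
  exact: (integrableZl measurableT _ (integrable_normal_pdf 0 (2 * sigma))).
have -> : 129 * sigma ^+ 3 = \int[leb]_y (sigma * (y ^+ 2 * phi y) +
    128 * sigma ^+ 3 * normal_pdf 0 (2 * sigma) y).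
  rewrite RintegralD// RintegralZl//.
  rewrite normal_variance RintegralZl//; last exact: integrable_normal_pdf.
  have -> : \int[leb]_y normal_pdf 0 (2 * sigma) y = 1 by rewrite /Rintegral integral_normal_pdf.
  ring.
apply: le_Rintegral => //.
- apply: (@integrable_normal _ 1).
    by apply: measurable_funX; exact: normr_measurable.
  by move=> y; rewrite mul1r normrX normr_id; exact: normrX_le_1DX4.
- have := integrableD measurableT i2 i4; by congr integrable.
move=> y _.
have p0 := normal_pdf_ge0 0 sigma y.
have p4 : y ^+ 4 / sigma * phi y <= 128 * sigma ^+ 3 * normal_pdf 0 (2 * sigma) y.
  rewrite mulrAC ler_pdivrMr//; apply: le_trans (normal_pdf_expr4 y) _.
  by rewrite le_eqVlt; apply/orP; left; apply/eqP; ring.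
apply: le_trans (lerD (lexx _) p4); rewrite mulrA -mulrDl ler_wpM2r//.
have -> : y ^+ 4 = `|y| ^+ 4 by rewrite -normrX ger0_norm// (exprM y 2 2) sqr_ge0.
have -> : y ^+ 2 = `|y| ^+ 2 by rewrite real_normK ?num_real.
have := normr_ge0 y; set z := `|y| => z0.
rewrite -(ler_pM2r sigma_gt0) mulrDl divfK//.
have -> : z ^+ 4 = z ^+ 2 * z ^+ 2 by ring.
have -> : sigma * z ^+ 2 * sigma = z ^+ 2 * sigma ^+ 2 by ring.
have -> : z ^+ 3 * sigma = z ^+ 2 * (z * sigma) by ring.
rewrite -mulrDr ler_wpM2l ?sqr_ge0//; nra.
Qed.

End gaussian_moments.

(** * The Gaussian semigroup *)

Section gaussian_smoothing.
Context {R : realType}.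
Notation leb := (@lebesgue_measure R).
Implicit Types (f : R -> R) (a b s : R).

(** The expectation of [f (s + a Z)] for a standard normal [Z]. The degenerate law at [a = 0] has no
    density and is therefore treated apart; it is needed for coordinates of variance zero and for
    the empty sum. *)
Definition gsmooth a f s : R :=
  if a == 0 then f s else \int[leb]_y (f (s + y) * normal_pdf 0 a y).

Lemma gsmoothE a f s : 0 < a ->
  gsmooth a f s = \int[leb]_y (f (s + y) * normal_pdf 0 a y).
Proof. by rewrite /gsmooth => /gt_eqF ->. Qed.

Lemma integrable_gsmooth a f s : 0 < a -> measurable_fun setT f ->
  (exists A : R, forall x, `|f x| <= A) ->
  leb.-integrable setT (fun y => (f (s + y) * normal_pdf 0 a y)%:E).
Proof.
move=> a0 mf [A fA]; apply: (@integrable_normal_bounded _ _ a0 _ A) => //.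
by apply: measurableT_comp => //; exact: measurable_funD.
Qed.

Lemma measurable_gsmooth a f : 0 <= a -> measurable_fun setT f ->
  (forall x, 0 <= f x) -> measurable_fun setT (gsmooth a f).
Proof.
move=> a0 mf f0; rewrite /gsmooth; have [//|an0] := eqVneq a 0.
apply: measurableT_comp => //.
pose F (z : R * R) : \bar R := (f (z.1 + z.2) * normal_pdf 0 a z.2)%:E.
apply: (@measurable_fun_fubini_tonelli_F _ _ _ _ _ leb F).
  apply/measurable_EFinP; apply: measurable_funM.
    apply: measurableT_comp => //.
    by apply: measurable_funD; [exact: measurable_fst|exact: measurable_snd].
  by apply: measurableT_comp; [exact: measurable_normal_pdf|exact: measurable_snd].
by move=> z; rewrite lee_fin mulr_ge0// normal_pdf_ge0.
Qed.

Lemma gsmooth_itv a f s : 0 <= a -> measurable_fun setT f ->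
  (forall x, 0 <= f x <= 1) -> 0 <= gsmooth a f s <= 1.
Proof.
move=> a0 mf f01; rewrite /gsmooth; have [//|an0] := eqVneq a 0.
have a_gt0 : 0 < a by rewrite lt_neqAle eq_sym an0.
have fp x := normal_pdf_ge0 0 a x.
apply/andP; split.
  by apply: Rintegral_ge0 => y _; rewrite mulr_ge0//; case/andP: (f01 (s + y)).
have -> : 1 = \int[leb]_y normal_pdf 0 a y by rewrite /Rintegral integral_normal_pdf.
apply: le_Rintegral => //.
- apply: integrable_gsmooth => //; exists 1 => x.
  by have /andP[f0 f1] := f01 x; rewrite ger0_norm.
- exact: integrable_normal_pdf.
by move=> y _; rewrite ler_piMl//; case/andP: (f01 (s + y)).
Qed.

Lemma ge0_integral_translation f b : continuous f -> (forall x, 0 <= f x) ->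
  (\int[leb]_x (f x)%:E = \int[leb]_x (f (x + b))%:E)%E.
Proof.
move=> cf f0.
have dF (x : R) : is_derive x 1 (fun y : R => y + b) 1.
  by apply: is_derive_eq; rewrite addr0.
have F'E : (fun y : R => y + b)^`()%classic = cst 1.
  by apply/funext => x; rewrite derive1E; apply: derive_val.
rewrite (@increasing_ge0_integration_by_substitutionT _ (fun y => y + b) f)//.
- by apply: eq_integral => x _; rewrite F'E !fctE/= mulr1.
- by move=> x y; rewrite ltrD2r.
- by rewrite F'E => x; exact: cvg_cst.
- by rewrite F'E; exact: is_cvg_cst.
- by rewrite F'E; exact: is_cvg_cst.
- exact: cvg_addrr_Ny.
- exact: cvg_addrr.
Qed.

(* Completing the square in the exponent of the convolution. *)
Lemma normal_pdf_mul a b c w y : 0 < a -> 0 < b -> 0 < c -> c ^+ 2 = a ^+ 2 + b ^+ 2 ->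
  normal_pdf 0 a (w - y) * normal_pdf 0 b y =
  normal_pdf 0 c w * normal_pdf (w * b ^+ 2 / c ^+ 2) (a * b / c) y.
Proof.
move=> a0 b0 c0 cab.
have an0 : a != 0 by rewrite gt_eqF.
have bn0 : b != 0 by rewrite gt_eqF.
have cn0 : c != 0 by rewrite gt_eqF.
have dn0 : a * b / c != 0 by rewrite !mulf_neq0// invr_eq0.
rewrite !normal_pdfE// /normal_fun !subr0.
have mulE (A B C D : R) : A * B * (C * D) = (A * C) * (B * D) by ring.
rewrite [LHS]mulE [RHS]mulE -!expRD; congr (_ * expR _).
  have v0 (r : R) : 0 <= r ^+ 2 * pi *+ 2.
    by rewrite mulrn_wge0// mulr_ge0 ?sqr_ge0 ?pi_ge0.
  rewrite /normal_peak -!invfM -!(sqrtrM _ (v0 _)).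
  by congr (_ (Num.sqrt _)); field.
have -> : (a * b / c) ^+ 2 = a ^+ 2 * b ^+ 2 / (a ^+ 2 + b ^+ 2).
  by rewrite -cab !exprMn exprVn.
have abn0 : a ^+ 2 + b ^+ 2 != 0 by rewrite -cab expf_neq0.
by rewrite cab; field; rewrite ?an0 ?bn0 ?abn0.
Qed.

Lemma gsmooth_gsmooth a b f s : 0 <= a -> 0 <= b -> continuous f ->
  (forall x, 0 <= f x <= 1) ->
  gsmooth b (gsmooth a f) s = gsmooth (Num.sqrt (a ^+ 2 + b ^+ 2)) f s.
Proof.
move=> a0 b0 cf f01.
have mf : measurable_fun setT f by exact: continuous_measurable_fun.
have f0 x : 0 <= f x by case/andP: (f01 x).
have fA : exists A : R, forall x, `|f x| <= A.
  by exists 1 => x; have /andP[? ?] := f01 x; rewrite ger0_norm.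
have [->|bn0] := eqVneq b 0.
  by rewrite {1}/gsmooth eqxx expr0n addr0 sqrtr_sqr ger0_norm.
have [->|an0] := eqVneq a 0.
  rewrite expr0n add0r sqrtr_sqr ger0_norm// {1 3}/gsmooth (negbTE bn0).
  by apply: eq_Rintegral => y _; rewrite /gsmooth eqxx.
have {}a0 : 0 < a by rewrite lt_neqAle eq_sym an0.
have {}b0 : 0 < b by rewrite lt_neqAle eq_sym bn0.
set c := Num.sqrt _.
have c0 : 0 < c by rewrite sqrtr_gt0 addr_gt0 ?exprn_gt0.
have cE : c ^+ 2 = a ^+ 2 + b ^+ 2 by rewrite sqr_sqrtr// addr_ge0 ?sqr_ge0.
rewrite (gsmoothE _ _ b0) (gsmoothE f s c0) /Rintegral; congr fine.
have mp (r : R) : measurable_fun setT (normal_pdf 0 r) by exact: measurable_normal_pdf.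
have p0 (r x : R) : 0 <= normal_pdf 0 r x by exact: normal_pdf_ge0.
pose G (z : R * R) : \bar R := (f (s + z.2) * (normal_pdf 0 a (z.2 - z.1) * normal_pdf 0 b z.1))%:E.
transitivity (\int[leb]_y \int[leb]_w G (y, w))%E.
  apply: eq_integral => y _.
  rewrite EFinM gsmoothE// fineK; last first.
    by apply: integrable_fin_num => //; exact: integrable_gsmooth.
  (* The inner variable becomes the total displacement [w], so that [f] no longer depends on [y] and
     the integrals can be exchanged. *)
  rewrite (@ge0_integral_translation (fun z => f (s + y + z) * normal_pdf 0 a z) (- y)); last 2 first.
  - move=> x; apply: cvgM; last by exact: (@continuous_normal_pdf R 0 a an0).
    apply: (cvg_comp (fun z => s + y + z) f); last exact: cf.
    by apply: cvgD; [exact: cvg_cst|exact: cvg_id].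
  - by move=> x; rewrite mulr_ge0.
  rewrite -ge0_integralZr//.
  - apply: eq_integral => w _; rewrite -EFinM /G/=; congr EFin.
    by rewrite -mulrA; congr (f _ * _); ring.
  - apply/measurable_EFinP; apply: measurable_funM.
      apply: measurableT_comp => //; apply: measurable_funD => //.
      exact: measurable_funB.
    apply: measurableT_comp => //; exact: measurable_funB.
  - by move=> x _; rewrite lee_fin mulr_ge0.
  - by rewrite lee_fin.
apply: (etrans (@fubini_tonelli _ _ _ _ _ leb leb G _ _)).
- apply/measurable_EFinP; apply: measurable_funM.
    by apply: measurableT_comp => //; apply: measurable_funD => //; exact: measurable_snd.
  apply: measurable_funM.
    apply: measurableT_comp => //.
    by apply: measurable_funB; [exact: measurable_snd|exact: measurable_fst].
  exact: (measurableT_comp (mp b) measurable_fst).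
- by move=> z; rewrite lee_fin !mulr_ge0.
apply: eq_integral => w _.
(* After completing the square, [y] occurs only in a Gaussian density, of total mass one. *)
under eq_integral do rewrite /G/= (normal_pdf_mul _ _ a0 b0 c0 cE) mulrA EFinM.
rewrite integralZl//; last exact: integrable_normal_pdf.
by rewrite integral_normal_pdf mule1.
Qed.

End gaussian_smoothing.

(** * Lindeberg's exchange argument *)

Section taylor_class.
Context {R : realType}.
Notation leb := (@lebesgue_measure R).

Definition mincube (y : R) : R := Num.min (y ^+ 2) (`|y| ^+ 3).

Lemma mincube_ge0 y : 0 <= mincube y.
Proof. by rewrite /mincube le_min sqr_ge0 exprn_ge0. Qed.

Lemma mincube_le2 y : mincube y <= y ^+ 2.
Proof. by rewrite /mincube ge_min lexx. Qed.

Lemma mincube_le3 y : mincube y <= `|y| ^+ 3.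
Proof. by rewrite /mincube ge_min lexx orbT. Qed.

Lemma measurable_mincube : measurable_fun setT mincube.
Proof.
apply: measurable_minr; first exact: measurable_funX.
by apply: measurable_funX; exact: normr_measurable.
Qed.

(** The coefficients are mere numbers: no differentiability is asked for, hence no differentiation
    under the integral sign is needed for the smoothed functions. *)
Definition taylor2_bound (C : R) (f : R -> R) s d1 d2 := forall y,
  `|f (s + y) - f s - d1 * y - d2 / 2 * y ^+ 2| <= C * mincube y.

(** The coefficient functions are bounded and measurable so that they can be averaged against a
    Gaussian density; values in [[0, 1]] make [f] integrable under every probability. *)
Definition smooth_test (C : R) (f D1 D2 : R -> R) :=
  [/\ continuous f, forall x, 0 <= f x <= 1,
      measurable_fun setT D1 /\ measurable_fun setT D2,
      forall x, `|D1 x| <= C /\ `|D2 x| <= C &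
      forall s, taylor2_bound C f s (D1 s) (D2 s)].

(** The linear term integrates to zero, so the law of [X] enters only through its variance, up to
    the error; it can thus be exchanged for any other centered law with that variance. *)
Lemma Rintegral_taylor2 d (T : measurableType d) (m : probability T R)
    (X : T -> R) (f : R -> R) C s d1 d2 :
  0 <= C -> L2 m X -> \int[m]_x X x = 0 ->
  measurable_fun setT f -> (forall x, 0 <= f x <= 1) ->
  taylor2_bound C f s d1 d2 ->
  `|\int[m]_x f (s + X x) - f s - d2 / 2 * \int[m]_x (X x ^+ 2)| <=
  C * \int[m]_x mincube (X x).
Proof.
move=> C0 LX X0 mf f01 fT; have [mX X2] := LX.
have mfs : measurable_fun setT (fun x => f (s + X x)).
  by apply: measurableT_comp => //; exact: measurable_funD.
have ifs : m.-integrable setT (EFin \o (fun x => f (s + X x))).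
  apply: (le_integrable _ _ _ (finite_measure_integrable_cst m 1 measurableT)) => //.
    exact/measurable_EFinP.
  move=> x _ /=; have /andP[a b] := f01 (s + X x).
  by rewrite lee_fin normr1 ger0_norm.
have i1 := L2_int (L2Z d1 LX).
have i2 : m.-integrable setT (EFin \o (fun x => d2 / 2 * X x ^+ 2)).
  exact: (integrableZl measurableT (d2 / 2) X2).
have i0 : m.-integrable setT (EFin \o (fun=> f s)).
  exact: finite_measure_integrable_cst.
have imc : m.-integrable setT (EFin \o (fun x => mincube (X x))).
  apply: (le_integrable _ _ _ X2) => //.
    by apply/measurable_EFinP; apply: measurableT_comp => //; exact: measurable_mincube.
  move=> x _ /=; rewrite lee_fin !ger0_norm ?sqr_ge0 ?mincube_ge0//.
  exact: mincube_le2.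
have iB (u v : T -> R) : m.-integrable setT (EFin \o u) ->
    m.-integrable setT (EFin \o v) -> m.-integrable setT (EFin \o (fun x => u x - v x)).
  by move=> iu iv; have := integrableB measurableT iu iv; congr integrable.
have -> : \int[m]_x f (s + X x) - f s - d2 / 2 * \int[m]_x (X x ^+ 2) =
    \int[m]_x (f (s + X x) - f s - d1 * X x - d2 / 2 * X x ^+ 2).
  rewrite RintegralB//; last by do 2 apply: (iB) => //.
  rewrite RintegralB//; last by apply: iB.
  rewrite RintegralB// Rintegral_prob_cst (RintegralZl _ measurableT (L2_int LX))// X0 mulr0 subr0.
  by rewrite RintegralZl.
rewrite -RintegralZl//.
have itot := iB _ _ (iB _ _ (iB _ _ ifs i0) i1) i2.
apply: le_trans (le_normr_Rintegral measurableT itot) _.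
apply: le_Rintegral => //.
- exact: integrable_norm.
- exact: (integrableZl measurableT C imc).
Qed.

(** The Gaussian counterpart of [Rintegral_taylor2]; the constant is that of [normal_moment3]. *)
Lemma gsmooth_taylor2 (f : R -> R) C s d1 d2 a :
  0 <= C -> 0 <= a -> measurable_fun setT f -> (forall x, 0 <= f x <= 1) ->
  taylor2_bound C f s d1 d2 ->
  `|gsmooth a f s - f s - d2 / 2 * a ^+ 2| <= C * (129 * a ^+ 3).
Proof.
move=> C0; rewrite le_eqVlt => /predU1P[<-|a0] mf f01 fT.
  by rewrite /gsmooth eqxx subrr !expr0n/= !mulr0 subrr normr0.
rewrite gsmoothE//.
have p0 y := normal_pdf_ge0 0 a y.
have ifs : leb.-integrable setT (EFin \o (fun y => f (s + y) * normal_pdf 0 a y)).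
  apply: integrable_gsmooth => //; exists 1 => x.
  by have /andP[? ?] := f01 x; rewrite ger0_norm.
have i0 : leb.-integrable setT (EFin \o (fun y => f s * normal_pdf 0 a y)).
  exact: (integrableZl measurableT (f s) (integrable_normal_pdf 0 a)).
have i1' : leb.-integrable setT (EFin \o (fun y => y * normal_pdf 0 a y)).
  apply: (@integrable_normal _ _ a0 _ 1) => // y.
  by rewrite mul1r; exact: (@normrX_le_1DX4 _ y 1).
have i2' : leb.-integrable setT (EFin \o (fun y => y ^+ 2 * normal_pdf 0 a y)).
  apply: (@integrable_normal _ _ a0 _ 1); first exact: measurable_funX.
  by move=> y; rewrite mul1r normrX; exact: normrX_le_1DX4.
have i3 : leb.-integrable setT (EFin \o (fun y => `|y| ^+ 3 * normal_pdf 0 a y)).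
  apply: (@integrable_normal _ _ a0 _ 1).
    by apply: measurable_funX; exact: normr_measurable.
  by move=> y; rewrite mul1r normrX normr_id; exact: normrX_le_1DX4.
have i1 : leb.-integrable setT (EFin \o (fun y => d1 * (y * normal_pdf 0 a y))).
  exact: (integrableZl measurableT d1 i1').
have i2 : leb.-integrable setT (EFin \o (fun y => d2 / 2 * (y ^+ 2 * normal_pdf 0 a y))).
  exact: (integrableZl measurableT (d2 / 2) i2').
have iB (u v : R -> R) : leb.-integrable setT (EFin \o u) ->
    leb.-integrable setT (EFin \o v) -> leb.-integrable setT (EFin \o (fun x => u x - v x)).
  by move=> iu iv; have := integrableB measurableT iu iv; congr integrable.
have -> : \int[leb]_y (f (s + y) * normal_pdf 0 a y) - f s - d2 / 2 * a ^+ 2 =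
    \int[leb]_y (f (s + y) * normal_pdf 0 a y - f s * normal_pdf 0 a y
      - d1 * (y * normal_pdf 0 a y) - d2 / 2 * (y ^+ 2 * normal_pdf 0 a y)).
  rewrite RintegralB//; last by do 2 apply: (iB) => //.
  rewrite RintegralB//; last by apply: iB.
  rewrite RintegralB// RintegralZl//; last exact: integrable_normal_pdf.
  have -> : \int[leb]_y normal_pdf 0 a y = 1 by rewrite /Rintegral integral_normal_pdf.
  by rewrite (RintegralZl _ measurableT i1')// normal_mean0// (RintegralZl _ measurableT i2')// normal_variance//; ring.
have itot := iB _ _ (iB _ _ (iB _ _ ifs i0) i1) i2.
apply: le_trans (le_normr_Rintegral measurableT itot) _.
apply: le_trans (ler_wpM2l C0 (normal_moment3 a0)).
rewrite -RintegralZl//; apply: le_Rintegral => //.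
- exact: integrable_norm.
- exact: (integrableZl measurableT C i3).
- move=> y _; have := fT y => fy.
  have -> : f (s + y) * normal_pdf 0 a y - f s * normal_pdf 0 a y
      - d1 * (y * normal_pdf 0 a y) - d2 / 2 * (y ^+ 2 * normal_pdf 0 a y) =
    (f (s + y) - f s - d1 * y - d2 / 2 * y ^+ 2) * normal_pdf 0 a y by ring.
  rewrite normrM (ger0_norm (p0 y)) [leRHS]mulrA ler_wpM2r//.
  by apply: le_trans fy _; rewrite ler_wpM2l// mincube_le3.
Qed.

(** The coefficients are the Gaussian averages of [D1] and [D2]; [C] is unchanged because the
    density has mass one. A constant independent of the number of smoothings is what lets the
    exchange errors simply add up. *)
Lemma gsmooth_taylor2_bound C f D1 D2 a s : 0 <= C -> 0 <= a ->
  smooth_test C f D1 D2 -> exists d1 d2, taylor2_bound C (gsmooth a f) s d1 d2.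
Proof.
move=> C0; rewrite le_eqVlt => /predU1P[<-|a0] [cf f01 [mD1 mD2] bD fT].
  exists (D1 s), (D2 s) => y; rewrite /gsmooth eqxx; exact: fT.
have mf : measurable_fun setT f by exact: continuous_measurable_fun.
have p0 y := normal_pdf_ge0 0 a y.
have ig (g : R -> R) A u : measurable_fun setT g -> (forall x, `|g x| <= A) ->
    leb.-integrable setT (EFin \o (fun y => g (u + y) * normal_pdf 0 a y)).
  by move=> mg gA; apply: integrable_gsmooth => //; exists A.
have ifs u : leb.-integrable setT (EFin \o (fun y => f (u + y) * normal_pdf 0 a y)).
  by apply: (ig f 1) => // x; have /andP[? ?] := f01 x; rewrite ger0_norm.
have iD1 : leb.-integrable setT (EFin \o (fun z => D1 (s + z) * normal_pdf 0 a z)).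
  by apply: (ig D1 C) => // x; exact: (bD x).1.
have iD2 : leb.-integrable setT (EFin \o (fun z => D2 (s + z) * normal_pdf 0 a z)).
  by apply: (ig D2 C) => // x; exact: (bD x).2.
exists (\int[leb]_z (D1 (s + z) * normal_pdf 0 a z)),
  (\int[leb]_z (D2 (s + z) * normal_pdf 0 a z)) => y.
rewrite !(gsmoothE f _ a0).
have i1 : leb.-integrable setT (EFin \o (fun z => D1 (s + z) * normal_pdf 0 a z * y)).
  exact: (integrableZr measurableT y iD1).
have i2 : leb.-integrable setT
    (EFin \o (fun z => D2 (s + z) * normal_pdf 0 a z * (2^-1 * y ^+ 2))).
  exact: (integrableZr measurableT _ iD2).
have iB (u v : R -> R) : leb.-integrable setT (EFin \o u) ->
    leb.-integrable setT (EFin \o v) -> leb.-integrable setT (EFin \o (fun x => u x - v x)).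
  by move=> iu iv; have := integrableB measurableT iu iv; congr integrable.
rewrite -(RintegralZr _ measurableT iD1)// -mulrA -(RintegralZr _ measurableT iD2)//.
have ia := iB _ _ (ifs (s + y)) (ifs s).
have ib := iB _ _ ia i1.
rewrite -(RintegralB measurableT (ifs (s + y)) (ifs s)).
rewrite -(RintegralB measurableT ia i1) -(RintegralB measurableT ib i2).
have itot := iB _ _ ib i2.
apply: le_trans (le_normr_Rintegral measurableT itot) _.
have -> : C * mincube y = \int[leb]_z (C * mincube y * normal_pdf 0 a z).
  rewrite RintegralZl//; last exact: integrable_normal_pdf.
  have -> : \int[leb]_y normal_pdf 0 a y = 1 by rewrite /Rintegral integral_normal_pdf.
  by rewrite mulr1.
apply: le_Rintegral => //.
- exact: integrable_norm.
- exact: (integrableZl measurableT _ (integrable_normal_pdf 0 a)).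
- move=> z _.
  have -> : f (s + y + z) * normal_pdf 0 a z - f (s + z) * normal_pdf 0 a z
      - D1 (s + z) * normal_pdf 0 a z * y - D2 (s + z) * normal_pdf 0 a z * (2^-1 * y ^+ 2) =
    (f (s + z + y) - f (s + z) - D1 (s + z) * y - D2 (s + z) / 2 * y ^+ 2) * normal_pdf 0 a z.
    by rewrite (addrAC s y z); ring.
  by rewrite normrM (ger0_norm (p0 z)) ler_wpM2r//; exact: fT.
Qed.

End taylor_class.

Section lindeberg.
Context {R : realType} {K : choiceType} (mu : probability (prodspace R K) R)
  (nu : probability R R).
Hypothesis mu_iid : iid_law mu nu.
Variable g : K -> R -> R.
Hypothesis g_L2 : forall k, L2 mu (fun x => g k (x k)).
Hypothesis g_mean0 : forall k, \int[mu]_x g k (x k) = 0.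

Definition coord_var k : R := \int[mu]_x (g k (x k) ^+ 2).

(** The cost of one exchange: the first term for the variable itself, the second for the Gaussian
    that replaces it. *)
Definition lindeberg_err k : R :=
  \int[mu]_x mincube (g k (x k)) + 129 * Num.sqrt (coord_var k) ^+ 3.

Lemma coord_var_ge0 k : 0 <= coord_var k.
Proof. by apply: Rintegral_ge0 => x _; exact: sqr_ge0. Qed.

(** Induction on the list for all starting points [s]. The variables already exchanged survive only
    as the smoothing [h] of the test function, so that each step compares a single variable with a
    single Gaussian. *)
Theorem lindeberg (C : R) (f D1 D2 : R -> R) (l : seq K) s :
  0 <= C -> smooth_test C f D1 D2 -> uniq l ->
  `|\int[mu]_x f (s + \sum_(k <- l) g k (x k)) -
     gsmooth (Num.sqrt (\sum_(k <- l) coord_var k)) f s| <=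
  C * \sum_(k <- l) lindeberg_err k.
Proof.
move=> C0 fsm; have [cf f01 _ _ _] := fsm.
have mf : measurable_fun setT f by exact: continuous_measurable_fun.
have f0 x : 0 <= f x by case/andP: (f01 x).
elim: l s => [|k l IH] s.
  move=> _; under eq_Rintegral do rewrite big_nil addr0.
  by rewrite Rintegral_prob_cst !big_nil sqrtr0 /gsmooth eqxx subrr normr0 mulr0.
rewrite cons_uniq => /andP[kl ul].
rewrite !big_cons; set v := \sum_(k <- l) coord_var k.
have v0 : 0 <= v by apply: sumr_ge0 => i _; exact: coord_var_ge0.
pose h := gsmooth (Num.sqrt v) f.
have sv0 : 0 <= Num.sqrt v by exact: sqrtr_ge0.
have h01 x : 0 <= h x <= 1 by exact: gsmooth_itv.
have mh : measurable_fun setT h by exact: measurable_gsmooth.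
have mg i : measurable_fun setT (fun x : prodspace R K => g i (x i)) by case: (g_L2 i).
have msum u : measurable_fun setT
    (fun x : prodspace R K => u + \sum_(i <- l) g i (x i)).
  by apply: measurable_funD => //; apply: measurable_sum => i; exact: mg.
have ib (m : probability (prodspace R K) R) (u : prodspace R K -> R) :
    measurable_fun setT u -> (forall x, 0 <= u x <= 1) -> m.-integrable setT (EFin \o u).
  move=> mu' u01.
  apply: (le_integrable _ _ _ (finite_measure_integrable_cst m 1 measurableT)) => //.
    exact/measurable_EFinP.
  by move=> x _ /=; have /andP[? ?] := u01 x; rewrite lee_fin normr1 ger0_norm.
(* Resampling every coordinate but [k] separates its variable from those of [l], as [k] is not in
   [l]; the induction hypothesis then applies at the starting point [s + g k (x k)]. *)
have E1 : \int[mu]_x f (s + \sum_(i <- k :: l) g i (x i)) =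
   \int[mu]_x \int[mu]_y f ((s + g k (x k)) + \sum_(i <- l) g i (y i)).
  rewrite (Rintegral_mix mu_iid (pred1 k)); last first.
    apply: ib => //; apply: measurableT_comp => //; apply: measurable_funD => //.
    by apply: measurable_sum => i; exact: mg.
  apply: eq_Rintegral => x _; apply: eq_Rintegral => y _.
  rewrite big_cons /mix/= eqxx addrA; congr (f (_ + _)).
  rewrite big_seq [RHS]big_seq; apply: eq_bigr => i il; rewrite ifF//.
  by apply: contraNF kl => /eqP <-.
have mE : measurable_fun setT (fun x : prodspace R K =>
    \int[mu]_y f ((s + g k (x k)) + \sum_(i <- l) g i (y i))).
  apply: measurableT_comp => //.
  pose F (z : prodspace R K * prodspace R K) : \bar R :=
    (f ((s + g k (z.1 k)) + \sum_(i <- l) g i (z.2 i)))%:E.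
  apply: (@measurable_fun_fubini_tonelli_F _ _ _ _ _ mu F).
    apply/measurable_EFinP; apply: measurableT_comp => //; apply: measurable_funD.
      by apply: measurable_funD => //; exact: (measurableT_comp (mg k) measurable_fst).
    apply: measurable_sum => i; exact: (measurableT_comp (mg i) measurable_snd).
  by move=> z; rewrite lee_fin.
have E01 (x : prodspace R K) :
    0 <= \int[mu]_y f ((s + g k (x k)) + \sum_(i <- l) g i (y i)) <= 1.
  apply/andP; split; first exact: Rintegral_ge0.
  rewrite -[leRHS](Rintegral_prob_cst mu); apply: le_Rintegral => //.
  - by apply: ib => //; apply: measurableT_comp => //; exact: msum.
  - exact: finite_measure_integrable_cst.
  - by move=> y _; case/andP: (f01 (s + g k (x k) + \sum_(i <- l) g i (y i))).
have mhk : measurable_fun setT (fun x : prodspace R K => h (s + g k (x k))).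
  by apply: measurableT_comp => //; apply: measurable_funD.
have step1 : `|\int[mu]_x f (s + \sum_(i <- k :: l) g i (x i)) -
    \int[mu]_x h (s + g k (x k))| <= C * \sum_(i <- l) lindeberg_err i.
  rewrite E1 -RintegralB//; [|exact: ib..].
  have iE := ib mu _ mE E01.
  have ih := ib mu _ mhk (fun x => h01 (s + g k (x k))).
  have iD : mu.-integrable setT (EFin \o (fun x : prodspace R K =>
    \int[mu]_y f ((s + g k (x k)) + \sum_(i <- l) g i (y i)) - h (s + g k (x k)))).
    by have := integrableB measurableT iE ih; congr integrable.
  apply: le_trans (le_normr_Rintegral measurableT iD) _.
  rewrite -[leRHS](Rintegral_prob_cst mu); apply: le_Rintegral => //.
  - exact: integrable_norm.
  - exact: finite_measure_integrable_cst.
  - by move=> x _; exact: IH.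
have [d1 [d2 hT]] := gsmooth_taylor2_bound s C0 sv0 fsm.
have step2 := Rintegral_taylor2 C0 (g_L2 k) (g_mean0 k) mh h01 hT.
have step3 := gsmooth_taylor2 C0 (sqrtr_ge0 (coord_var k)) mh h01 hT.
(* The semigroup property: smoothing [h] once more adds the variance of the new variable. *)
rewrite gsmooth_gsmooth ?sqrtr_ge0// in step3.
rewrite !sqr_sqrtr ?coord_var_ge0// [v + _]addrC in step3.
rewrite -/(coord_var k) in step2.
(* The expansions of the variable and of its Gaussian substitute share [h s] and the variance term,
   which cancel. *)
have -> : \int[mu]_x f (s + (\sum_(i <- k :: l) g i (x i))) -
   gsmooth (Num.sqrt (coord_var k + v)) f s =
   (\int[mu]_x f (s + \sum_(i <- k :: l) g i (x i)) - \int[mu]_x h (s + g k (x k)))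
   + ((\int[mu]_x h (s + g k (x k)) - h s - d2 / 2 * coord_var k)
   - (gsmooth (Num.sqrt (coord_var k + v)) f s - h s - d2 / 2 * coord_var k)) by ring.
apply: le_trans (ler_normD _ _) _.
rewrite [leRHS]mulrDr [leRHS]addrC lerD//.
apply: le_trans (ler_normB _ _) _.
by rewrite /lindeberg_err mulrDr lerD.
Qed.

End lindeberg.

(** * Smoothing the indicator of a half-line *)

Section spline.
Context {R : realType}.
Implicit Types u y s x lam : R.

Definition pospart u : R := Num.max u 0.

Lemma pospartP u : (u <= 0 /\ pospart u = 0) \/ (0 <= u /\ pospart u = u).
Proof.
rewrite /pospart; case: (leP u 0) => u0; [left|right] => //.
by split => //; exact: ltW.
Qed.

(** Without change of sign the remainder is [0] or [y^3]. If [u] and [u + y] have opposite signs,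
    [|u + y| <= |y|] and the part that is cut off cannot exceed [|y|^3]. *)
Lemma pospart_cube_taylor u y :
  `|pospart (u + y) ^+ 3 - pospart u ^+ 3 - 3 * pospart u ^+ 2 * y
    - 3 * pospart u * y ^+ 2| <= `|y| ^+ 3.
Proof.
case: (pospartP u) => -[u0 ->]; case: (pospartP (u + y)) => -[uy0 ->].
- have -> : 0 ^+ 3 - 0 ^+ 3 - 3 * 0 ^+ 2 * y - 3 * 0 * y ^+ 2 = 0 :> R by ring.
  by rewrite normr0 exprn_ge0.
- have -> : (u + y) ^+ 3 - 0 ^+ 3 - 3 * 0 ^+ 2 * y - 3 * 0 * y ^+ 2 = (u + y) ^+ 3 by ring.
  rewrite ger0_norm ?exprn_ge0//.
  have y0 : 0 <= y by lra.
  by rewrite (ger0_norm y0) lerXn2r// ?nnegrE//; lra.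
- have y0 : y <= 0 by lra.
  have -> : 0 ^+ 3 - u ^+ 3 - 3 * u ^+ 2 * y - 3 * u * y ^+ 2 = y ^+ 3 - (u + y) ^+ 3 by ring.
  have -> : y ^+ 3 - (u + y) ^+ 3 = (- (u + y)) ^+ 3 - (- y) ^+ 3 by ring.
  rewrite (ler0_norm y0).
  set z := - (u + y); have z0 : 0 <= z by rewrite /z; lra.
  set t := - y; have zt : z <= t by rewrite /z /t; lra.
  have zt3 : z ^+ 3 <= t ^+ 3 by rewrite lerXn2r// ?nnegrE//; lra.
  have z3 : 0 <= z ^+ 3 by exact: exprn_ge0.
  by rewrite ler0_norm; lra.
- have -> : (u + y) ^+ 3 - u ^+ 3 - 3 * u ^+ 2 * y - 3 * u * y ^+ 2 = y ^+ 3 by ring.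
  by rewrite normrX.
Qed.

(* The distribution function of the sum of three independent uniform variables,
   and its first two derivatives. *)
Definition bspline u : R := (pospart u ^+ 3 - 3 * pospart (u - 1) ^+ 3 +
  3 * pospart (u - 2) ^+ 3 - pospart (u - 3) ^+ 3) / 6.
Definition bspline1 u : R := (pospart u ^+ 2 - 3 * pospart (u - 1) ^+ 2 +
  3 * pospart (u - 2) ^+ 2 - pospart (u - 3) ^+ 2) / 2.
Definition bspline2 u : R := pospart u - 3 * pospart (u - 1) +
  3 * pospart (u - 2) - pospart (u - 3).

Variant bspline_spec u : R -> R -> R -> Prop :=
| Bspline0 of u <= 0 : bspline_spec u 0 0 0
| Bspline1 of 0 <= u & u <= 1 : bspline_spec u (u ^+ 3 / 6) (u ^+ 2 / 2) u
| Bspline2 of 1 <= u & u <= 2 : bspline_spec u ((u ^+ 3 - 3 * (u - 1) ^+ 3) / 6)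
    ((u ^+ 2 - 3 * (u - 1) ^+ 2) / 2) (u - 3 * (u - 1))
| Bspline3 of 2 <= u & u <= 3 : bspline_spec u (1 - (3 - u) ^+ 3 / 6)
    ((3 - u) ^+ 2 / 2) (u - 3)
| Bspline4 of 3 <= u : bspline_spec u 1 0 0.

Lemma bsplineP u : bspline_spec u (bspline u) (bspline1 u) (bspline2 u).
Proof.
rewrite /bspline /bspline1 /bspline2.
case: (pospartP u) => -[u0 ->]; case: (pospartP (u - 1)) => -[u1 ->];
  case: (pospartP (u - 2)) => -[u2 ->]; case: (pospartP (u - 3)) => -[u3 ->];
  (* Only the five sign patterns compatible with the order of the knots remain. *)
  try lra.
- set b0 := _ / 6; set b1 := _ / 2; set b2 := _ - 0.
  have -> : b0 = 0 by rewrite /b0; field.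
  have -> : b1 = 0 by rewrite /b1; field.
  have -> : b2 = 0 by rewrite /b2; ring.
  exact: Bspline0.
- set b0 := _ / 6; set b1 := _ / 2; set b2 := _ - 0.
  have -> : b0 = u ^+ 3 / 6 by rewrite /b0; field.
  have -> : b1 = u ^+ 2 / 2 by rewrite /b1; field.
  have -> : b2 = u by rewrite /b2; ring.
  by apply: Bspline1; lra.
- set b0 := _ / 6; set b1 := _ / 2; set b2 := _ - 0.
  have -> : b0 = (u ^+ 3 - 3 * (u - 1) ^+ 3) / 6 by rewrite /b0; field.
  have -> : b1 = (u ^+ 2 - 3 * (u - 1) ^+ 2) / 2 by rewrite /b1; field.
  have -> : b2 = u - 3 * (u - 1) by rewrite /b2; ring.
  by apply: Bspline2; lra.
- set b0 := _ / 6; set b1 := _ / 2; set b2 := _ - 0.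
  have -> : b0 = 1 - (3 - u) ^+ 3 / 6 by rewrite /b0; field.
  have -> : b1 = (3 - u) ^+ 2 / 2 by rewrite /b1; field.
  have -> : b2 = u - 3 by rewrite /b2; ring.
  by apply: Bspline3; lra.
- set b0 := _ / 6; set b1 := _ / 2; set b2 := _ - (u - 3).
  have -> : b0 = 1 by rewrite /b0; field.
  have -> : b1 = 0 by rewrite /b1; field.
  have -> : b2 = 0 by rewrite /b2; ring.
  by apply: Bspline4; lra.
Qed.

Lemma bspline_itv u : 0 <= bspline u <= 1.
Proof.
case: bsplineP => [_|u0 u1|u1 u2|u2 u3|_]; apply/andP; split => //.
- by rewrite divr_ge0// exprn_ge0.
- have := exprn_ile1 3 u0 u1; lra.
- set t := u - 1; have t0 : 0 <= t by rewrite /t; lra.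
  have -> : u ^+ 3 = (t + 1) ^+ 3 by rewrite /t; ring.
  have t1 : t ^+ 3 <= 1 by apply: exprn_ile1 => //; rewrite /t; lra.
  have t2 : 0 <= t ^+ 2 by exact: sqr_ge0.
  have t3 : t ^+ 3 <= t ^+ 2.
    by rewrite exprS ler_piMl// /t; lra.
  have -> : (t + 1) ^+ 3 = t ^+ 3 + 3 * t ^+ 2 + 3 * t + 1 by ring.
  lra.
- set t := u - 1; have t0 : 0 <= t by rewrite /t; lra.
  have -> : u ^+ 3 = (t + 1) ^+ 3 by rewrite /t; ring.
  have t1 : t <= 1 by rewrite /t; lra.
  have t2 : 0 <= (1 - t) ^+ 2 * (1 + 2 * t) by rewrite mulr_ge0 ?sqr_ge0//; lra.
  have -> : (t + 1) ^+ 3 = t ^+ 3 + 3 * t ^+ 2 + 3 * t + 1 by ring.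
  lra.
- have v0 : 0 <= 3 - u by lra.
  have v1 : 3 - u <= 1 by lra.
  have := exprn_ile1 3 v0 v1; lra.
- have v0 : 0 <= 3 - u by lra.
  have := exprn_ge0 3 v0; lra.
Qed.

Lemma bspline1_le1 u : `|bspline1 u| <= 1.
Proof. by case: bsplineP => *; rewrite ler_norml; apply/andP; split; nra. Qed.

Lemma bspline2_le1 u : `|bspline2 u| <= 1.
Proof. by case: bsplineP => *; rewrite ler_norml; apply/andP; split; nra. Qed.

Lemma bspline_le0 u : u <= 0 -> bspline u = 0.
Proof. by case: bsplineP => // *; nra. Qed.

Lemma bspline_ge3 u : 3 <= u -> bspline u = 1.
Proof. by case: bsplineP => // *; nra. Qed.

(** For [|y| <= 1] the four truncated cubes give the factor [(1 + 3 + 3 + 1) / 6], which is below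
    [3]. For [|y| > 1] the increment, the linear term and the quadratic term are each at most [y^2],
    whence [3]. *)
Lemma bspline_taylor u : taylor2_bound 3 bspline u (bspline1 u) (bspline2 u).
Proof.
move=> y.
have cubic : `|bspline (u + y) - bspline u - bspline1 u * y - bspline2 u / 2 * y ^+ 2|
    <= 3 * `|y| ^+ 3.
  pose e v := pospart (v + y) ^+ 3 - pospart v ^+ 3 - 3 * pospart v ^+ 2 * y
    - 3 * pospart v * y ^+ 2.
  have -> : bspline (u + y) - bspline u - bspline1 u * y - bspline2 u / 2 * y ^+ 2 =
      (e u - 3 * e (u - 1) + 3 * e (u - 2) - e (u - 3)) / 6.
    rewrite /bspline /bspline1 /bspline2 /e.
    by rewrite (addrAC u y (- 1)) (addrAC u y (- 2)) (addrAC u y (- 3)); field.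
  have eb v : `|e v| <= `|y| ^+ 3 by exact: pospart_cube_taylor.
  move: (eb u) (eb (u - 1)) (eb (u - 2)) (eb (u - 3)).
  have := exprn_ge0 3 (normr_ge0 y).
  rewrite !ler_norml; move: (`|y| ^+ 3) (e u) (e (u - 1)) (e (u - 2)) (e (u - 3)) => *.
  apply/andP; split; lra.
have [y1|y1] := leP `|y| 1.
  apply: le_trans cubic _; rewrite ler_wpM2l// /mincube le_min lexx andbT.
  by rewrite exprS -[leRHS]mul1r real_normK ?num_real// ler_wpM2r// sqr_ge0.
have -> : mincube y = y ^+ 2.
  apply/min_idPl; rewrite -(real_normK (num_real y)).
  by rewrite [leRHS]exprS ler_peMl ?sqr_ge0// ltW.
have /andP[a0 a1] := bspline_itv (u + y); have /andP[b0 b1] := bspline_itv u.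
have := bspline1_le1 u; have := bspline2_le1 u.
have yy : `|y| <= y ^+ 2.
  by rewrite -(real_normK (num_real y)) expr2 ler_peMl// ltW.
have y2 : 1 <= y ^+ 2 by exact: le_trans (ltW y1) yy.
move=> c2 c1.
have t1 : `|bspline1 u * y| <= y ^+ 2.
  by rewrite normrM; apply: le_trans yy; rewrite ler_piMl.
have t2 : `|bspline2 u / 2 * y ^+ 2| <= y ^+ 2.
  rewrite normrM (ger0_norm (sqr_ge0 y)) ler_piMl ?sqr_ge0// normrM normfV normr_nat.
  by move: (`|bspline2 u|) c2 => *; lra.
move: t1 t2; rewrite !ler_norml => /andP[? ?] /andP[? ?].
by apply/andP; split; lra.
Qed.

Lemma continuous_pospart : continuous pospart.
Proof.
have -> : pospart = (fun u => (`|u| + u) / 2).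
  apply/funext => u; case: (pospartP u) => -[u0 ->].
    by rewrite ler0_norm//; ring.
  by rewrite ger0_norm//; field.
move=> u; apply: cvgMr_tmp; apply: cvgD; last exact: cvg_id.
exact: norm_continuous.
Qed.

Lemma continuous_pospartB x n : continuous (fun u => pospart (u - x) ^+ n).
Proof.
move=> u.
have cB : {for u, continuous (fun u : R => u - x)}.
  by apply: cvgB; [exact: cvg_id|exact: cvg_cst].
have cp := continuous_comp cB (continuous_pospart (x := u - x)).
exact: (continuous_comp cp (@exprn_continuous R n (pospart (u - x)))).
Qed.

Lemma continuous_bspline : continuous bspline.
Proof.
have c0 n : continuous (fun u => pospart u ^+ n).
  by have := @continuous_pospartB 0 n; under eq_fun do rewrite subr0.
move=> u; apply: cvgMr_tmp.
apply: cvgB; last exact: continuous_pospartB.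
apply: cvgD; last by apply: cvgMl_tmp; exact: continuous_pospartB.
apply: cvgB; first exact: c0.
by apply: cvgMl_tmp; exact: continuous_pospartB.
Qed.

Lemma measurable_bspline1 : measurable_fun setT bspline1.
Proof.
apply: continuous_measurable_fun => u.
have c0 n : continuous (fun u => pospart u ^+ n).
  by have := @continuous_pospartB 0 n; under eq_fun do rewrite subr0.
apply: cvgMr_tmp.
apply: cvgB; last exact: continuous_pospartB.
apply: cvgD; last by apply: cvgMl_tmp; exact: continuous_pospartB.
apply: cvgB; first exact: c0.
by apply: cvgMl_tmp; exact: continuous_pospartB.
Qed.

Lemma measurable_bspline2 : measurable_fun setT bspline2.
Proof.
apply: continuous_measurable_fun => u.
have c x : continuous (fun u => pospart (u - x)).
  by have := @continuous_pospartB x 1; under eq_fun do rewrite expr1.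
apply: cvgB; last exact: c.
apply: cvgD; last by apply: cvgMl_tmp; exact: c.
apply: cvgB; first exact: continuous_pospart.
by apply: cvgMl_tmp; exact: c.
Qed.

Definition soft_step x lam s : R := 1 - bspline (lam * (s - x)).

Lemma soft_step1 x lam s : 0 <= lam -> s <= x -> soft_step x lam s = 1.
Proof. by move=> l0 sx; rewrite /soft_step bspline_le0 ?subr0//; nra. Qed.

Lemma soft_step0 x lam s : 0 < lam -> x + 3 / lam <= s -> soft_step x lam s = 0.
Proof.
move=> l0 sx; rewrite /soft_step bspline_ge3 ?subrr//.
by rewrite -ler_pdivrMl// mulrC; lra.
Qed.

Lemma smooth_soft_step x lam : 0 < lam ->
  exists D1 D2, smooth_test (3 * (1 + lam) ^+ 3) (soft_step x lam) D1 D2.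
Proof.
move=> l0; have l0' := ltW l0.
exists (fun s => - lam * bspline1 (lam * (s - x))),
  (fun s => - lam ^+ 2 * bspline2 (lam * (s - x))).
(* Scaling multiplies the square by [lam^2] and the cube by [lam^3]; [(1 + lam)^3] dominates both,
   as well as the bounds [lam] and [lam^2] on the coefficients. *)
have mc y : mincube (lam * y) <= (1 + lam) ^+ 3 * mincube y.
  rewrite /mincube minr_pMr ?exprn_ge0 ?addr_ge0//.
  rewrite le_min !ge_min !exprMn normrM (ger0_norm l0') exprMn.
  apply/andP; split; apply/orP; [left|right].
    by rewrite ler_wpM2r ?sqr_ge0//; nra.
  rewrite ler_wpM2r ?exprn_ge0// lerXn2r// ?nnegrE ?addr_ge0//; lra.
have maff : measurable_fun setT (fun s : R => lam * (s - x)).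
  by apply: measurable_funM => //; exact: measurable_funB.
split.
- move=> s; apply: cvgB; first exact: cvg_cst.
  have cB : {for s, continuous (fun s : R => lam * (s - x))}.
    by apply: cvgMl_tmp; apply: cvgB; [exact: cvg_id|exact: cvg_cst].
  exact: (continuous_comp cB (continuous_bspline (x := lam * (s - x)))).
- by move=> s; have := bspline_itv (lam * (s - x)); rewrite /soft_step; lra.
- split; apply: measurable_funM => //.
    by apply: measurableT_comp => //; exact: measurable_bspline1.
  by apply: measurableT_comp => //; exact: measurable_bspline2.
- move=> s; rewrite (normrM (- lam)) (normrM (- lam ^+ 2)) !normrN normrX (ger0_norm l0').
  have := bspline1_le1 (lam * (s - x)); have := bspline2_le1 (lam * (s - x)).
  have := normr_ge0 (bspline1 (lam * (s - x))); have := normr_ge0 (bspline2 (lam * (s - x))).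
  move: (`|bspline1 _|) (`|bspline2 _|) => b1 b2 b20 b10 b21 b11.
  split.
    apply: (@le_trans _ _ lam); first by rewrite ler_piMr.
    nra.
  apply: (@le_trans _ _ (lam ^+ 2)); first by rewrite ler_piMr ?sqr_ge0.
  nra.
move=> s y.
have := bspline_taylor (lam * (s - x)) (lam * y).
rewrite /soft_step => T.
have -> : 1 - bspline (lam * (s + y - x)) - (1 - bspline (lam * (s - x))) -
   - lam * bspline1 (lam * (s - x)) * y -
   - lam ^+ 2 * bspline2 (lam * (s - x)) / 2 * y ^+ 2 =
  - (bspline (lam * (s - x) + lam * y) - bspline (lam * (s - x)) -
       bspline1 (lam * (s - x)) * (lam * y) -
       bspline2 (lam * (s - x)) / 2 * (lam * y) ^+ 2).
  have -> : lam * (s + y - x) = lam * (s - x) + lam * y by ring.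
  by field.
rewrite normrN; apply: le_trans T _.
by rewrite -mulrA ler_wpM2l.
Qed.

End spline.

(** * The Lindeberg condition for rescaled copies of one variable *)

Section mincube_limit.
Context d (T : measurableType d) (R : realType) (m : probability T R).

(** One has [mincube (a f) = a^2 f^2 min(1, a |f|)]. The factor [c a^2] is bounded, and the rest
    tends to zero by domination by [f^2], so that a second moment suffices. *)
Lemma integral_mincube_cvg0 (f : T -> R) (a c : nat -> R) (B : R) :
  L2 m f -> (forall n, 0 <= a n) -> (forall n, 0 <= c n) ->
  (forall n, c n * a n ^+ 2 <= B) -> a n @[n --> \oo] --> (0 : R) ->
  c n * \int[m]_x mincube (a n * f x) @[n --> \oo] --> (0 : R).
Proof.
move=> [mf f2] a0 c0 cB acvg.
have B0 : 0 <= B by apply: le_trans (cB 0); rewrite mulr_ge0 ?sqr_ge0.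
pose w n x := f x ^+ 2 * Num.min 1 (a n * `|f x|).
have mw n : measurable_fun setT (w n).
  apply: measurable_funM; first exact: measurable_funX.
  apply: measurable_minr => //; apply: measurable_funM => //.
  by apply: measurableT_comp.
have w0 n x : 0 <= w n x.
  by rewrite mulr_ge0 ?sqr_ge0// le_min ler01 mulr_ge0.
have wf n x : w n x <= f x ^+ 2.
  by rewrite ler_piMr ?sqr_ge0// ge_min lexx.
have iw n : m.-integrable setT (EFin \o w n).
  apply: (le_integrable _ _ _ f2) => //; first exact/measurable_EFinP.
  by move=> x _ /=; rewrite lee_fin !ger0_norm ?sqr_ge0.
have wcvg : (\int[m]_x w n x) @[n --> \oo] --> (0 : R).
  have [] := @dominated_convergence _ _ _ m setT measurableT (fun n => EFin \o w n)
    (cst 0%E) (EFin \o (fun x => f x ^+ 2)).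
  - by move=> n; exact/measurable_EFinP.
  - exact: measurable_cst.
  - apply: aeW => x _ /=; apply: cvg_EFin; first by apply: nearW.
    apply: (@squeeze_cvgr _ _ _ _ (cst 0) (fun n => f x ^+ 2 * (a n * `|f x|))).
    + apply: nearW => n /=; rewrite w0/= ler_wpM2l ?sqr_ge0// ge_min lexx orbT//.
    + exact: cvg_cst.
    + rewrite -(mulr0 (f x ^+ 2)); apply: cvgMl_tmp.
      by rewrite -(mul0r `|f x|); exact: cvgMr_tmp.
  - exact: f2.
  - by apply: aeW => x n _ /=; rewrite lee_fin ger0_norm.
  move=> _ _; rewrite integral0 => cv.
  have : fine (\int[m]_x (w n x)%:E)%E @[n --> \oo] --> fine (0%:E : \bar R).
    exact: fine_cvg.
  by [].
apply: (@squeeze_cvgr _ _ _ _ (cst 0) (fun n => B * \int[m]_x w n x)); last 2 first.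
- exact: cvg_cst.
- by rewrite -(mulr0 B); exact: cvgMl_tmp.
apply: nearW => n; apply/andP; split.
  by rewrite mulr_ge0//; apply: Rintegral_ge0 => x _; exact: mincube_ge0.
apply: le_trans (_ : c n * (a n ^+ 2 * \int[m]_x w n x) <= _); last first.
  by rewrite mulrA ler_wpM2r//; apply: Rintegral_ge0.
rewrite ler_wpM2l// -RintegralZl//.
have maf : measurable_fun setT (fun x => a n * f x) by exact: measurable_funM.
have wE x : mincube (a n * f x) = a n ^+ 2 * w n x.
  have af0 : 0 <= a n ^+ 2 * f x ^+ 2 by rewrite mulr_ge0 ?sqr_ge0.
  rewrite /mincube /w [RHS]mulrA (minr_pMr _ _ af0) mulr1 exprMn; congr Num.min.
  rewrite normrM (ger0_norm (a0 n)) -[f x ^+ 2](real_normK (num_real _)); ring.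
by under eq_Rintegral do rewrite wE.
Qed.

End mincube_limit.

(** * A central limit theorem for weighted sums with a negligible remainder *)

(** Only the second moment of the remainder will be known to vanish, so the linear term is split by
    [|y| <= eta + y^2 / eta] with [eta] small at will; the [2] accounts for the quadratic term and
    the Taylor error. *)
Lemma smooth_test_increment (R : realType) (C : R) f D1 D2 s y eta :
  0 < eta -> 0 <= C -> smooth_test C f D1 D2 ->
  `|f (s + y) - f s| <= C * eta + C * (eta^-1 + 2) * y ^+ 2.
Proof.
move=> eta0 C0 [_ _ _ bD fT].
have := fT s y; have [b1 b2] := bD s.
set r := _ - _ - _ - _ => rb.
have -> : f (s + y) - f s = r + D1 s * y + D2 s / 2 * y ^+ 2 by rewrite /r; ring.
have yb : `|y| <= eta + eta^-1 * y ^+ 2.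
  rewrite -(real_normK (num_real y)); move: (`|y|) (normr_ge0 y) => z z0.
  rewrite -(ler_pM2r eta0) mulrDl mulrAC mulVf ?gt_eqF// mul1r; nra.
have t1 : `|D1 s * y| <= C * (eta + eta^-1 * y ^+ 2).
  by rewrite normrM; apply: ler_pM.
have t2 : `|D2 s / 2 * y ^+ 2| <= C * y ^+ 2.
  rewrite normrM (ger0_norm (sqr_ge0 y)) ler_wpM2r ?sqr_ge0//.
  by rewrite normrM normfV normr_nat; lra.
have t3 : `|r| <= C * y ^+ 2.
  by apply: le_trans rb _; rewrite ler_wpM2l// mincube_le2.
apply: le_trans (ler_normD _ _) _; apply: le_trans (lerD (ler_normD _ _) (lexx _)) _.
apply: le_trans (lerD (lerD t3 t1) t2) _.
by rewrite le_eqVlt; apply/orP; left; apply/eqP; ring.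
Qed.

Section clt.
Context {R : realType} {K : choiceType} (mu : probability (prodspace R K) R)
  (nu : probability R R).
Hypothesis mu_iid : iid_law mu nu.
Variables (l : nat -> seq K) (g : nat -> K -> R -> R) (V : R)
  (rem : nat -> prodspace R K -> R).
Hypothesis l_uniq : forall N, uniq (l N).
Hypothesis g_L2 : forall N k, L2 mu (fun x => g N k (x k)).
Hypothesis g_mean0 : forall N k, \int[mu]_x g N k (x k) = 0.
Hypothesis V_gt0 : 0 < V.
Hypothesis var_l : \forall N \near \oo, \sum_(k <- l N) coord_var mu (g N) k = V.
Hypothesis err_l : \sum_(k <- l N) lindeberg_err mu (g N) k @[N --> \oo] --> (0 : R).
Hypothesis rem_L2 : forall N, L2 mu (rem N).
Hypothesis rem_cvg : \int[mu]_x (rem N x ^+ 2) @[N --> \oo] --> (0 : R).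

Let W N (x : prodspace R K) : R := \sum_(k <- l N) g N k (x k) + rem N x.

Lemma measurable_clt_sum N :
  measurable_fun setT (fun x : prodspace R K => \sum_(k <- l N) g N k (x k)).
Proof. by apply: measurable_sum => k; case: (g_L2 N k). Qed.

Lemma measurable_clt N : measurable_fun setT (W N).
Proof.
apply: measurable_funD; first exact: measurable_clt_sum.
by case: (rem_L2 N).
Qed.

Lemma integrable_test (f : R -> R) (u : prodspace R K -> R) :
  measurable_fun setT f -> (forall x, 0 <= f x <= 1) -> measurable_fun setT u ->
  mu.-integrable setT (EFin \o (fun x => f (u x))).
Proof.
move=> mf f01 mu'.
apply: (le_integrable _ _ _ (finite_measure_integrable_cst mu 1 measurableT)) => //.
  by apply/measurable_EFinP; exact: measurableT_comp.
by move=> x _ /=; have /andP[? ?] := f01 (u x); rewrite lee_fin normr1 ger0_norm.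
Qed.

Lemma clt_smooth_test C f D1 D2 : 0 <= C -> smooth_test C f D1 D2 ->
  \int[mu]_x f (W N x) @[N --> \oo] --> gsmooth (Num.sqrt V) f 0.
Proof.
move=> C0 fsm; have [cf f01 _ _ _] := fsm.
have mf : measurable_fun setT f by exact: continuous_measurable_fun.
have diff eta N : 0 < eta ->
    `|\int[mu]_x f (W N x) - \int[mu]_x f (0 + \sum_(k <- l N) g N k (x k))| <=
    C * eta + C * (eta^-1 + 2) * \int[mu]_x (rem N x ^+ 2).
  move=> eta0.
  have mS := measurable_clt_sum N.
  have iW := integrable_test mf f01 (measurable_clt N).
  have iS : mu.-integrable setT
      (EFin \o (fun x : prodspace R K => f (0 + \sum_(k <- l N) g N k (x k)))).
    apply: (integrable_test (u := fun x => 0 + \sum_(k <- l N) g N k (x k)) mf f01).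
    exact: measurable_funD.
  have [_ ir] := rem_L2 N.
  rewrite -RintegralB//.
  have iD := integrableB measurableT iW iS.
  apply: le_trans (le_normr_Rintegral measurableT iD) _.
  have ic : mu.-integrable setT (EFin \o (fun=> C * eta)).
    exact: finite_measure_integrable_cst.
  have iq := integrableZl measurableT (C * (eta^-1 + 2)) ir.
  rewrite -[X in _ <= X + _](Rintegral_prob_cst mu) -RintegralZl// -RintegralD//.
  apply: le_Rintegral => //.
  - exact: (integrable_norm iD).
  - exact: (integrableD measurableT ic iq).
  - move=> x _; rewrite add0r /W; exact: (smooth_test_increment _ _ eta0 C0 fsm).
apply/cvgrPdist_le => /= eps eps0.
(* Three errors of size [C * c] must fit into [eps]; [C + 1] avoids dividing by zero when
   [C = 0]. *)
pose c := eps / (3 * (C + 1)).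
have C1 : 0 < C + 1 by lra.
have c0 : 0 < c by rewrite divr_gt0// mulr_gt0.
have k0 : 0 < c^-1 + 2 by rewrite addr_gt0// invr_gt0.
have rk0 : 0 < c / (c^-1 + 2) by rewrite divr_gt0.
near=> N.
rewrite distrC.
have E : \sum_(k <- l N) coord_var mu (g N) k = V by near: N.
have := lindeberg mu_iid (g_L2 N) (g_mean0 N) 0 C0 fsm (l_uniq N).
rewrite E => Lb.
have errN : \sum_(k <- l N) lindeberg_err mu (g N) k <= c.
  apply: le_trans (ler_norm _) _; near: N.
  by move/cvgr0Pnorm_le : err_l => /(_ c c0).
have remN : \int[mu]_x (rem N x ^+ 2) <= c / (c^-1 + 2).
  apply: le_trans (ler_norm _) _; near: N.
  by move/cvgr0Pnorm_le : rem_cvg => /(_ _ rk0).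
have D := diff c N c0.
apply: le_trans (ler_distD (\int[mu]_x f (0 + \sum_(k <- l N) g N k (x k))) _ _) _.
have Ee : eps = 3 * (C * c) + 3 * c.
  by rewrite /c; field; rewrite gt_eqF.
have D2' : C * (c^-1 + 2) * \int[mu]_x (rem N x ^+ 2) <= C * c.
  rewrite -mulrA ler_wpM2l//; apply: le_trans (ler_wpM2l (ltW k0) remN) _.
  by rewrite mulrC divfK// gt_eqF.
have D3 : C * \sum_(k <- l N) lindeberg_err mu (g N) k <= C * c by rewrite ler_wpM2l.
lra.
Unshelve. all: end_near. Qed.

Lemma soft_step_itv (x lam s : R) : 0 <= soft_step x lam s <= 1.
Proof. by have := bspline_itv (lam * (s - x)); rewrite /soft_step; lra. Qed.

Lemma gsmooth_EFin (f : R -> R) : measurable_fun setT f ->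
  (forall x, 0 <= f x <= 1) ->
  ((gsmooth (Num.sqrt V) f 0)%:E =
   \int[lebesgue_measure]_y (f y * normal_pdf 0 (Num.sqrt V) y)%:E)%E.
Proof.
move=> mf f01; have sV : 0 < Num.sqrt V by rewrite sqrtr_gt0.
rewrite gsmoothE// /Rintegral fineK.
  by apply: eq_integral => y _; rewrite add0r.
apply: integrable_fin_num => //; apply: integrable_gsmooth => //.
by exists 1 => x; have /andP[? ?] := f01 x; rewrite ger0_norm.
Qed.

Lemma measurable_soft_step x lam : measurable_fun setT (@soft_step R x lam).
Proof.
apply: measurable_funB => //; apply: (@measurableT_comp _ _ _ _ _ _ (@bspline R)).
  by apply: continuous_measurable_fun; exact: continuous_bspline.
by apply: measurable_funM => //; exact: measurable_funB.
Qed.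

Lemma measurable_soft_step_pdf x lam : measurable_fun setT
  (fun y => (soft_step x lam y * normal_pdf 0 (Num.sqrt V) y)%:E).
Proof.
apply/measurable_EFinP; apply: measurable_funM; first exact: measurable_soft_step.
exact: measurable_normal_pdf.
Qed.

Lemma measurable_pdf_ray (b : R) : measurable_fun setT
  ((fun y => (normal_pdf 0 (Num.sqrt V) y)%:E) \_ `]-oo, b]%classic).
Proof.
apply/(measurable_restrictT _ _).1; first exact: measurable_itv.
apply/measurable_EFinP; apply: measurable_funTS; exact: measurable_normal_pdf.
Qed.

Lemma gsmooth_soft_step_le x lam : 0 < lam ->
  ((gsmooth (Num.sqrt V) (soft_step x lam) 0)%:E <=
   normal_prob 0 (Num.sqrt V) `]-oo, (x + 3 / lam)%R]%classic)%E.
Proof.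
move=> l0; rewrite gsmooth_EFin; [|exact: measurable_soft_step|exact: soft_step_itv].
rewrite /normal_prob [leRHS]integral_mkcond; apply: ge0_le_integral => //.
- move=> y _; rewrite lee_fin mulr_ge0 ?normal_pdf_ge0//.
  by case/andP: (soft_step_itv x lam y).
- exact: measurable_soft_step_pdf.
- exact: measurable_pdf_ray.
- move=> y _; rewrite patchE; case: ifPn => yx.
    by rewrite lee_fin ler_piMl ?normal_pdf_ge0//; case/andP: (soft_step_itv x lam y).
  rewrite notin_setE/= in_itv/= in yx.
  rewrite soft_step0 ?mul0r//; apply: ltW; rewrite ltNge; exact/negP.
Qed.

Lemma gsmooth_soft_step_ge x lam : 0 < lam ->
  (normal_prob 0 (Num.sqrt V) `]-oo, x]%classic <=
   (gsmooth (Num.sqrt V) (soft_step x lam) 0)%:E)%E.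
Proof.
move=> l0; rewrite gsmooth_EFin; [|exact: measurable_soft_step|exact: soft_step_itv].
rewrite /normal_prob [leLHS]integral_mkcond; apply: ge0_le_integral => //.
- by move=> y _; rewrite patchE; case: ifP => // _; rewrite lee_fin normal_pdf_ge0.
- exact: measurable_pdf_ray.
- exact: measurable_soft_step_pdf.
- move=> y _; rewrite patchE; case: ifPn => yx; last first.
    rewrite lee_fin mulr_ge0 ?normal_pdf_ge0//.
    by case/andP: (soft_step_itv x lam y).
  rewrite inE/= in_itv/= in yx.
  by rewrite soft_step1 ?mul1r// ltW.
Qed.

Lemma measurable_clt_event N x : measurable [set w | W N w <= x].
Proof.
have -> : [set w | W N w <= x] = setT `&` W N @^-1` `]-oo, x]%classic.
  by rewrite setTI; apply/seteqP; split => w /=; rewrite in_itv.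
by apply: measurable_clt => //; exact: measurable_itv.
Qed.

Lemma clt_event_le N x lam : 0 < lam ->
  fine (mu [set w | W N w <= x]) <= \int[mu]_w soft_step x lam (W N w).
Proof.
move=> l0; have mA := measurable_clt_event N x.
have iA := integrable_indic mu mA.
have -> : fine (mu [set w | W N w <= x]) = \int[mu]_w \1_[set w | W N w <= x] w.
  by rewrite /Rintegral integral_indic// setIT.
apply: le_Rintegral => //.
  apply: (integrable_test (f := soft_step x lam)); last exact: measurable_clt.
    exact: measurable_soft_step.
  exact: soft_step_itv.
move=> w _; rewrite indicE; have [|_] := boolP (w \in _).
  by rewrite inE/= => wx; rewrite soft_step1// ltW.
by case/andP: (soft_step_itv x lam (W N w)).
Qed.

Lemma clt_event_ge N x lam : 0 < lam ->
  \int[mu]_w soft_step (x - 3 / lam) lam (W N w) <= fine (mu [set w | W N w <= x]).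
Proof.
move=> l0; have mA := measurable_clt_event N x.
have iA := integrable_indic mu mA.
have -> : fine (mu [set w | W N w <= x]) = \int[mu]_w \1_[set w | W N w <= x] w.
  by rewrite /Rintegral integral_indic// setIT.
apply: le_Rintegral => //.
  apply: (integrable_test (f := soft_step (x - 3 / lam) lam)); last exact: measurable_clt.
    exact: measurable_soft_step.
  exact: soft_step_itv.
move=> w _; rewrite indicE; have [|] := boolP (w \in _).
  by case/andP: (soft_step_itv (x - 3 / lam) lam (W N w)).
rewrite notin_setE/= => wx; rewrite soft_step0// subrK.
by apply: ltW; rewrite ltNge; exact/negP.
Qed.

(** The soft step starting at [x] lies above the indicator of the half-line and the one ending at
    [x] lies below it; continuity of the limit at [x] closes the gap between their Gaussian
    means. *)
Theorem clt_cdf x :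
  {for x, continuous (fun y : R => normal_prob 0 (Num.sqrt V) `]-oo, y]%classic)} ->
  mu [set w | W N w <= x] @[N --> \oo] --> normal_prob 0 (Num.sqrt V) `]-oo, x]%classic.
Proof.
move=> cPhi.
pose F (y : R) := normal_prob 0 (Num.sqrt V) `]-oo, y]%classic.
have Ffin y : F y \is a fin_num by exact: fin_num_measure.
have FE y : F y = (fine (F y))%:E by rewrite fineK.
have cF : fine (F y) @[y --> x] --> fine (F x).
  by apply: fine_cvg; rewrite -FE; exact: cPhi.
rewrite -/(F x) FE; apply: cvg_EFin.
  by apply: nearW => N; apply: fin_num_measure; exact: measurable_clt_event.
apply/cvgrPdist_le => /= eps eps0.
have eps2 : 0 < eps / 2 by rewrite divr_gt0.
move/cvgrPdist_le : cF => /(_ _ eps2) /nbhs_ballP[delta /= d0 xF].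
(* The step then has width [3 / lam = delta / 2], which keeps its ends inside the ball of
   continuity. *)
pose lam := 6 / delta.
have lam0 : 0 < lam by rewrite divr_gt0.
have lamE : 3 / lam = delta / 2 by rewrite /lam; field; rewrite gt_eqF.
have [C C0 [D1 [D2 fup]]] : exists2 C, 0 <= C & exists D1 D2, smooth_test C (soft_step x lam) D1 D2.
  exists (3 * (1 + lam) ^+ 3); last exact: smooth_soft_step.
  by rewrite mulr_ge0// exprn_ge0// addr_ge0// ltW.
have [C' C'0 [D1' [D2' flow]]] : exists2 C, 0 <= C &
    exists D1 D2, smooth_test C (soft_step (x - 3 / lam) lam) D1 D2.
  exists (3 * (1 + lam) ^+ 3); last exact: smooth_soft_step.
  by rewrite mulr_ge0// exprn_ge0// addr_ge0// ltW.
have cup := clt_smooth_test C0 fup.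
have clow := clt_smooth_test C'0 flow.
have up := gsmooth_soft_step_le x lam0.
have low := gsmooth_soft_step_ge (x - 3 / lam) lam0.
rewrite -/(F _) FE lee_fin lamE in up.
rewrite -/(F _) FE lee_fin lamE in low.
have xFp : `|fine (F x) - fine (F (x + delta / 2))| <= eps / 2.
  apply: xF; rewrite /ball/= opprD addNKr normrN ger0_norm; lra.
have xFm : `|fine (F x) - fine (F (x - delta / 2))| <= eps / 2.
  apply: xF; rewrite /ball/= opprD opprK addNKr ger0_norm; lra.
near=> N.
have iup : `|gsmooth (Num.sqrt V) (soft_step x lam) 0 -
    \int[mu]_w soft_step x lam (W N w)| <= eps / 2.
  by near: N; move/cvgrPdist_le : cup => /(_ _ eps2).
have ilow : `|gsmooth (Num.sqrt V) (soft_step (x - delta / 2) lam) 0 -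
    \int[mu]_w soft_step (x - delta / 2) lam (W N w)| <= eps / 2.
  by near: N; rewrite -lamE; move/cvgrPdist_le : clow => /(_ _ eps2).
have e1 := clt_event_le N x lam0.
have e2 := clt_event_ge N x lam0.
rewrite lamE in e2.
move: iup ilow xFp xFm e1 e2; rewrite !ler_norml.
move=> /andP[? ?] /andP[? ?] /andP[? ?] /andP[? ?] ? ?; apply/andP; split; lra.
Unshelve. all: end_near. Qed.

End clt.

(** * Residuals after projection on single coordinates *)

(** Transpositions carry statements about one coordinate to another, the coordinates being
    exchangeable. *)
Definition swap (K : eqType) (i j k : K) : K :=
  if k == i then j else if k == j then i else k.

Lemma swapK (K : eqType) (i j : K) : involutive (swap i j).
Proof.
move=> k; rewrite /swap; case: (eqVneq k i) => [->|ki].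
  by rewrite eqxx; case: eqVneq.
case: (eqVneq k j) => [->|kj]; first by rewrite eqxx.
by rewrite (negbTE ki) (negbTE kj).
Qed.

Lemma swap_inj (K : eqType) (i j : K) : injective (swap i j).
Proof. exact: inv_inj (swapK i j). Qed.

Section iid_coordinates.
Context {R : realType} {K : choiceType} (mu : probability (prodspace R K) R)
  (nu : probability R R).
Hypothesis mu_iid : iid_law mu nu.

Lemma L2_coord (f : R -> R) k k' : L2 mu (fun x => f (x k)) -> L2 mu (fun x => f (x k')).
Proof.
move=> fk; have := L2_relabel mu_iid (@swap_inj _ k k') fk.
by congr L2; apply/funext => x; rewrite /relabel/= /swap eqxx.
Qed.

Lemma Rintegral_coord (f : R -> R) k k' :
  mu.-integrable setT (EFin \o (fun x => f (x k))) ->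
  \int[mu]_x f (x k') = \int[mu]_x f (x k).
Proof.
move=> fk; rewrite -(Rintegral_relabel mu_iid (@swap_inj _ k k') fk).
by apply: eq_Rintegral => x _; rewrite /relabel/= /swap eqxx.
Qed.

Lemma ae_relabel tau (Q : prodspace R K -> Prop) : injective tau ->
  {ae mu, forall x, Q x} -> {ae mu, forall x, Q (relabel tau x)}.
Proof.
move=> tau_inj [N [mN N0 QN]]; exists (relabel tau @^-1` N); split.
- rewrite -[X in measurable X]setTI; exact: (measurable_relabel tau).
- rewrite -[LHS]/(pushforward mu (relabel tau) N) (relabel_law mu_iid tau_inj mN).
  exact: N0.
- by move=> x /= Qx; exact: QN.
Qed.

Lemma ae_cmean_relabel tau k (f : prodspace R K -> R) (e : R -> R) : injective tau ->
  mu.-integrable setT (EFin \o f) ->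
  {ae mu, forall x, cmean mu k f x = e (x k)} ->
  {ae mu, forall x, cmean mu (tau k) (fun y => f (relabel tau y)) x = e (x (tau k))}.
Proof.
move=> tau_inj fi fe.
have fi' := ae_relabel tau_inj (ae_cmean_int mu_iid k fi).
have fe' := ae_relabel tau_inj fe.
apply: filterS2 fi' fe' => x ix ex.
by rewrite (cmean_relabel mu_iid tau_inj ix) ex.
Qed.

Lemma Rintegral_cmean k (f : prodspace R K -> R) : mu.-integrable setT (EFin \o f) ->
  \int[mu]_x cmean mu k f x = \int[mu]_x f x.
Proof. by move=> fi; rewrite (Rintegral_mix mu_iid (pred1 k) fi). Qed.

Lemma Rintegral_sqr_sum (e : K -> R -> R) (l : seq K) : uniq l ->
  (forall k, L2 mu (fun x => e k (x k))) -> (forall k, \int[mu]_x e k (x k) = 0) ->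
  \int[mu]_x ((\sum_(k <- l) e k (x k)) ^+ 2) = \sum_(k <- l) \int[mu]_x (e k (x k) ^+ 2).
Proof.
move=> ul e2 e0.
have ekj k j := L2_mul (e2 k) (e2 j).
have ek k : mu.-integrable setT (EFin \o (fun x => \sum_(j <- l) e k (x k) * e j (x j))).
  by apply: integrable_Rsum => j; exact: ekj.
under eq_Rintegral do rewrite expr2 big_distrlr/=.
rewrite (Rintegral_sum _ _ ek) big_seq [RHS]big_seq; apply: eq_bigr => k kl.
rewrite (Rintegral_sum _ _ (ekj k)) (bigD1_seq k)//= big1_seq ?addr0// => j /andP[jk _].
(* For [j] different from [k] the variable is entirely resampled, so its conditional mean is its
   mean. *)
have cj x : cmean mu k (fun y => e j (y j)) x = 0.
  rewrite -[RHS](e0 j); apply: eq_Rintegral => y _.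
  by rewrite /mix/= (negbTE jk).
apply: (integral_mul_eq0 (D := [set k]) (D' := [set j]) (k := k) mu_iid (e2 k) (e2 j)) => //.
- by move=> x y xy; rewrite xy.
- by move=> x y xy; rewrite xy.
- exact: (aeW _ cj).
Qed.

Section hoeffding_residual.
Variables (H : prodspace R K -> R) (e : K -> R -> R) (D : seq K).
Hypotheses (H_L2 : L2 mu H) (D_uniq : uniq D).
Hypothesis e_L2 : forall k, L2 mu (fun x => e k (x k)).
Hypothesis e_mean0 : forall k, \int[mu]_x e k (x k) = 0.
Hypothesis cmean_H : forall k, k \in D ->
  {ae mu, forall x, cmean mu k H x = \int[mu]_y H y + e k (x k)}.

Definition residual x : R := H x - \int[mu]_y H y - \sum_(k <- D) e k (x k).

Lemma L2_residual : L2 mu residual.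
Proof.
apply: L2B; last exact: L2_sum.
by apply: L2B => //; exact: L2_cst.
Qed.

(** Given the coordinate [k], every other projection averages to zero, while the one of index [k],
    which occurs once, cancels the conditional mean of [H]. *)
Lemma cmean_residual k : k \in D -> {ae mu, forall x, cmean mu k residual x = 0}.
Proof.
move=> kD; apply: filterS2 (cmean_H kD) (ae_cmean_int mu_iid k (L2_int H_L2)) => x cx ix.
rewrite /cmean /residual.
have ie j : mu.-integrable setT (fun y => (e j (mix (pred1 k) (x, y) j))%:E).
  rewrite /mix/=; have [->|jk] := eqVneq j k.
    exact: finite_measure_integrable_cst.
  exact: (L2_int (e_L2 j)).
have isum := integrable_Rsum D xpredT ie.
have ic := finite_measure_integrable_cst mu (\int[mu]_y H y) measurableT.
have iHc := integrableB measurableT ix ic.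
rewrite RintegralB// RintegralB// Rintegral_prob_cst.
rewrite -/(cmean mu k H x) cx.
have -> : \int[mu]_y (\sum_(j <- D) e j (mix (pred1 k) (x, y) j)) = e k (x k).
  rewrite (Rintegral_sum _ _ ie) (bigD1_seq k)//= big1_seq ?addr0.
    by rewrite /mix/= eqxx Rintegral_prob_cst.
  by move=> j /andP[jk _]; rewrite /mix/= (negbTE jk); exact: e_mean0.
by ring.
Qed.

End hoeffding_residual.

End iid_coordinates.

(** * The Hoeffding decomposition of the U-statistic *)

(** The sets with measurable preimage form a sigma-algebra containing the generators. *)
Lemma sigma_family_preimage d (T : measurableType d) (R : realType) I S
    (X : I -> S -> R) (F : T -> S) (A : set S) :
  (forall i, measurable_fun setT (fun w => X i (F w))) ->
  sigma_family setT X A -> measurable (F @^-1` A).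
Proof.
move=> mX; move: A; rewrite -[forall A, _]/(_ `<=` [set A | measurable (F @^-1` A)]).
apply: smallest_sub.
  split => //=.
  - by rewrite preimage_set0.
  - by move=> B mB; rewrite setTD preimage_setC; exact: measurableC.
  - by move=> B mB; rewrite preimage_bigcup; exact: bigcupT_measurable.
move=> _ [i _ [B mB <-]] /=; rewrite setTI -[X in measurable X]setTI.
exact: (mX i).
Qed.

Definition AHK_index : Type := (nat + nat + nat * nat)%type.
HB.instance Definition _ := Choice.on AHK_index.

Definition row_ix i : AHK_index := inl (inl i).
Definition col_ix j : AHK_index := inl (inr j).
Definition cell_ix ij : AHK_index := inr ij.

(** Renaming rows and columns renames the cells along with them, so that every kernel value is the
    leading one read after a relabelling and has the same law. *)
Definition lift_index (r c : nat -> nat) (k : AHK_index) : AHK_index :=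
  match k with
  | inl (inl i) => row_ix (r i)
  | inl (inr j) => col_ix (c j)
  | inr ij => cell_ix (r ij.1, c ij.2)
  end.

Lemma lift_index_inj r c : injective r -> injective c -> injective (lift_index r c).
Proof.
move=> ri ci [[i|j]|[i j]] [[i'|j']|[i' j']] //= [].
- by move=> /ri ->.
- by move=> /ci ->.
- by move=> /ri -> /ci ->.
Qed.

Section enum_set.
Variables (m p : nat).
Implicit Type A : {set 'I_m}.

(* The elements of [A] in increasing order, extended to an injective sequence. *)
Definition enum_set A (a : nat) : nat :=
  if (#|A| == p) && (a < p)%N then elements A a else (m + a)%N.

Lemma elementsP A a : (a < #|A|)%N -> exists2 i : 'I_m, i \in A & elements A a = i.
Proof.
move=> aA; have : elements A a \in [seq val i | i <- enum A].
  by apply: mem_nth; rewrite size_map -cardE.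
by move=> /mapP[i iA ->]; exists i => //; rewrite mem_enum in iA.
Qed.

Lemma enum_set_inj A : injective (enum_set A).
Proof.
rewrite /enum_set => a b; have [Ap|] := eqVneq #|A| p; last by move=> _ /= /addnI.
rewrite -Ap /=; case: ifPn => aA; case: ifPn => bA.
- move=> /eqP; rewrite nth_uniq ?size_map -?cardE//; last first.
    by rewrite map_inj_uniq ?enum_uniq//; exact: val_inj.
  by move/eqP.
- by have [i _ ->] := elementsP aA; have := ltn_ord i; lia.
- by have [i _ ->] := elementsP bA; have := ltn_ord i; lia.
- by move/addnI.
Qed.

Lemma enum_set_mem A a : #|A| = p -> (a < p)%N ->
  exists2 i : 'I_m, i \in A & enum_set A a = i.
Proof.
by move=> Ap ap; rewrite /enum_set Ap eqxx ap; apply: elementsP; rewrite Ap.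
Qed.

Lemma mem_enum_set A (i : 'I_m) : #|A| = p -> i \in A ->
  exists2 a, (a < p)%N & enum_set A a = i.
Proof.
move=> Ap iA; exists (index i (enum A)).
  by rewrite -Ap cardE index_mem mem_enum.
rewrite /enum_set Ap eqxx -Ap cardE index_mem mem_enum iA/= /elements.
by rewrite (nth_map i) ?index_mem ?mem_enum// nth_index ?mem_enum.
Qed.

Lemma sum_enum_set (V : nmodType) A (f : nat -> V) : #|A| = p ->
  \sum_(a < p) f (enum_set A a) = \sum_(i in A) f i.
Proof.
move=> Ap; rewrite -(big_mkord xpredT (fun a => f (enum_set A a))).
rewrite -[RHS]big_enum -(big_map val xpredT f).
rewrite [RHS](big_nth 0%N) size_map -cardE Ap.
rewrite big_nat [RHS]big_nat; apply: eq_bigr => a /andP[_ ap].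
by rewrite /enum_set Ap eqxx ap.
Qed.

End enum_set.

(** * Kernel values, projections and residuals of the array *)

Section array.
Context {R : realType} (mu : probability (prodspace R AHK_index) R) (nu : probability R R).
Hypothesis mu_iid : iid_law mu nu.
Variables (p q : nat) (h : 'M[R]_(p, q) -> R) (phi : R * R * R -> R).
Hypotheses (p_gt0 : (0 < p)%N) (q_gt0 : (0 < q)%N).
Hypothesis h_kernel : kernel_function h.
Hypothesis phi_meas : measurable_fun setT phi.

Definition array (x : prodspace R AHK_index) i j : R := phi (x (row_ix i), x (col_ix j), x (cell_ix (i, j))).

Lemma measurable_array i j : measurable_fun setT (fun x => array x i j).
Proof.
apply: measurableT_comp => //; apply: measurable_fun_pair.
  by apply: measurable_fun_pair; exact: measurable_coord.
exact: measurable_coord.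
Qed.

Lemma measurable_kernel_fun d (T : measurableType d) (F : T -> 'M[R]_(p, q)) :
  (forall a b, measurable_fun setT (fun w => F w a b)) ->
  measurable_fun setT (fun w => h (F w)).
Proof.
move=> mF _ B mB; rewrite setTI.
exact: (sigma_family_preimage (fun ab => mF ab.1 ab.2) (h_kernel.1 B mB)).
Qed.

Definition kernel_at (r c : nat -> nat) (x : prodspace R AHK_index) : R :=
  h (\matrix_(a < p, b < q) array x (r a) (c b)).

Notation H := (kernel_at id id).

Lemma measurable_kernel_at r c : measurable_fun setT (kernel_at r c).
Proof.
apply: measurable_kernel_fun => a b.
by apply: eq_measurable_fun (measurable_array (r a) (c b)) => x _; rewrite mxE.
Qed.

Lemma kernel_at_relabel r c x : kernel_at r c x = H (relabel (lift_index r c) x).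
Proof. by []. Qed.

(** Row symmetry of the kernel: conditioning on the row variable [a] reduces to conditioning on the
    row variable [0], and one function serves as projection for all rows. *)
Lemma kernel_swap_row a : (a < p)%N -> kernel_at (swap 0%N a) id = H.
Proof.
move=> ap; apply/funext => x; rewrite /kernel_at.
rewrite -[RHS](h_kernel.2 (tperm (Ordinal p_gt0) (Ordinal ap)) 1%g).
congr h; apply/matrixP => i j; rewrite !mxE perm1; congr array.
rewrite permE/= /swap -!val_eqE/=.
by case: (_ == 0%N) => //; case: (_ == _).
Qed.

Lemma kernel_swap_col b : (b < q)%N -> kernel_at id (swap 0%N b) = H.
Proof.
move=> bq; apply/funext => x; rewrite /kernel_at.
rewrite -[RHS](h_kernel.2 1%g (tperm (Ordinal q_gt0) (Ordinal bq))).
congr h; apply/matrixP => i j; rewrite !mxE perm1; congr array.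
rewrite permE/= /swap -!val_eqE/=.
by case: (_ == 0%N) => //; case: (_ == _).
Qed.

Hypothesis H_L2 : L2 mu H.

Let m0 : R := \int[mu]_x H x.

(** Only the coordinate [row_ix 0] of the first argument is read, so the constant family stands for
    any point with that coordinate equal to [t]. *)
Definition row_mean (t : R) : R := cmean mu (row_ix 0) H (fun=> t).
Definition col_mean (t : R) : R := cmean mu (col_ix 0) H (fun=> t).

Lemma cmean_row x : cmean mu (row_ix 0) H x = row_mean (x (row_ix 0)).
Proof.
apply: eq_Rintegral => y _; congr (H _); apply/funext => k; rewrite /mix/=.
by case: eqVneq => // ->.
Qed.

Lemma cmean_col x : cmean mu (col_ix 0) H x = col_mean (x (col_ix 0)).
Proof.
apply: eq_Rintegral => y _; congr (H _); apply/funext => k; rewrite /mix/=.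
by case: eqVneq => // ->.
Qed.

(** Cells get no projection: index sets sharing a cell also share its row and its column, and such
    pairs are bounded by counting rather than by orthogonality. *)
Definition proj_term (k : AHK_index) (t : R) : R :=
  match k with
  | inl (inl _) => row_mean t - m0
  | inl (inr _) => col_mean t - m0
  | inr _ => 0
  end.

Lemma L2_proj_term k : L2 mu (fun x => proj_term k (x k)).
Proof.
case: k => [[i|j]|ij] /=; last exact: L2_cst.
  apply: L2B; last exact: L2_cst.
  apply: (L2_coord mu_iid (k := row_ix 0)).
  by have := L2_cmean mu_iid (row_ix 0) H_L2; congr L2; apply/funext => x; rewrite cmean_row.
apply: L2B; last exact: L2_cst.
apply: (L2_coord mu_iid (k := col_ix 0)).
by have := L2_cmean mu_iid (col_ix 0) H_L2; congr L2; apply/funext => x; rewrite cmean_col.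
Qed.

Lemma proj_term_mean0 k : \int[mu]_x proj_term k (x k) = 0.
Proof.
have mean0 k0 (F : R -> R) : (forall x, cmean mu k0 H x = F (x k0)) ->
    \int[mu]_x (F (x k) - m0) = 0.
  move=> cF.
  have LF : L2 mu (fun x => F (x k0)).
    by have := L2_cmean mu_iid k0 H_L2; congr L2; apply/funext => x; rewrite cF.
  rewrite RintegralB//; last 2 first.
  - exact: (L2_int (L2_coord mu_iid k LF)).
  - exact: finite_measure_integrable_cst.
  rewrite Rintegral_prob_cst (Rintegral_coord mu_iid k (L2_int LF)).
  under eq_Rintegral do rewrite -cF.
  by rewrite (Rintegral_cmean mu_iid k0 (L2_int H_L2)) subrr.
case: k mean0 => [[i|j]|ij] mean0 /=; last by rewrite Rintegral_prob_cst.
- by apply: (mean0 (row_ix 0)) => x; rewrite cmean_row.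
- by apply: (mean0 (col_ix 0)) => x; rewrite cmean_col.
Qed.

Definition lead : seq AHK_index :=
  [seq row_ix a | a <- iota 0 p] ++ [seq col_ix b | b <- iota 0 q].

Lemma lead_uniq : uniq lead.
Proof.
rewrite cat_uniq !map_inj_uniq ?iota_uniq ?andbT/=; [|by move=> ? ? []..].
by apply/hasPn => _ /mapP[b _ ->]; apply/negP => /mapP[].
Qed.

Lemma cmean_lead k : k \in lead ->
  {ae mu, forall x, cmean mu k H x = m0 + proj_term k (x k)}.
Proof.
rewrite mem_cat => /orP[] /mapP[a]; rewrite mem_iota add0n => /andP[_ ap] -> /=.
- have /= := @ae_cmean_relabel _ _ _ _ mu_iid (lift_index (swap 0%N a) id) (row_ix 0) H row_mean
    (lift_index_inj (@swap_inj _ _ _) (@inj_id _)) (L2_int H_L2) (aeW _ cmean_row).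
  rewrite /swap/= -/(kernel_at (swap 0%N a) id) kernel_swap_row//.
  by apply: filterS => x ->; rewrite addrC subrK.
- have /= := @ae_cmean_relabel _ _ _ _ mu_iid (lift_index id (swap 0%N a)) (col_ix 0) H col_mean
    (lift_index_inj (@inj_id _) (@swap_inj _ _ _)) (L2_int H_L2) (aeW _ cmean_col).
  rewrite /swap/= -/(kernel_at id (swap 0%N a)) kernel_swap_col//.
  by apply: filterS => x ->; rewrite addrC subrK.
Qed.

Definition residual_at (r c : nat -> nat) (x : prodspace R AHK_index) : R :=
  residual mu H proj_term lead (relabel (lift_index r c) x).

Lemma residual_atE r c x : residual_at r c x = kernel_at r c x - m0 -
  \sum_(a < p) (row_mean (x (row_ix (r a))) - m0) -
  \sum_(b < q) (col_mean (x (col_ix (c b))) - m0).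
Proof.
rewrite /residual_at /residual -kernel_at_relabel -/m0 big_cat/= opprD addrA.
rewrite !big_map.
rewrite -(big_mkord xpredT (fun a => row_mean (x (row_ix (r a))) - m0)).
rewrite -(big_mkord xpredT (fun b => col_mean (x (col_ix (c b))) - m0)).
by rewrite /index_iota !subn0.
Qed.

Lemma L2_residual_at r c : injective r -> injective c -> L2 mu (residual_at r c).
Proof.
move=> ri ci; apply: (L2_relabel mu_iid (lift_index_inj ri ci)).
by apply: L2_residual => // k; exact: L2_proj_term.
Qed.

Lemma L2_kernel_at r c : injective r -> injective c -> L2 mu (kernel_at r c).
Proof. by move=> ri ci; exact: (L2_relabel mu_iid (lift_index_inj ri ci) H_L2). Qed.

Definition residual_var : R := \int[mu]_x (residual mu H proj_term lead x ^+ 2).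

Lemma residual_at_var r c : injective r -> injective c ->
  \int[mu]_x (residual_at r c x ^+ 2) = residual_var.
Proof.
move=> ri ci; apply: (Rintegral_relabel mu_iid (lift_index_inj ri ci)
  (f := fun x => residual mu H proj_term lead x ^+ 2)).
by have [] : L2 mu (residual mu H proj_term lead) by apply: L2_residual => // k; exact: L2_proj_term.
Qed.

Lemma cmean_residual_at r c k : injective r -> injective c -> k \in lead ->
  {ae mu, forall x, cmean mu (lift_index r c k) (residual_at r c) x = 0}.
Proof.
move=> ri ci kl.
have LR : L2 mu (residual mu H proj_term lead).
  by apply: L2_residual => // j; exact: L2_proj_term.
apply: (ae_cmean_relabel mu_iid (e := fun=> 0) (lift_index_inj ri ci) (L2_int LR)).
apply: (cmean_residual mu_iid H_L2 lead_uniq) => //.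
- exact: L2_proj_term.
- exact: proj_term_mean0.
- exact: cmean_lead.
Qed.

Definition index_support (r c : nat -> nat) : set AHK_index := fun k =>
  match k with
  | inl (inl i) => exists2 a, (a < p)%N & r a = i
  | inl (inr j) => exists2 b, (b < q)%N & c b = j
  | inr ij => (exists2 a, (a < p)%N & r a = ij.1) /\ (exists2 b, (b < q)%N & c b = ij.2)
  end.

Lemma depends_residual_at r c : depends (index_support r c) (residual_at r c).
Proof.
move=> x y xy; rewrite !residual_atE.
have rowE a : (a < p)%N -> x (row_ix (r a)) = y (row_ix (r a)) by move=> ap; apply: xy; exists a.
have colE b : (b < q)%N -> x (col_ix (c b)) = y (col_ix (c b)) by move=> bq; apply: xy; exists b.
congr (_ - _ - _ - _).
- congr h; apply/matrixP => a b; rewrite !mxE /array rowE// colE//.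
  by congr (phi (_, _)); apply: xy; split; [exists a|exists b].
- by apply: eq_bigr => a _; rewrite rowE.
- by apply: eq_bigr => b _; rewrite colE.
Qed.

(** * Covariances of the residuals over a finite sample *)

Section sample.
Variables (m n : nat).
Implicit Types (A : {set 'I_m}) (B : {set 'I_n}) (AB : {set 'I_m} * {set 'I_n}).

Definition set_residual (AB : {set 'I_m} * {set 'I_n}) : prodspace R AHK_index -> R :=
  residual_at (enum_set p AB.1) (enum_set q AB.2).

(** The supports have at most one variable in common, since a common cell would require a common row
    and a common column. Conditioning on that variable, or on the leading row variable if there is
    none, makes the second residual vanish. *)
Lemma residual_orthogonal A B A' B' : #|A| = p -> #|B| = q -> #|A'| = p -> #|B'| = q ->
  (#|A :&: A'| + #|B :&: B'| <= 1)%N ->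
  \int[mu]_x (set_residual (A, B) x * set_residual (A', B') x) = 0.
Proof.
move=> Ap Bq A'p B'q o1.
have common i : (exists2 a, (a < p)%N & enum_set p A a = i) ->
    (exists2 a, (a < p)%N & enum_set p A' a = i) ->
    exists2 z : 'I_m, z \in A :&: A' & i = z.
  move=> [a ap <-] [a' a'p]; have [z zA ->] := enum_set_mem Ap ap.
  have [z' zA' ->] := enum_set_mem A'p a'p => /val_inj zz'.
  by exists z => //; rewrite inE zA -zz'.
have common' j : (exists2 b, (b < q)%N & enum_set q B b = j) ->
    (exists2 b, (b < q)%N & enum_set q B' b = j) ->
    exists2 z : 'I_n, z \in B :&: B' & j = z.
  move=> [b bq <-] [b' b'q]; have [z zB ->] := enum_set_mem Bq bq.
  have [z' zB' ->] := enum_set_mem B'q b'q => /val_inj zz'.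
  by exists z => //; rewrite inE zB -zz'.
have card_gt0 (T : finType) (X : {set T}) z : z \in X -> (0 < #|X|)%N.
  by move=> zX; apply/card_gt0P; exists z.
have orth k : k \in lead ->
    index_support (enum_set p A) (enum_set q B) `&` index_support (enum_set p A') (enum_set q B')
      `<=` [set lift_index (enum_set p A') (enum_set q B') k] ->
    \int[mu]_x (set_residual (A, B) x * set_residual (A', B') x) = 0.
  move=> kl DD'.
  apply: (integral_mul_eq0 mu_iid (L2_residual_at _ _) (L2_residual_at _ _)
    (@depends_residual_at _ _) (@depends_residual_at _ _) DD'); try exact: enum_set_inj.
  by apply: cmean_residual_at => //; exact: enum_set_inj.
have row_lead a : (a < p)%N -> row_ix a \in lead.
  by move=> ap; rewrite mem_cat map_f// mem_iota.
have col_lead b : (b < q)%N -> col_ix b \in lead.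
  by move=> bq; rewrite mem_cat (map_f col_ix) ?orbT// mem_iota.
have [/eqP|[i0 i0A]] := set_0Vmem (A :&: A').
  rewrite -cards_eq0 => /eqP A0.
  have [/eqP|[j0 j0B]] := set_0Vmem (B :&: B').
    rewrite -cards_eq0 => /eqP B0.
    apply: (orth (row_ix 0)); first exact: row_lead.
    move=> [[i|j]|[i j]] [] /=.
    - by move=> iA /(common _ iA)[z /card_gt0]; rewrite A0.
    - by move=> jB /(common' _ jB)[z /card_gt0]; rewrite B0.
    - by move=> [iA _] [/(common _ iA)[z /card_gt0]]; rewrite A0.
  have j0B' : j0 \in B' by move: j0B; rewrite inE => /andP[].
  have [b0 b0q b0E] := mem_enum_set B'q j0B'.
  apply: (orth (col_ix b0)); first exact: col_lead.
  move=> [[i|j]|[i j]] [] /=.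
  - by move=> iA /(common _ iA)[z /card_gt0]; rewrite A0.
  - move=> jB /(common' _ jB)[z zB ->]; rewrite b0E.
    have /card_le1_eqP E : (#|B :&: B'| <= 1)%N by lia.
    by rewrite (E z j0).
  - by move=> [iA _] [/(common _ iA)[z /card_gt0]]; rewrite A0.
have i0A' : i0 \in A' by move: i0A; rewrite inE => /andP[].
have [a0 a0p a0E] := mem_enum_set A'p i0A'.
have A1 := card_gt0 _ _ _ i0A.
have B0 : #|B :&: B'| = 0%N by lia.
apply: (orth (row_ix a0)); first exact: row_lead.
move=> [[i|j]|[i j]] [] /=.
- move=> iA /(common _ iA)[z zA ->]; rewrite a0E.
  have /card_le1_eqP E : (#|A :&: A'| <= 1)%N by lia.
  by rewrite (E z i0).
- by move=> jB /(common' _ jB)[z /card_gt0]; rewrite B0.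
- by move=> [_ jB] [_ /(common' _ jB)[z /card_gt0]]; rewrite B0.
Qed.

Lemma L2_set_residual AB : L2 mu (set_residual AB).
Proof. by apply: L2_residual_at; exact: enum_set_inj. Qed.

Lemma set_residual_var AB : \int[mu]_x (set_residual AB x ^+ 2) = residual_var.
Proof.
rewrite /set_residual.
exact: (residual_at_var (@enum_set_inj m p AB.1) (@enum_set_inj n q AB.2)).
Qed.

Lemma set_residual_cov AB AB' :
  \int[mu]_x (set_residual AB x * set_residual AB' x) <= residual_var.
Proof.
exact: (Rintegral_mul_le (L2_set_residual AB) (L2_set_residual AB')
  (set_residual_var AB) (set_residual_var AB')).
Qed.

Lemma residual_var_ge0 : 0 <= residual_var.
Proof. by apply: Rintegral_ge0 => x _; exact: sqr_ge0. Qed.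

(** It is at least one as soon as two rows or columns are shared in total, and each of its three
    terms is a function of the rows times a function of the columns, which makes its sum
    computable. *)
Definition overlap_weight (AB AB' : {set 'I_m} * {set 'I_n}) : nat :=
  let o := #|AB.1 :&: AB'.1| in let o' := #|AB.2 :&: AB'.2| in
  (o * o.-1 + o' * o'.-1 + o * o')%N.

Lemma set_residual_cov_weight AB AB' :
  #|AB.1| = p -> #|AB.2| = q -> #|AB'.1| = p -> #|AB'.2| = q ->
  \int[mu]_x (set_residual AB x * set_residual AB' x) <=
  residual_var * (overlap_weight AB AB')%:R.
Proof.
case: AB AB' => A B [A' B'] /= Ap Bq A'p B'q.
have [few|many] := leqP (#|A :&: A'| + #|B :&: B'|) 1.
  by rewrite residual_orthogonal// mulr_ge0// residual_var_ge0.
apply: le_trans (set_residual_cov _ _) _.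
rewrite ler_peMr ?residual_var_ge0// ler1n /overlap_weight/=.
move: many; move: #|A :&: A'| #|B :&: B'| => [|[|u]] [|[|v]] //=; nia.
Qed.

Lemma sum_overlap_weight :
  (\sum_(AB : {set 'I_m} * {set 'I_n} | (#|AB.1| == p) && (#|AB.2| == q))
   \sum_(AB' : {set 'I_m} * {set 'I_n} | (#|AB'.1| == p) && (#|AB'.2| == q))
     overlap_weight AB AB' =
   overlap2 m p * 'C(n, q) ^ 2 + 'C(m, p) ^ 2 * overlap2 n q + overlap m p * overlap n q)%N.
Proof.
have pairE (G : {set 'I_m} -> {set 'I_n} -> nat) :
    (\sum_(AB : {set 'I_m} * {set 'I_n} | (#|AB.1| == p) && (#|AB.2| == q)) G AB.1 AB.2 =
     \sum_(A : {set 'I_m} | #|A| == p) \sum_(B : {set 'I_n} | #|B| == q) G A B)%N.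
  by rewrite pair_big.
have prodE (u : {set 'I_m} -> {set 'I_m} -> nat) (v : {set 'I_n} -> {set 'I_n} -> nat) :
   (\sum_(AB : {set 'I_m} * {set 'I_n} | (#|AB.1| == p) && (#|AB.2| == q))
    \sum_(AB' : {set 'I_m} * {set 'I_n} | (#|AB'.1| == p) && (#|AB'.2| == q))
      u AB.1 AB'.1 * v AB.2 AB'.2 =
    (\sum_(A : {set 'I_m} | #|A| == p) \sum_(A' : {set 'I_m} | #|A'| == p) u A A') *
    (\sum_(B : {set 'I_n} | #|B| == q) \sum_(B' : {set 'I_n} | #|B'| == q) v B B'))%N.
  under eq_bigr => AB _.
    rewrite (pairE (fun A' B' => u AB.1 A' * v AB.2 B')%N) -big_distrlr/=.
    over.
  rewrite (pairE (fun A B => (\sum_(A' : {set 'I_m} | #|A'| == p) u A A') *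
    (\sum_(B' : {set 'I_n} | #|B'| == q) v B B'))%N).
  by rewrite -big_distrlr.
have cst k r : (\sum_(A : {set 'I_k} | #|A| == r) \sum_(A' : {set 'I_k} | #|A'| == r) 1 =
    'C(k, r) ^ 2)%N.
  have E : (\sum_(A : {set 'I_k} | #|A| == r) 1 = 'C(k, r))%N.
    rewrite sum1_card -[k in RHS]card_ord -card_draws.
    by apply: eq_card => A; rewrite inE.
  by rewrite E sum_nat_const -sum1_card E.
under eq_bigr => AB _ do rewrite !big_split/=.
rewrite !big_split/=; congr (_ + _ + _)%N.
- rewrite -(cst n q) -(prodE (fun A A' => #|A :&: A'| * #|A :&: A'|.-1)%N (fun _ _ => 1%N)).
  by apply: eq_bigr => AB _; apply: eq_bigr => AB' _; rewrite muln1.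
- rewrite -(cst m p) -(prodE (fun _ _ => 1%N) (fun B B' => #|B :&: B'| * #|B :&: B'|.-1)%N).
  by apply: eq_bigr => AB _; apply: eq_bigr => AB' _; rewrite mul1n.
- exact: (prodE (fun A A' => #|A :&: A'|) (fun B B' => #|B :&: B'|)).
Qed.

Definition avg_residual x : R := ('C(m, p))%:R^-1 * ('C(n, q))%:R^-1 *
  \sum_(A : {set 'I_m} | #|A| == p) \sum_(B : {set 'I_n} | #|B| == q) set_residual (A, B) x.

Lemma avg_residual_var : (p <= m)%N -> (q <= n)%N ->
  \int[mu]_x (avg_residual x ^+ 2) <= residual_var *
  ((overlap2 m p)%:R / ('C(m, p))%:R ^+ 2 + (overlap2 n q)%:R / ('C(n, q))%:R ^+ 2 +
   (overlap m p)%:R / ('C(m, p))%:R ^+ 2 * ((overlap n q)%:R / ('C(n, q))%:R ^+ 2)).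
Proof.
move=> pm qn; pose w : R := ('C(m, p))%:R^-1 * ('C(n, q))%:R^-1.
pose Q (AB : {set 'I_m} * {set 'I_n}) := (#|AB.1| == p) && (#|AB.2| == q).
have avgE x : avg_residual x ^+ 2 = w ^+ 2 *
    \sum_(AB : {set 'I_m} * {set 'I_n} | Q AB) \sum_(AB' : {set 'I_m} * {set 'I_n} | Q AB') set_residual AB x * set_residual AB' x.
  rewrite /avg_residual exprMn -/w; congr (_ * _).
  rewrite (pair_big (fun A : {set 'I_m} => #|A| == p) (fun B : {set 'I_n} => #|B| == q)
    (fun A B => set_residual (A, B) x))/= expr2 big_distrlr/=.
  apply: eq_bigr => -[A B] _; apply: eq_bigr => -[A' B'] _ //.
under eq_Rintegral do rewrite avgE.
have ip AB AB' := L2_mul (L2_set_residual AB) (L2_set_residual AB').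
have isum AB : mu.-integrable setT (EFin \o (fun x =>
    \sum_(AB' : {set 'I_m} * {set 'I_n} | Q AB') set_residual AB x * set_residual AB' x)).
  by apply: integrable_Rsum => AB'; exact: ip.
rewrite RintegralZl//; last by apply: integrable_Rsum.
rewrite Rintegral_sum//.
under eq_bigr do rewrite Rintegral_sum//.
have Cm : ('C(m, p))%:R != 0 :> R by rewrite pnatr_eq0 -lt0n bin_gt0.
have Cn : ('C(n, q))%:R != 0 :> R by rewrite pnatr_eq0 -lt0n bin_gt0.
have sum_le : \sum_(AB : {set 'I_m} * {set 'I_n} | Q AB) \sum_(AB' : {set 'I_m} * {set 'I_n} | Q AB')
      \int[mu]_x (set_residual AB x * set_residual AB' x) <=
    residual_var * (overlap2 m p * 'C(n, q) ^ 2 + 'C(m, p) ^ 2 * overlap2 n q +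
      overlap m p * overlap n q)%:R.
  rewrite -sum_overlap_weight natr_sum mulr_sumr.
  apply: ler_sum => AB /andP[/eqP Ap /eqP Bq].
  rewrite natr_sum mulr_sumr.
  by apply: ler_sum => AB' /andP[/eqP A'p /eqP B'q]; exact: set_residual_cov_weight.
apply: le_trans (ler_wpM2l (sqr_ge0 w) sum_le) _.
rewrite le_eqVlt; apply/orP; left; apply/eqP.
rewrite 2!natrD (natrM _ (overlap2 m p)) (natrM _ ('C(m, p) ^ 2)%N).
rewrite (natrM _ (overlap m p)) 2!natrX /w; field.
by rewrite Cm Cn.
Qed.

Definition array_Ustat x : R := ('C(m, p))%:R^-1 * ('C(n, q))%:R^-1 *
  \sum_(A : {set 'I_m} | #|A| == p) \sum_(B : {set 'I_n} | #|B| == q)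
    kernel_at (enum_set p A) (enum_set q B) x.

Lemma L2_array_Ustat : L2 mu array_Ustat.
Proof.
apply: L2Z; apply: L2_sum => A; apply: L2_sum => B.
by apply: L2_kernel_at; exact: enum_set_inj.
Qed.

Lemma L2_avg_residual : L2 mu avg_residual.
Proof.
apply: L2Z; apply: L2_sum => A; apply: L2_sum => B.
exact: L2_set_residual.
Qed.

(** A sum over [i \in A] does not depend on [B], so the two averages separate, and each row index
    belongs to the fraction [p / m] of the sets. *)
Lemma array_Ustat_decomposition x : (p <= m)%N -> (q <= n)%N ->
  array_Ustat x - m0 =
  p%:R / m%:R * (\sum_(i < m) proj_term (row_ix i) (x (row_ix i))) +
  q%:R / n%:R * (\sum_(j < n) proj_term (col_ix j) (x (col_ix j))) + avg_residual x.
Proof.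
move=> pm qn.
rewrite /avg_residual.
have E A B : #|A| = p -> #|B| = q -> kernel_at (enum_set p A) (enum_set q B) x =
   set_residual (A, B) x + m0 + \sum_(i in A) proj_term (row_ix i) (x (row_ix i)) +
   \sum_(j in B) proj_term (col_ix j) (x (col_ix j)).
  move=> Ap Bq; rewrite /set_residual residual_atE /=.
  rewrite (sum_enum_set (fun i => row_mean (x (row_ix i)) - m0) Ap).
  by rewrite (sum_enum_set (fun j => col_mean (x (col_ix j)) - m0) Bq); ring.
have -> : array_Ustat x = ('C(m, p))%:R^-1 * ('C(n, q))%:R^-1 *
    \sum_(A : {set 'I_m} | #|A| == p) \sum_(B : {set 'I_n} | #|B| == q)
    (set_residual (A, B) x + m0 + \sum_(i in A) proj_term (row_ix i) (x (row_ix i)) +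
    \sum_(j in B) proj_term (col_ix j) (x (col_ix j))).
  rewrite /array_Ustat; congr (_ * _); apply: eq_bigr => A /eqP Ap.
  by apply: eq_bigr => B /eqP Bq; exact: E.
have splitE (r : {set 'I_m} -> {set 'I_n} -> R) c u v :
    \sum_(A : {set 'I_m} | #|A| == p) \sum_(B : {set 'I_n} | #|B| == q)
      (r A B + c + u A + v B) =
    \sum_(A : {set 'I_m} | #|A| == p) \sum_(B : {set 'I_n} | #|B| == q) r A B +
    \sum_(A : {set 'I_m} | #|A| == p) \sum_(B : {set 'I_n} | #|B| == q) c +
    \sum_(A : {set 'I_m} | #|A| == p) \sum_(B : {set 'I_n} | #|B| == q) u A +
    \sum_(A : {set 'I_m} | #|A| == p) \sum_(B : {set 'I_n} | #|B| == q) v B.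
  by under eq_bigr do rewrite !big_split/=; rewrite !big_split.
rewrite (splitE (fun A B => set_residual (A, B) x) m0
  (fun A => \sum_(i in A) proj_term (row_ix i) (x (row_ix i)))
  (fun B => \sum_(j in B) proj_term (col_ix j) (x (col_ix j)))) !mulrDr.
have mulE (u v S : R) : u * v * S = u * (v * S) by rewrite mulrA.
have cstE : ('C(m, p))%:R^-1 * ('C(n, q))%:R^-1 *
    \sum_(A : {set 'I_m} | #|A| == p) \sum_(B : {set 'I_n} | #|B| == q) m0 = m0.
  rewrite mulE mulr_sumr.
  by under eq_bigr do rewrite avg_draws_cst//; rewrite avg_draws_cst.
have rowE : ('C(m, p))%:R^-1 * ('C(n, q))%:R^-1 *
    \sum_(A : {set 'I_m} | #|A| == p) \sum_(B : {set 'I_n} | #|B| == q)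
      \sum_(i in A) proj_term (row_ix i) (x (row_ix i)) =
    p%:R / m%:R * (\sum_(i < m) proj_term (row_ix i) (x (row_ix i))).
  rewrite mulE mulr_sumr; under eq_bigr do rewrite avg_draws_cst//.
  by rewrite (avg_draws_sum (fun i : 'I_m => proj_term (row_ix i) (x (row_ix i)))) ?p_gt0.
have colE : ('C(m, p))%:R^-1 * ('C(n, q))%:R^-1 *
    \sum_(A : {set 'I_m} | #|A| == p) \sum_(B : {set 'I_n} | #|B| == q)
      \sum_(j in B) proj_term (col_ix j) (x (col_ix j)) =
    q%:R / n%:R * (\sum_(j < n) proj_term (col_ix j) (x (col_ix j))).
  rewrite mulE mulr_sumr.
  under eq_bigr do rewrite (avg_draws_sum (fun j : 'I_n => proj_term (col_ix j) (x (col_ix j)))) ?q_gt0//.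
  by rewrite avg_draws_cst.
rewrite cstE rowE colE.
set r := _ * \sum_(A : {set 'I_m} | _) _; ring.
Qed.

End sample.

End array.

(** * Asymptotics of the counting ratios *)

Section growth.
Context {R : realType} (m : nat -> nat) (rho : R).
Hypothesis rho_gt0 : 0 < rho.
Hypothesis m_rho : (m N)%:R / N%:R @[N --> \oo] --> rho.

Lemma near_ratio_ge : \forall N \near \oo, rho / 2 * N%:R <= (m N)%:R.
Proof.
have r2 : 0 < rho / 2 by rewrite divr_gt0.
near=> N.
have N0 : (0 < N)%N by near: N; exact: nbhs_infty_gt.
have NR : 0 < N%:R :> R by rewrite ltr0n.
rewrite -ler_pdivlMr//.
have : `|rho - (m N)%:R / N%:R| <= rho / 2.
  by near: N; move/cvgrPdist_le : m_rho => /(_ _ r2).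
by rewrite ler_norml => /andP[_]; lra.
Unshelve. all: end_near. Qed.

Lemma near_ge (k : nat) : \forall N \near \oo, (k <= m N)%N.
Proof.
have r2 : 0 < rho / 2 by rewrite divr_gt0.
near=> N.
rewrite -(ler_nat R).
have h : rho / 2 * N%:R <= (m N)%:R by near: N; exact: near_ratio_ge.
apply: le_trans h; rewrite mulrC -ler_pdivrMr//.
by near: N; exact: nbhs_infty_ger.
Unshelve. all: end_near. Qed.

(** The weight [sqrt N * p / m] with [N] replaced by [m / rho]. Its square times [m] is exactly
    [p^2 / rho] whenever [m] is positive, so the comparison sum has the limiting variance and not
    merely a variance tending to it. *)
Definition clt_coef (p : nat) N : R := p%:R / Num.sqrt (rho * (m N)%:R).

Lemma clt_coef_ge0 p N : 0 <= clt_coef p N.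
Proof. by rewrite /clt_coef divr_ge0// sqrtr_ge0. Qed.

Lemma clt_coef_sqr p N : (0 < m N)%N -> (m N)%:R * clt_coef p N ^+ 2 = p%:R ^+ 2 / rho.
Proof.
move=> m0; have mR : 0 < (m N)%:R :> R by rewrite ltr0n.
rewrite /clt_coef expr_div_n sqr_sqrtr ?mulr_ge0 ?(ltW rho_gt0)//.
by field; rewrite !gt_eqF.
Qed.

Lemma clt_coef_sqr_le p N : (m N)%:R * clt_coef p N ^+ 2 <= p%:R ^+ 2 / rho.
Proof.
have [m0|m0] := posnP (m N); last by rewrite clt_coef_sqr.
by rewrite m0 mul0r divr_ge0 ?sqr_ge0// ltW.
Qed.

Lemma clt_coef_cvg0 p : clt_coef p N @[N --> \oo] --> (0 : R).
Proof.
apply/cvgr0Pnorm_le => eps eps0; near=> N.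
rewrite ger0_norm ?clt_coef_ge0//.
have m0 : (0 < m N)%N by near: N; exact: near_ge.
have mR : 0 < (m N)%:R :> R by rewrite ltr0n.
rewrite -ler_sqr ?nnegrE ?clt_coef_ge0 ?(ltW eps0)//.
rewrite -(ler_pM2l mR) clt_coef_sqr// -ler_pdivrMr ?exprn_gt0//.
set b := _ / _ / _.
have b0 : 0 <= b by rewrite !divr_ge0 ?sqr_ge0// ltW.
apply: le_trans (_ : (Num.trunc b).+1%:R <= _).
  by apply: ltW; exact: truncnS_gt.
by rewrite ler_nat; near: N; exact: near_ge.
Unshelve. all: end_near. Qed.

(** For [m] positive the expression equals [p^2 * (sqrt (N / m) - sqrt (1 / rho))^2]. *)
Lemma clt_coef_diff_cvg0 p :
  (m N)%:R * (Num.sqrt N%:R * (p%:R / (m N)%:R) - clt_coef p N) ^+ 2 @[N --> \oo] --> (0 : R).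
Proof.
have cu : Num.sqrt ((m N)%:R / N%:R)^-1 @[N --> \oo] --> Num.sqrt rho^-1.
  have ci : ((m N)%:R / N%:R)^-1 @[N --> \oo] --> rho^-1.
    by apply: cvgV => //; rewrite gt_eqF.
  exact: (cvg_comp _ _ ci (sqrt_continuous (x := rho^-1))).
have cv : p%:R ^+ 2 * (Num.sqrt ((m N)%:R / N%:R)^-1 - Num.sqrt rho^-1) ^+ 2
    @[N --> \oo] --> (0 : R).
  have c1 : Num.sqrt ((m N)%:R / N%:R)^-1 - Num.sqrt rho^-1 @[N --> \oo] --> (0 : R).
    by rewrite -(subrr (Num.sqrt rho^-1)); apply: cvgB => //; exact: cvg_cst.
  have c2 : (Num.sqrt ((m N)%:R / N%:R)^-1 - Num.sqrt rho^-1) ^+ 2 @[N --> \oo] --> (0 : R).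
    by have := cvgM c1 c1; rewrite mulr0; apply.
  by have := cvgMl_tmp (a := p%:R ^+ 2) c2; rewrite mulr0; apply.
apply: cvg_trans cv; apply: near_eq_cvg; near=> N.
have m0 : (0 < m N)%N by near: N; exact: near_ge.
have N0 : (0 < N)%N by near: N; exact: nbhs_infty_gt.
have mR : 0 < (m N)%:R :> R by rewrite ltr0n.
have NR : 0 < N%:R :> R by rewrite ltr0n.
rewrite /clt_coef invfM invrK mulrC sqrtrM ?ler0n// !sqrtrV ?(ltW rho_gt0) ?(ltW mR)//.
rewrite sqrtrM ?(ltW rho_gt0)//.
have sm : Num.sqrt (m N)%:R != 0 :> R by rewrite gt_eqF// sqrtr_gt0.
have sr : Num.sqrt rho != 0 :> R by rewrite gt_eqF// sqrtr_gt0.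
have := sqr_sqrtr (ltW mR); move: sm; move: (Num.sqrt _) => s s0 <-.
by field; rewrite s0 sr.
Unshelve. all: end_near. Qed.

(** The [m] coordinates of one kind have equal errors. The Gaussian part is cubic in the weight: [m]
    absorbs two factors, and the third tends to zero. *)
Lemma clt_err_cvg0 d (T : measurableType d) (P : probability T R) (f : T -> R) p v :
  0 <= v -> L2 P f ->
  (m N)%:R * (\int[P]_x mincube (clt_coef p N * f x) +
    129 * Num.sqrt (clt_coef p N ^+ 2 * v) ^+ 3) @[N --> \oo] --> (0 : R).
Proof.
move=> v0 Lf.
have c1 : (m N)%:R * \int[P]_x mincube (clt_coef p N * f x) @[N --> \oo] --> (0 : R).
  by apply: (integral_mincube_cvg0 Lf (clt_coef_ge0 p)
    (fun N => ler0n R (m N)) (clt_coef_sqr_le p) (clt_coef_cvg0 p)).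
pose B := p%:R ^+ 2 / rho * (129 * Num.sqrt v ^+ 3).
have c2 : (m N)%:R * (129 * Num.sqrt (clt_coef p N ^+ 2 * v) ^+ 3) @[N --> \oo] --> (0 : R).
  apply: (@squeeze_cvgr _ _ _ _ (cst 0) (fun N => B * clt_coef p N)); last 2 first.
  - exact: cvg_cst.
  - by have := cvgMl_tmp (a := B) (clt_coef_cvg0 p); rewrite mulr0; apply.
  apply: nearW => N; have a0 := clt_coef_ge0 p N; have s0 := sqrtr_ge0 v.
  apply/andP; split; first by rewrite !mulr_ge0// exprn_ge0// sqrtr_ge0.
  rewrite sqrtrM ?sqr_ge0// sqrtr_sqr ger0_norm//.
  have -> : (m N)%:R * (129 * (clt_coef p N * Num.sqrt v) ^+ 3) =
    ((m N)%:R * clt_coef p N ^+ 2) * (129 * Num.sqrt v ^+ 3) * clt_coef p N by ring.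
  rewrite /B ler_wpM2r// ler_wpM2r ?mulr_ge0 ?exprn_ge0//.
  exact: clt_coef_sqr_le.
under eq_fun do rewrite mulrDr.
by have := cvgD c1 c2; rewrite addr0; apply.
Qed.

(* The three terms bound the contributions of the pairs of index sets sharing two
   rows, two columns, or one row and one column. *)
Lemma near_overlap_ratio p : (0 < p)%N -> exists2 C, 0 <= C &
  \forall N \near \oo,
    (overlap (m N) p)%:R / ('C(m N, p))%:R ^+ 2 <= C / N%:R :> R /\
    (overlap2 (m N) p)%:R / ('C(m N, p))%:R ^+ 2 <= C / N%:R ^+ 2 :> R.
Proof.
(* From [m >= rho N / 2] one gets [1 / m <= c / N]; the extra [2] in [C] comes from
   [m - 1 >= m / 2]. *)
move=> p0; pose c := 2 / rho.
have c0 : 0 < c by rewrite divr_gt0.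
pose C := p%:R ^+ 2 * c + (p%:R * p.-1%:R) ^+ 2 * (2 * c ^+ 2).
have C1 : 0 <= p%:R ^+ 2 * c by rewrite mulr_ge0 ?sqr_ge0// ltW.
have C2 : 0 <= (p%:R * p.-1%:R) ^+ 2 * (2 * c ^+ 2).
  by apply: mulr_ge0; rewrite ?sqr_ge0// mulr_ge0// sqr_ge0.
exists C; first exact: addr_ge0.
near=> N.
have mp : (p <= m N)%N by near: N; exact: near_ge.
have m2 : (2 <= m N)%N by near: N; exact: near_ge.
have N0 : (0 < N)%N by near: N; exact: nbhs_infty_gt.
have NR : 0 < N%:R :> R by rewrite ltr0n.
have mR : 0 < (m N)%:R :> R by rewrite ltr0n (leq_trans _ m2).
have mN : rho / 2 * N%:R <= (m N)%:R by near: N; exact: near_ratio_ge.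
have minv : (m N)%:R^-1 <= c / N%:R.
  rewrite -[c / _]invrK lef_pV2 ?posrE ?invr_gt0 ?divr_gt0//.
  by rewrite invfM invrK /c invfM invrK mulrC mulrC [2^-1 * _]mulrC.
have m1R : (m N)%:R / 2 <= (m N).-1%:R :> R.
  rewrite -subn1 natrB ?(ltnW m2)//; have : 2%:R <= (m N)%:R :> R by rewrite ler_nat.
  by move: (m N)%:R => z; lra.
have m1inv : (m N).-1%:R^-1 <= 2 * (c / N%:R).
  apply: (@le_trans _ _ (2 * (m N)%:R^-1)); last by rewrite ler_wpM2l.
  rewrite -[2 * _]invrK lef_pV2 ?posrE ?invr_gt0 ?mulr_gt0 ?invr_gt0//.
    by rewrite invfM invrK mulrC.
  by apply: lt_le_trans m1R; rewrite divr_gt0.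
have mi0 : 0 <= (m N)%:R^-1 :> R by rewrite invr_ge0 ltW.
have m1i0 : 0 <= (m N).-1%:R^-1 :> R by rewrite invr_ge0 ler0n.
split.
  rewrite overlap_ratio ?p0//; apply: (@le_trans _ _ (p%:R ^+ 2 * (c / N%:R))).
    by rewrite ler_wpM2l// sqr_ge0.
  by rewrite mulrA ler_wpM2r ?invr_ge0 ?(ltW NR)// /C lerDl.
rewrite overlap2_ratio ?p0//; apply: (@le_trans _ _
    ((p%:R * p.-1%:R) ^+ 2 * ((c / N%:R) * (2 * (c / N%:R))))).
  by rewrite ler_wpM2l ?sqr_ge0// invfM ler_pM.
have -> : (p%:R * p.-1%:R) ^+ 2 * ((c / N%:R) * (2 * (c / N%:R))) =
    (p%:R * p.-1%:R) ^+ 2 * (2 * c ^+ 2) / N%:R ^+ 2 by field; rewrite gt_eqF.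
by rewrite ler_wpM2r ?invr_ge0 ?sqr_ge0// /C lerDr.
Unshelve. all: end_near. Qed.

End growth.

(** * The central limit theorem on the product space *)

Lemma sum_ord_cst (V : pzSemiRingType) k (F : nat -> V) (a : V) :
  (forall i, F i = a) -> \sum_(i < k) F i = k%:R * a.
Proof.
move=> Fa; rewrite (eq_bigr (fun=> a)); last by move=> i _; exact: Fa.
by rewrite sumr_const card_ord mulr_natl.
Qed.

Section array_clt.
Context {R : realType} (mu : probability (prodspace R AHK_index) R) (nu : probability R R).
Hypothesis mu_iid : iid_law mu nu.
Variables (p q : nat) (h : 'M[R]_(p, q) -> R) (phi : R * R * R -> R).
Hypotheses (p_gt0 : (0 < p)%N) (q_gt0 : (0 < q)%N).
Hypothesis h_kernel : kernel_function h.
Hypothesis H_L2 : L2 mu (kernel_at h phi id id).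
Variables (m n : nat -> nat) (rho : R).
Hypothesis rho01 : 0 < rho < 1.
Hypothesis m_rho : (m N)%:R / N%:R @[N --> \oo] --> rho.
Hypothesis n_rho : (n N)%:R / N%:R @[N --> \oo] --> 1 - rho.

Notation e := (proj_term mu h phi).
Let m0 : R := \int[mu]_x kernel_at h phi id id x.
Let rho0 : 0 < rho. Proof. by case/andP: rho01. Qed.
Let rho1 : 0 < 1 - rho. Proof. by case/andP: rho01 => _; rewrite subr_gt0. Qed.
Let e_L2 := L2_proj_term mu_iid H_L2.
Let e_mean0 := proj_term_mean0 mu_iid H_L2.

Definition row_var : R := coord_var mu e (row_ix 0).
Definition col_var : R := coord_var mu e (col_ix 0).

Definition sample N : seq AHK_index :=
  [seq row_ix i | i <- iota 0 (m N)] ++ [seq col_ix j | j <- iota 0 (n N)].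

Lemma sample_uniq N : uniq (sample N).
Proof.
rewrite cat_uniq !map_inj_uniq ?iota_uniq ?andbT/=; [|by move=> ? ? []..].
by apply/hasPn => _ /mapP[b _ ->]; apply/negP => /mapP[].
Qed.

Lemma big_sample N (F : AHK_index -> R) : \sum_(k <- sample N) F k =
  \sum_(i < m N) F (row_ix i) + \sum_(j < n N) F (col_ix j).
Proof.
rewrite big_cat/= !big_map -(big_mkord xpredT (fun i => F (row_ix i))).
by rewrite -(big_mkord xpredT (fun j => F (col_ix j))) /index_iota !subn0.
Qed.

Definition weight N (k : AHK_index) : R :=
  match k with
  | inl (inl _) => clt_coef m rho p N
  | inl (inr _) => clt_coef n (1 - rho) q N
  | inr _ => 0
  end.

Definition Ustat_weight N (k : AHK_index) : R :=
  match k with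
  | inl (inl _) => Num.sqrt N%:R * (p%:R / (m N)%:R)
  | inl (inr _) => Num.sqrt N%:R * (q%:R / (n N)%:R)
  | inr _ => 0
  end.

Lemma coord_var_scale (w : AHK_index -> R) k :
  coord_var mu (fun k t => w k * e k t) k = w k ^+ 2 * coord_var mu e k.
Proof.
have [_ e2] := e_L2 k.
by rewrite /coord_var -RintegralZl//; apply: eq_Rintegral => x _; rewrite exprMn.
Qed.

Lemma coord_var_row i : coord_var mu e (row_ix i) = row_var.
Proof.
have [_ e2] := e_L2 (row_ix 0).
exact: (Rintegral_coord mu_iid (f := fun t => e (row_ix 0) t ^+ 2) (row_ix i) e2).
Qed.

Lemma coord_var_col j : coord_var mu e (col_ix j) = col_var.
Proof.
have [_ e2] := e_L2 (col_ix 0).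
exact: (Rintegral_coord mu_iid (f := fun t => e (col_ix 0) t ^+ 2) (col_ix j) e2).
Qed.

Lemma sum_coord_var N (w : AHK_index -> R) a b :
  (forall i, w (row_ix i) = a) -> (forall j, w (col_ix j) = b) ->
  \sum_(k <- sample N) coord_var mu (fun k t => w k * e k t) k =
  (m N)%:R * a ^+ 2 * row_var + (n N)%:R * b ^+ 2 * col_var.
Proof.
move=> wa wb; rewrite big_sample.
rewrite (@sum_ord_cst _ _ (fun i => coord_var mu _ (row_ix i)) (a ^+ 2 * row_var)).
  rewrite (@sum_ord_cst _ _ (fun j => coord_var mu _ (col_ix j)) (b ^+ 2 * col_var)).
    by rewrite !mulrA.
  by move=> j; rewrite coord_var_scale coord_var_col wb.
by move=> i; rewrite coord_var_scale coord_var_row wa.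
Qed.

Definition limit_var : R :=
  p%:R ^+ 2 / rho * row_var + q%:R ^+ 2 / (1 - rho) * col_var.

Lemma near_sum_weight_var : \forall N \near \oo,
  \sum_(k <- sample N) coord_var mu (fun k t => weight N k * e k t) k = limit_var.
Proof.
near=> N.
rewrite (sum_coord_var N (a := clt_coef m rho p N) (b := clt_coef n (1 - rho) q N))//.
by rewrite !clt_coef_sqr//; near: N; [exact: near_ge n_rho _|exact: near_ge m_rho _].
Unshelve. all: end_near. Qed.

Lemma sum_err_cvg0 :
  \sum_(k <- sample N) lindeberg_err mu (fun k t => weight N k * e k t) k
  @[N --> \oo] --> (0 : R).
Proof.
have err k a N : weight N k = a ->
    lindeberg_err mu (fun k t => weight N k * e k t) k =
    \int[mu]_x mincube (a * e k (x k)) + 129 * Num.sqrt (a ^+ 2 * coord_var mu e k) ^+ 3.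
  by move=> <-; rewrite /lindeberg_err coord_var_scale.
have imc a k : mu.-integrable setT (EFin \o (fun x : prodspace R AHK_index => mincube (a * e k (x k)))).
  have [me e2] := L2Z a (e_L2 k).
  apply: (le_integrable _ _ _ e2) => //.
    by apply/measurable_EFinP; apply: measurableT_comp => //; exact: measurable_mincube.
  by move=> x _ /=; rewrite lee_fin !ger0_norm ?mincube_ge0 ?sqr_ge0// mincube_le2.
have rowE N i : lindeberg_err mu (fun k t => weight N k * e k t) (row_ix i) =
    \int[mu]_x mincube (clt_coef m rho p N * e (row_ix 0) (x (row_ix 0))) +
    129 * Num.sqrt (clt_coef m rho p N ^+ 2 * row_var) ^+ 3.
  have E a : \int[mu]_x mincube (a * e (row_ix i) (x (row_ix i))) =
      \int[mu]_x mincube (a * e (row_ix 0) (x (row_ix 0))).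
    exact: (Rintegral_coord mu_iid (f := fun t => mincube (a * e (row_ix 0) t))
      (row_ix i) (imc a (row_ix 0))).
  by rewrite (err (row_ix i) (clt_coef m rho p N) N erefl) E coord_var_row.
have colE N j : lindeberg_err mu (fun k t => weight N k * e k t) (col_ix j) =
    \int[mu]_x mincube (clt_coef n (1 - rho) q N * e (col_ix 0) (x (col_ix 0))) +
    129 * Num.sqrt (clt_coef n (1 - rho) q N ^+ 2 * col_var) ^+ 3.
  have E a : \int[mu]_x mincube (a * e (col_ix j) (x (col_ix j))) =
      \int[mu]_x mincube (a * e (col_ix 0) (x (col_ix 0))).
    exact: (Rintegral_coord mu_iid (f := fun t => mincube (a * e (col_ix 0) t))
      (col_ix j) (imc a (col_ix 0))).
  by rewrite (err (col_ix j) (clt_coef n (1 - rho) q N) N erefl) E coord_var_col.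
under eq_fun => N do
  rewrite big_sample (sum_ord_cst (m N) (rowE N)) (sum_ord_cst (n N) (colE N)).
have v1 : 0 <= row_var by exact: coord_var_ge0.
have v2 : 0 <= col_var by exact: coord_var_ge0.
have c1 := clt_err_cvg0 rho0 m_rho p v1 (e_L2 (row_ix 0)).
have c2 := clt_err_cvg0 rho1 n_rho q v2 (e_L2 (col_ix 0)).
by have := cvgD c1 c2; rewrite addr0; apply.
Qed.

(** Defined as a difference, so that the splitting of the statistic holds for every [N]; the
    explicit form [remainderE] requires samples of size at least [p] and [q]. *)
Definition remainder N (x : prodspace R AHK_index) : R :=
  Num.sqrt N%:R * (array_Ustat h phi (m N) (n N) x - m0) -
  \sum_(k <- sample N) weight N k * e k (x k).

Lemma L2_weighted (w : AHK_index -> R) k : L2 mu (fun x => w k * e k (x k)).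
Proof. by apply: L2Z; exact: e_L2. Qed.

Lemma L2_remainder N : L2 mu (remainder N).
Proof.
apply: L2B; last by apply: L2_sum => k; exact: L2_weighted.
apply: L2Z; apply: L2B; last exact: L2_cst.
exact: (L2_array_Ustat mu_iid H_L2).
Qed.

Lemma remainderE N x : (p <= m N)%N -> (q <= n N)%N ->
  remainder N x = Num.sqrt N%:R * avg_residual mu h phi (m N) (n N) x +
   \sum_(k <- sample N) (Ustat_weight N k - weight N k) * e k (x k).
Proof.
move=> pm qn; rewrite /remainder (array_Ustat_decomposition mu)//.
have -> : \sum_(k <- sample N) (Ustat_weight N k - weight N k) * e k (x k) =
    \sum_(k <- sample N) Ustat_weight N k * e k (x k) -
    \sum_(k <- sample N) weight N k * e k (x k).
  by rewrite -sumrB; apply: eq_bigr => k _; rewrite mulrBl.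
rewrite [in RHS]big_sample/= -!mulr_sumr.
by ring.
Qed.

Lemma remainder_cvg0 : \int[mu]_x (remainder N x ^+ 2) @[N --> \oo] --> (0 : R).
Proof.
have [C1 C10 nearm] := near_overlap_ratio rho0 m_rho p_gt0.
have [C2 C20 nearn] := near_overlap_ratio rho1 n_rho q_gt0.
pose K := residual_var mu h phi.
have K0 : 0 <= K by exact: residual_var_ge0.
pose D1 N := (m N)%:R * (Num.sqrt N%:R * (p%:R / (m N)%:R) - clt_coef m rho p N) ^+ 2.
pose D2 N := (n N)%:R * (Num.sqrt N%:R * (q%:R / (n N)%:R) - clt_coef n (1 - rho) q N) ^+ 2.
have d1 : D1 N @[N --> \oo] --> (0 : R) by exact: clt_coef_diff_cvg0.
have d2 : D2 N @[N --> \oo] --> (0 : R) by exact: clt_coef_diff_cvg0.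
(* The averaged residual has variance at most [M / N^2], and [M / N] after multiplication by
   [sqrt N]. *)
pose M := K * (C1 + C2 + C1 * C2).
(* The bound is [(a + b)^2 <= 2 a^2 + 2 b^2], with [a] the rescaled averaged residual and [b] the
   discrepancy of the weights, whose variance is a sum over independent coordinates. *)
apply: (@squeeze_cvgr _ _ _ _ (cst 0)
  (fun N => 2 * (M * N%:R^-1) + 2 * (D1 N * row_var + D2 N * col_var))); last 2 first.
- exact: cvg_cst.
- have cN : N%:R^-1 @[N --> \oo] --> (0 : R).
    by apply/gtr0_cvgV0; [near=> N; rewrite ltr0n; near: N; exact: nbhs_infty_gt|exact: cvgr_idn].
  have e1 : 2 * (M * N%:R^-1) @[N --> \oo] --> (0 : R).
    have h1 : M * N%:R^-1 @[N --> \oo] --> (0 : R).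
      by have := cvgMl_tmp (a := M) cN; rewrite mulr0; apply.
    by have := cvgMl_tmp (a := 2) h1; rewrite mulr0; apply.
  have e2 : 2 * (D1 N * row_var + D2 N * col_var) @[N --> \oo] --> (0 : R).
    have h1 : D1 N * row_var @[N --> \oo] --> (0 : R).
      by have := cvgMr_tmp (b := row_var) d1; rewrite mul0r; apply.
    have h2 : D2 N * col_var @[N --> \oo] --> (0 : R).
      by have := cvgMr_tmp (b := col_var) d2; rewrite mul0r; apply.
    have h3 : D1 N * row_var + D2 N * col_var @[N --> \oo] --> (0 : R).
      by have := cvgD h1 h2; rewrite addr0; apply.
    by have := cvgMl_tmp (a := 2) h3; rewrite mulr0; apply.
  by have := cvgD e1 e2; rewrite addr0; apply.
near=> N.
apply/andP; split; first by apply: Rintegral_ge0 => x _; exact: sqr_ge0.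
have pm : (p <= m N)%N by near: N; exact: near_ge m_rho _.
have qn : (q <= n N)%N by near: N; exact: near_ge n_rho _.
have [a1 a2] : (overlap (m N) p)%:R / ('C(m N, p))%:R ^+ 2 <= C1 / N%:R :> R /\
    (overlap2 (m N) p)%:R / ('C(m N, p))%:R ^+ 2 <= C1 / N%:R ^+ 2 :> R by near: N.
have [b1 b2] : (overlap (n N) q)%:R / ('C(n N, q))%:R ^+ 2 <= C2 / N%:R :> R /\
    (overlap2 (n N) q)%:R / ('C(n N, q))%:R ^+ 2 <= C2 / N%:R ^+ 2 :> R by near: N.
have N0 : (0 < N)%N by near: N; exact: nbhs_infty_gt.
have NR : 0 < N%:R :> R by rewrite ltr0n.
pose A x := Num.sqrt N%:R * avg_residual mu h phi (m N) (n N) x.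
pose w k := Ustat_weight N k - weight N k.
pose S x := \sum_(k <- sample N) w k * e k (x k).
have LA : L2 mu A by apply: L2Z; exact: (L2_avg_residual mu_iid H_L2).
have LS : L2 mu S by apply: L2_sum => k; exact: L2_weighted.
have [mA A2] := LA; have [mS S2] := LS.
have [_ av2] := L2_avg_residual mu_iid H_L2 (m N) (n N).
have Avar : \int[mu]_x (A x ^+ 2) <= M * N%:R^-1.
  have -> : \int[mu]_x (A x ^+ 2) =
      N%:R * \int[mu]_x (avg_residual mu h phi (m N) (n N) x ^+ 2).
    rewrite -RintegralZl//; apply: eq_Rintegral => x _.
    by rewrite /A exprMn sqr_sqrtr ?ler0n.
  apply: (@le_trans _ _ (N%:R * (K * (C1 / N%:R ^+ 2 + C2 / N%:R ^+ 2 +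
      C1 / N%:R * (C2 / N%:R))))).
    rewrite ler_wpM2l ?ler0n//; apply: le_trans (avg_residual_var mu_iid p_gt0 q_gt0 h_kernel H_L2 pm qn) _.
    rewrite ler_wpM2l// lerD// ?lerD// ler_pM// divr_ge0 ?ler0n// exprn_ge0 ?ler0n//.
  by rewrite le_eqVlt; apply/orP; left; apply/eqP; rewrite /M; field; rewrite gt_eqF.
have Svar : \int[mu]_x (S x ^+ 2) = D1 N * row_var + D2 N * col_var.
  rewrite (Rintegral_sqr_sum mu_iid (e := fun k t => w k * e k t) (sample_uniq N)).
  - exact: sum_coord_var.
  - by move=> k; exact: L2_weighted.
  - by move=> k; rewrite RintegralZl// ?e_mean0 ?mulr0//; exact: (L2_int (e_L2 k)).
rewrite -Svar; apply: le_trans (lerD (ler_wpM2l _ Avar) (lexx _)) => //.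
have i1 := integrableZl measurableT 2 A2.
have i2 := integrableZl measurableT 2 S2.
rewrite -RintegralZl// -[X in _ + X]RintegralZl// -RintegralD//.
apply: le_Rintegral => //.
- by have [] := L2_remainder N.
- exact: (integrableD measurableT i1 i2).
move=> x _; rewrite remainderE// -/(A x) -/(S x); move: (A x) (S x) => a b.
by have := sqr_ge0 (a - b); rewrite sqrrB sqrrD; lra.
Unshelve. all: end_near. Qed.

Theorem array_clt x : 0 < limit_var ->
  {for x, continuous (fun y : R => normal_prob 0 (Num.sqrt limit_var) `]-oo, y]%classic)} ->
  mu [set w | Num.sqrt N%:R * (array_Ustat h phi (m N) (n N) w - m0) <= x] @[N --> \oo]
  --> normal_prob 0 (Num.sqrt limit_var) `]-oo, x]%classic.
Proof.
move=> V0 cPhi.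
have wmean N k : \int[mu]_x (weight N k * e k (x k)) = 0.
  by rewrite RintegralZl// ?e_mean0 ?mulr0//; exact: (L2_int (e_L2 k)).
have setE N : [set w | Num.sqrt N%:R * (array_Ustat h phi (m N) (n N) w - m0) <= x] =
    [set w | \sum_(k <- sample N) weight N k * e k (w k) + remainder N w <= x].
  have E w : \sum_(k <- sample N) weight N k * e k (w k) + remainder N w =
      Num.sqrt N%:R * (array_Ustat h phi (m N) (n N) w - m0).
    by rewrite /remainder [LHS]addrC subrK.
  by apply/seteqP; split => w /=; rewrite E.
under eq_fun do rewrite setE.
exact: (clt_cdf mu_iid sample_uniq (fun N => L2_weighted (weight N)) wmean V0
  near_sum_weight_var sum_err_cvg0 L2_remainder remainder_cvg0 cPhi).
Qed.

End array_clt.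

(** * Transfer to the sample space *)

Section conditional_expectation.
Context d (T : measurableType d) (R : realType) (P : probability T R).
Variables (X : T -> R).
Hypothesis mX : measurable_fun setT X.

Lemma sigma_var_measurable A : sigma_var X A -> measurable A.
Proof. by move=> [B mB <-]; exact: mX. Qed.

Lemma measurable_sigma_var (Z : T -> R) :
  (forall B, measurable B -> sigma_var X (Z @^-1` B)) -> measurable_fun setT Z.
Proof. by move=> ZX _ B mB; rewrite setTI; apply: sigma_var_measurable; exact: ZX. Qed.

(** Both functions are measurable for the sigma-algebra generated by [X], taken as the measurable
    structure of the domain. *)
Lemma sigma_var_lt (Z Z' : T -> R) :
  (forall B, measurable B -> sigma_var X (Z @^-1` B)) ->
  (forall B, measurable B -> sigma_var X (Z' @^-1` B)) ->
  sigma_var X [set w | Z w < Z' w].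
Proof.
move=> ZX ZX'.
pose TX := g_sigma_algebra_preimageType X.
have mZ : measurable_fun (setT : set TX) (Z : TX -> R).
  by move=> _ B mB; rewrite setTI; exact: ZX.
have mZ' : measurable_fun (setT : set TX) (Z' : TX -> R).
  by move=> _ B mB; rewrite setTI; exact: ZX'.
have mtrue : measurable [set true] by [].
by have := measurable_fun_ltr mZ mZ' measurableT mtrue; rewrite setTI.
Qed.

(** The event [Z < Z'] belongs to the conditioning sigma-algebra, so [Z' - Z] has integral zero over
    it while being positive there; the event is therefore null. *)
Lemma cond_expectation_le (F Z Z' : T -> R) :
  is_cond_expectation P (sigma_var X) F Z -> is_cond_expectation P (sigma_var X) F Z' ->
  {ae P, forall w, Z' w <= Z w}.
Proof.
move=> [ZX iZ ZF] [ZX' iZ' ZF'].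
pose D := [set w | Z w < Z' w].
have XD : sigma_var X D by exact: sigma_var_lt.
have mD : measurable D by exact: sigma_var_measurable.
have mZ := measurable_sigma_var ZX; have mZ' := measurable_sigma_var ZX'.
have iZD : P.-integrable D (EFin \o Z) by exact: integrableS iZ.
have iZD' : P.-integrable D (EFin \o Z') by exact: integrableS iZ'.
have mZZ : measurable_fun D (fun w => ((Z' w)%:E - (Z w)%:E)%E).
  apply: measurable_funTS; apply: emeasurable_funB; exact/measurable_EFinP.
have /(ae_eq_integral_abs P mD mZZ) : (\int[P]_(w in D) `|(Z' w)%:E - (Z w)%:E| = 0)%E.
  rewrite (eq_integral (fun w => ((Z' w)%:E - (Z w)%:E)%E)); last first.
    by move=> w; rewrite inE => Dw; rewrite gee0_abs// -EFinB lee_fin subr_ge0 ltW.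
  rewrite integralB_EFin// ZF'// ZF// subee// -ZF//.
  exact: integrable_fin_num.
apply: filterS => w /= ZZ; rewrite leNgt; apply/negP => Zw.
by have [] := ZZ Zw => /eqP; rewrite subr_eq0 => /eqP E; move: Zw; rewrite E ltxx.
Qed.

Lemma cond_expectation_ae (F Z : T -> R) : is_cond_expectation P (sigma_var X) F Z ->
  {ae P, forall w, cond_expectation P (sigma_var X) F w = Z w} /\
  measurable_fun setT (cond_expectation P (sigma_var X) F).
Proof.
move=> FZ; have FC : is_cond_expectation P (sigma_var X) F (cond_expectation P (sigma_var X) F).
  by apply: (@xgetPex _ (fun=> 0) [set Z | is_cond_expectation P (sigma_var X) F Z]); exists Z.
split; last by case: FC => CX _ _; exact: measurable_sigma_var.
apply: filterS2 (cond_expectation_le FC FZ) (cond_expectation_le FZ FC) => w ? ?.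
by apply/eqP; rewrite eq_le; apply/andP.
Qed.

End conditional_expectation.

Lemma ae_eq_Rintegral d (T : measurableType d) (R : realType)
    (P : {measure set T -> \bar R}) (f g : T -> R) :
  measurable_fun setT f -> measurable_fun setT g ->
  {ae P, forall w, f w = g w} -> \int[P]_w f w = \int[P]_w g w.
Proof.
move=> mf mg fg; congr fine; apply: ae_eq_integral => //; try exact/measurable_EFinP.
by apply: filterS fg => w fgw _; rewrite /= fgw.
Qed.

Lemma ae_eq_probability d (T : measurableType d) (R : realType)
    (P : probability T R) (A B : set T) : measurable A -> measurable B ->
  {ae P, forall w, A w <-> B w} -> P A = P B.
Proof.
move=> mA mB AB; rewrite -[A]setIT -[B]setIT -!integral_indic//.
apply: ae_eq_integral => //; try exact/measurable_EFinP.
apply: filterS AB => w ABw _; rewrite /= !indicE; congr (_%:R%:E); congr nat_of_bool.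
by apply/idP/idP; rewrite !inE => ?; apply/ABw.
Qed.

(** * Almost sure identification with the array on the product space *)

Section transfer_to_sample_space.
Context d (T : measurableType d) (R : realType) (P : probability T R).
Variables (Y : nat -> nat -> {RV P >-> R}) (phi : R * R * R -> R).
Variables (xi eta : nat -> {RV P >-> R}) (zeta : nat -> nat -> {RV P >-> R}).
Hypothesis Y_AHK : AHK_representation Y phi xi eta zeta.

Definition AHK_family (w : T) : prodspace R AHK_index :=
  fun k => AHK_variables xi eta zeta k w.

Lemma measurable_AHK_family : measurable_fun setT AHK_family.
Proof. by apply: measurable_to_prodspace => k; exact: measurable_funP. Qed.

HB.instance Definition _ := isMeasurableFun.Build _ _ _ _ AHK_family measurable_AHK_family.

Definition AHK_law : probability (prodspace R AHK_index) R := distribution P AHK_family.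

Lemma AHK_lawE A : measurable A -> pushforward P AHK_family A = AHK_law A.
Proof. by []. Qed.

Lemma AHK_iid : iid_law AHK_law (distribution P (xi 0%N)).
Proof.
have [_ indep unif _] := Y_AHK.
move=> s B us mB.
transitivity (P (\bigcap_(k in [set` s]) (AHK_variables xi eta zeta k : T -> R) @^-1` B k)).
  by [].
rewrite (indep s B us mB); apply: eq_bigr => k _.
exact: etrans (unif k (B k) (mB k)) (esym (unif (inl (inl 0%N)) (B k) (mB k))).
Qed.

(** The representing function is measurable only on the cube; extending it by zero makes it
    measurable everywhere and changes the array only on a null event. *)
Definition AHK_phi : R * R * R -> R := phi \_ (@unit_cube R).

Lemma measurable_AHK_phi : measurable_fun setT AHK_phi.
Proof.
have [mphi _ _ _] := Y_AHK.
apply/(measurable_restrictT _ _).1 => //.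
by apply: measurableX; [apply: measurableX|]; exact: measurable_itv.
Qed.

Lemma ae_AHK_itv k : {ae P, forall w, `[0, 1]%classic (AHK_family w k)}.
Proof.
have [_ _ unif _] := Y_AHK.
have m01 : measurable (~` `[0, 1]%classic : set R).
  by apply: measurableC; exact: measurable_itv.
exists (AHK_variables xi eta zeta k @^-1` (~` `[0, 1]%classic)); split.
- by rewrite -[X in measurable X]setTI; exact: measurable_funP.
- have := unif k _ m01; rewrite /distribution /pushforward => ->.
  by rewrite /uniform_prob integral_uniform_pdf setICl integral_set0.
- by move=> w.
Qed.

Lemma ae_array : {ae P, forall w, forall i j, Y i j w = array AHK_phi (AHK_family w) i j}.
Proof.
have [_ _ _ Yphi] := Y_AHK.
apply: ae_foralln => i; apply: ae_foralln => j.
apply: (filterS2 _ _ (Yphi i j)); last first.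
  apply: filterS3 (ae_AHK_itv (row_ix i)) (ae_AHK_itv (col_ix j)) (ae_AHK_itv (cell_ix (i, j))).
  by move=> w xi01 eta01 zeta01; exact: (conj xi01 (conj eta01 zeta01)).
move=> w -> [xi01 [eta01 zeta01]].
by rewrite /array /AHK_phi patchE ifT// inE; split; [split|].
Qed.

Variables (p q : nat) (h : 'M[R]_(p, q) -> R).
Hypothesis h_kernel : kernel_function h.
Hypothesis h_sqr : ('E_P[fun w => (h (leading_submatrix Y p q w) ^+ 2)%R] < +oo)%E.

Notation H := (kernel_at h AHK_phi id id).
Notation mu := AHK_law.

Lemma measurable_kernel_submatrix (r : 'I_p -> nat) (c : 'I_q -> nat) :
  measurable_fun setT (fun w => h (submatrix Y r c w)).
Proof.
apply: (measurable_kernel_fun h_kernel) => a b.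
by apply: eq_measurable_fun (measurable_funP (Y (r a) (c b))) => w _; rewrite mxE.
Qed.

Lemma ae_kernel : {ae P, forall w, h (leading_submatrix Y p q w) = H (AHK_family w)}.
Proof.
apply: filterS ae_array => w YE; rewrite /kernel_at; congr h.
by apply/matrixP => a b; rewrite !mxE YE.
Qed.

Lemma measurable_HX : measurable_fun setT (fun w => H (AHK_family w)).
Proof.
apply: measurableT_comp; last exact: measurable_AHK_family.
exact: measurable_kernel_at measurable_AHK_phi _ _.
Qed.

Lemma L2_H : L2 mu H.
Proof.
have mH := measurable_kernel_at h_kernel measurable_AHK_phi id id.
split; first exact: mH.
apply/(integrable_transfer AHK_lawE); first exact: measurable_funX.
have m1 : measurable_fun setT (fun w => H (AHK_family w) ^+ 2).
  by apply: measurable_funX; exact: measurable_HX.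
apply/integrableP; split; first exact/measurable_EFinP.
move: h_sqr; rewrite unlock; apply: le_lt_trans.
rewrite le_eqVlt; apply/orP; left; apply/eqP.
apply: ae_eq_integral => //.
- by apply: measurableT_comp => //; exact/measurable_EFinP.
- apply/measurable_EFinP; apply: measurable_funX.
  exact: measurable_kernel_submatrix.
- apply: filterS ae_kernel => w -> _ /=.
  by rewrite ger0_norm ?sqr_ge0.
Qed.

Lemma Uinfty_integral : Uinfty h Y = \int[mu]_x H x.
Proof.
rewrite (Rintegral_transfer AHK_lawE (L2_int L2_H)) /Uinfty unlock.
apply: ae_eq_Rintegral ae_kernel; last exact: measurable_HX.
exact: measurable_kernel_submatrix.
Qed.

Lemma integral_indicM (m : {measure set T -> \bar R}) (A : set T) (f : T -> R) :
  (\int[m]_(w in A) (f w)%:E = \int[m]_w (\1_A w * f w)%:E)%E.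
Proof.
rewrite integral_mkcond; apply: eq_integral => w _; rewrite patchE indicE.
by case: ifP => _; rewrite ?mul1r ?mul0r.
Qed.

(** The indicator of an event generated by the [k]-th variable is a function of that coordinate,
    which resampling the others leaves unchanged; it therefore factors out of the inner Fubini
    integral. *)
Lemma is_cond_expectation_kernel k (F : R -> R) : measurable_fun setT F ->
  (forall x, cmean mu k H x = F (x k)) ->
  is_cond_expectation P (sigma_var (AHK_variables xi eta zeta k : T -> R))
    (h \o leading_submatrix Y p q) (fun w => F (AHK_family w k)).
Proof.
move=> mF cF.
have LF : L2 mu (fun x => F (x k)).
  by have := L2_cmean AHK_iid k L2_H; congr L2; apply/funext => x; rewrite cF.
split.
- by move=> B mB; exists (F @^-1` B); rewrite ?setTI// -[X in measurable X]setTI; exact: mF.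
- exact/(integrable_transfer AHK_lawE LF.1).2/L2_int.
move=> _ [B mB <-]; rewrite setTI.
set A := _ @^-1` B.
have mA : measurable A by rewrite -[X in measurable X]setTI; exact: measurable_funP.
pose b (x : prodspace R AHK_index) : R := \1_B (x k).
have mb : measurable_fun setT b.
  have mB1 : measurable_fun setT (\1_B : R -> R) by exact: measurable_indic.
  exact: (measurableT_comp mB1 (@measurable_coord R AHK_index k)).
have Lb : L2 mu b.
  split => //; apply: (le_integrable _ _ _ (finite_measure_integrable_cst mu 1 measurableT)) => //.
    by apply/measurable_EFinP; exact: measurable_funX.
  move=> x _ /=; rewrite /b indicE lee_fin normr1.
  by case: (_ \in _); rewrite ?expr1n ?expr0n/= ?normr1 ?normr0.
have ibF := L2_mul Lb LF; have ibH := L2_mul Lb L2_H.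
have eq_mu : \int[mu]_x (b x * F (x k)) = \int[mu]_x (b x * H x).
  rewrite (Rintegral_mix AHK_iid (pred1 k) ibH); apply: eq_Rintegral => x _.
  rewrite -cF /cmean.
  have -> : (fun y => b (mix (pred1 k) (x, y)) * H (mix (pred1 k) (x, y))) =
      (fun y => b x * H (mix (pred1 k) (x, y))).
    by apply/funext => y; rewrite /b /mix/= eqxx.
  rewrite /b indicE; case: (_ \in _).
    by rewrite mul1r; under [RHS]eq_Rintegral do rewrite mul1r.
  by rewrite mul0r; under [RHS]eq_Rintegral do rewrite mul0r; rewrite Rintegral_prob_cst.
have iA (g : prodspace R AHK_index -> R) : mu.-integrable setT (EFin \o (fun x => b x * g x)) ->
    (\int[P]_(w in A) (g (AHK_family w))%:E = (\int[mu]_x (b x * g x))%:E)%E.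
  move=> ig; rewrite integral_indicM (Rintegral_transfer AHK_lawE ig) /Rintegral fineK//.
  have mg : measurable_fun setT (fun x => b x * g x).
    by apply/measurable_EFinP; exact: measurable_int ig.
  by apply: integrable_fin_num => //; exact/(integrable_transfer AHK_lawE mg).2.
rewrite (iA (fun x => F (x k)) ibF) eq_mu -(iA _ ibH).
apply: ae_eq_integral => //.
- by apply/measurable_EFinP; apply: measurable_funTS; exact: measurable_HX.
- by apply/measurable_EFinP; apply: measurable_funTS; exact: measurable_kernel_submatrix.
- by apply: filterS ae_kernel => w /= -> _.
Qed.

(** The conditional expectation has the mean of the kernel, so its variance is the second moment of
    the centered projection. *)
Lemma kernel_cond_varE k (F : R -> R) : measurable_fun setT F ->
  (forall x, cmean mu k H x = F (x k)) ->
  kernel_cond_var h Y (AHK_variables xi eta zeta k) =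
  \int[mu]_x ((F (x k) - \int[mu]_x H x) ^+ 2).
Proof.
move=> mF cF; have ce := is_cond_expectation_kernel mF cF.
have mX : measurable_fun setT (AHK_variables xi eta zeta k : T -> R) by exact: measurable_funP.
have [aeZ mZ] := cond_expectation_ae mX ce.
set Z := cond_expectation _ _ _ in aeZ mZ *.
have LF : L2 mu (fun x => F (x k)).
  by have := L2_cmean AHK_iid k L2_H; congr L2; apply/funext => x; rewrite cF.
have mFX : measurable_fun setT (fun w => F (AHK_family w k)).
  by apply: measurableT_comp.
have EZ : fine 'E_P[Z] = \int[mu]_x H x.
  rewrite unlock -/(Rintegral P setT Z) (ae_eq_Rintegral mZ mFX aeZ).
  rewrite -(Rintegral_transfer AHK_lawE (L2_int LF)).
  rewrite -(Rintegral_cmean AHK_iid k (L2_int L2_H)).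
  by apply: eq_Rintegral => x _; rewrite cF.
rewrite /kernel_cond_var -/Z /variance unlock EZ unlock.
set m0 := \int[mu]_x H x.
have [mFm iFm] : L2 mu (fun x => F (x k) - m0) by apply: L2B => //; exact: L2_cst.
rewrite (Rintegral_transfer AHK_lawE iFm).
rewrite -/(Rintegral P setT ((Z \- cst m0) * (Z \- cst m0))).
apply: ae_eq_Rintegral.
- by apply: measurable_funM; apply: measurable_funB.
- by apply: measurable_funX; apply: measurable_funB.
- by apply: filterS aeZ => w /= Zw; rewrite expr2 -Zw.
Qed.

Lemma measurable_mean (k : AHK_index) :
  measurable_fun setT (fun t : R => cmean mu k H (fun=> t)).
Proof.
apply: (measurableT_comp (measurable_cmean AHK_iid k (L2_int L2_H))).
by apply: measurable_to_prodspace.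
Qed.

Lemma asymptotic_varianceE rho :
  asymptotic_variance h Y xi eta rho = limit_var mu h AHK_phi rho.
Proof.
rewrite /asymptotic_variance /limit_var; congr (_ * _ + _ * _).
  exact: (kernel_cond_varE (measurable_mean (row_ix 0)) (@cmean_row _ _ _ _ h AHK_phi)).
exact: (kernel_cond_varE (measurable_mean (col_ix 0)) (@cmean_col _ _ _ _ h AHK_phi)).
Qed.

Lemma ae_Ustat m n : {ae P, forall w, Ustat h Y m n w = array_Ustat h AHK_phi m n (AHK_family w)}.
Proof.
apply: filterS ae_array => w YE; rewrite /Ustat /array_Ustat; congr (_ * _).
apply: eq_bigr => A /eqP Ap; apply: eq_bigr => B /eqP Bq.
rewrite /kernel_at; congr h; apply/matrixP => a b; rewrite !mxE YE.
by rewrite /enum_set Ap Bq !eqxx !ltn_ord.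
Qed.

Lemma measurable_Ustat m n : measurable_fun setT (Ustat h Y m n).
Proof.
apply: measurable_funM => //.
under eq_fun do rewrite -big_filter; apply: measurable_sum => A.
under eq_fun do rewrite -big_filter; apply: measurable_sum => B.
exact: measurable_kernel_submatrix.
Qed.

Lemma Ustat_law_le m n (c t x : R) :
  P [set w | c * (Ustat h Y m n w - t) <= x] =
  mu [set z | c * (array_Ustat h AHK_phi m n z - t) <= x].
Proof.
have le_measurable d' (S : measurableType d') (f : S -> R) :
    measurable_fun setT f -> measurable [set w | c * (f w - t) <= x].
  move=> mf; rewrite -[X in measurable X]setTI.
  have mg : measurable_fun setT (fun w => c * (f w - t)).
    by apply: measurable_funM => //; apply: measurable_funB.
  have -> : [set w | c * (f w - t) <= x] = (fun w => c * (f w - t)) @^-1` `]-oo, x].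
    by apply/seteqP; split => w /=; rewrite in_itv.
  by apply: mg => //; exact: measurable_itv.
have [mU _] := L2_array_Ustat AHK_iid L2_H m n.
rewrite -AHK_lawE; last exact: le_measurable.
apply: ae_eq_probability.
- exact/le_measurable/measurable_Ustat.
- rewrite -[X in measurable X]setTI; apply: measurable_AHK_family => //.
  exact: le_measurable.
- by apply: filterS (ae_Ustat m n) => w /= ->.
Qed.

End transfer_to_sample_space.

Theorem theorem4p1 (d : measure_display) (T : measurableType d) (R : realType)
    (P : probability T R) (Y : nat -> nat -> {RV P >-> R})
    (phi : R * R * R -> R) (xi eta : nat -> {RV P >-> R})
    (zeta : nat -> nat -> {RV P >-> R})
    (p q : nat) (h : 'M[R]_(p, q) -> R) (m n : nat -> nat) (rho : R) :
  RCE Y -> dissociated Y -> AHK_representation Y phi xi eta zeta ->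
  (0 < p)%N -> (0 < q)%N -> kernel_function h ->
  ('E_P[fun w => (h (leading_submatrix Y p q w) ^+ 2)%R] < +oo)%E ->
  (forall N : nat, (0 < N)%N -> (m N + n N)%N = N) ->
  0 < rho < 1 ->
  (m N)%:R / N%:R @[N --> \oo] --> rho ->
  (n N)%:R / N%:R @[N --> \oo] --> 1 - rho ->
  0 < asymptotic_variance h Y xi eta rho ->
  cvg_in_distribution P
    (fun N w => Num.sqrt N%:R * (Ustat h Y (m N) (n N) w - Uinfty h Y))
    (normal_prob 0 (Num.sqrt (asymptotic_variance h Y xi eta rho))).
Proof.
move=> _ _ Y_AHK p0 q0 h_kernel h_sqr _ rho01 m_rho n_rho.
rewrite (asymptotic_varianceE Y_AHK h_kernel h_sqr) => V0 x.
rewrite (Uinfty_integral Y_AHK h_kernel h_sqr) => x_cont.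
have HL2 := L2_H Y_AHK h_kernel h_sqr.
have := array_clt (AHK_iid Y_AHK) p0 q0 h_kernel HL2 rho01 m_rho n_rho V0 x_cont.
apply: cvg_trans; apply: near_eq_cvg; apply: nearW => N.
apply/esym/(Ustat_law_le Y_AHK h_kernel h_sqr).
Qed.
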